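(* Let $\alpha'\in[0,1)$. There exist $\sigma>0$, a body force $F_0\in L^{1+\sigma}((0,2);C^\sigma(\mathbb T^3))$ and a divergence-free initial datum $v_{\mathrm{in}}\in C^\infty(\mathbb T^3;\mathbb R^3)$ such that the 3d forced Euler equations $$\partial_t v+v\cdot\nabla v+\nabla p=F_0,\qquad\operatorname{div}v=0,\qquad v(0,\cdot)=v_{\mathrm{in}}$$ on $(0,2)\times\mathbb T^3$ admit at least two distinct admissible bounded solutions, one of which belongs to $L^1((0,2);C^{\alpha'}(\mathbb T^3))$.
   Context: $\mathbb T^3\simeq\mathbb R^3/\mathbb Z^3$ is the 3-dimensional torus. For $\alpha\in(0,1)$, $C^\alpha$ denotes $\alpha$-Hölder continuous functions with the usual norm; $C^0$ denotes continuous functions with the sup norm. Body forces are ($\mathbb R^3$-valued and) divergence-free. Weak solutions are understood in the sense of distributions: with $T=2$, $\operatorname{div}v=0$ and $\int_0^T\int_{\mathbb T^3}(v\cdot\partial_t\varphi+v\otimes v:\nabla\varphi+F_0\cdot\varphi)\,dx\,dt+\int_{\mathbb T^3}v_{\mathrm{in}}\cdot\varphi(0,\cdot)\,dx=0$ for all divergence-free $\varphi\in C^\infty_c([0,T)\times\mathbb T^3;\mathbb R^3)$. Bounded means in $L^\infty((0,2)\times\mathbb T^3)$. A weak solution $v\in L^\infty((0,T);L^2(\mathbb T^3))$ is admissible if $$\int_{\mathbb T^3}|v(x,t)|^2dx\le\int_{\mathbb T^3}|v_{\mathrm{in}}(x)|^2dx+2\int_0^t\int_{\mathbb T^3}F_0(x,s)\cdot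 v(x,s)\,dx\,ds\qquad\text{for a.e. }t\in(0,T).$$ *)

(* Defs.v *)
From HB Require Import structures.
From mathcomp Require Import all_boot all_order all_algebra.
From mathcomp Require Import all_classical all_reals all_analysis.

Set Implicit Arguments.
Unset Strict Implicit.
Unset Printing Implicit Defensive.

Import Order.TTheory GRing.Theory Num.Theory.
Import numFieldNormedType.Exports.

Local Open Scope classical_set_scope.
Local Open Scope ring_scope.

(* Points of R^3 are nested triples, so that the product topology, the product
   sigma-algebra and the product measure of the library apply to them; values
   of vector fields are row vectors.  Functions on the torus R^3/Z^3 are
   Z^3-periodic functions on R^3, and integrals over the torus are taken over
   the fundamental domain [0,1]^3. *)
Notation space3 R := (R * R * R)%type.
Notation vfield R := (space3 R -> 'rV[R]_3).

Section Torus.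
Context {R : realType}.
Local Notation mu := (@lebesgue_measure R).
Local Notation mu3 := ((mu \x mu) \x mu)%E.

Definition unit_vec (i : 'I_3) : space3 R :=
  ((i == 0%N :> nat)%:R, (i == 1%N :> nat)%:R, (i == 2%N :> nat)%:R).

Definition torus_periodic (W : Type) (f : space3 R -> W) : Prop :=
  forall x i, f (x + unit_vec i) = f x.

Definition cube : set (space3 R) := (`[0, 1] `*` `[0, 1]) `*` `[0, 1].

Definition dot (u w : 'rV[R]_3) : R := \sum_(i < 3) u 0 i * w 0 i.

(* The canonical norms of ['rV[R]_3] and [space3 R] are max norms. *)
Definition enorm (u : 'rV[R]_3) : R := Num.sqrt (dot u u).

Definition eucl_dist (x y : space3 R) : R :=
  Num.sqrt ((x.1.1 - y.1.1) ^+ 2 + (x.1.2 - y.1.2) ^+ 2 + (x.2 - y.2) ^+ 2).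

Definition partial (i : 'I_3) (f : space3 R -> R) (x : space3 R) : R :=
  'D_(unit_vec i) f x.

Definition div (u : vfield R) (x : space3 R) : R :=
  \sum_(i < 3) partial i (fun y => u y 0 i) x.

Fixpoint Ck (V W : normedModType R) (n : nat) (f : V -> W) : Prop :=
  match n with
  | 0%N => continuous f
  | m.+1 => continuous f /\
      forall v : V, (forall x, derivable f x v) /\ Ck m (fun x => 'D_v f x)
  end.

Definition smooth (V W : normedModType R) (f : V -> W) : Prop :=
  forall n, Ck n f.

(* For periodic fields the distance of R^3 and the quotient distance of the
   torus give the same Hoelder seminorm. *)
Definition sup_norm (f : vfield R) : \bar R :=
  ereal_sup (range (fun x => (enorm (f x))%:E)).

Definition holder_seminorm (a : R) (f : vfield R) : \bar R :=
  ereal_sup [set (enorm (f z.1 - f z.2) / eucl_dist z.1 z.2 `^ a)%:E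
            | z in [set z : space3 R * space3 R | z.1 != z.2]].

Definition C_norm (a : R) (f : vfield R) : \bar R :=
  if a == 0 then sup_norm f else (sup_norm f + holder_seminorm a f)%E.

(* [C_norm] and [inC] are meant for exponents in [0, 1[, and exponent 0 stands
   for continuous fields with the sup norm. *)
Definition inC (a : R) (f : vfield R) : Prop :=
  [/\ torus_periodic f, continuous f & (C_norm a f < +oo)%E].

Definition simple_in_C (a : R) (h : R -> vfield R) : Prop :=
  exists (m : nat) (A : 'I_m -> set R) (g : 'I_m -> vfield R),
    [/\ forall i, measurable (A i), forall i, inC a (g i) &
        forall t x, h t x = \sum_(i < m) \1_(A i) t *: g i x].

Definition strongly_measurable_in_C (T a : R) (f : R -> vfield R) : Prop :=
  exists h : nat -> R -> vfield R,
    (forall n, simple_in_C a (h n)) /\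
    {ae mu, forall t, t \in `]0, T[ ->
       C_norm a (fun x => h n t x - f t x) @[n --> \oo] --> 0%E}.

(* The Bochner space L^p((0,T); C^a(T^3)), for finite p. *)
Definition LpC (p T a : R) (f : R -> vfield R) : Prop :=
  [/\ strongly_measurable_in_C T a f,
      {ae mu, forall t, t \in `]0, T[ -> inC a (f t)} &
      (\int[mu]_(t in `]0%R, T[) (C_norm a (f t) `^ p) < +oo)%E].

Definition spacetime (T : R) : set (R * space3 R) := `]0, T[ `*` cube.

Definition measurable_field (T : R) (f : R -> vfield R) : Prop :=
  forall i : 'I_3,
    measurable_fun (`]0, T[ `*` setT) (fun z : R * space3 R => f z.1 z.2 0 i).

Definition distr_div_free (T : R) (f : R -> vfield R) : Prop :=
  forall psi : R -> space3 R -> R,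
    smooth (fun z : R * space3 R => psi z.1 z.2 : R) ->
    (forall t, torus_periodic (psi t)) ->
    (exists a b, [/\ 0 < a, b < T &
       forall t x, psi t x != 0 -> a <= t <= b]) ->
    (\int[mu]_(t in `]0%R, T[) \int[mu3]_(x in cube)
       (\sum_(i < 3) f t x 0 i * partial i (psi t) x)%:E = 0)%E.

(* Test functions on [0,T) x T^3: restrictions of smooth functions on
   R x T^3, so that smoothness holds up to t = 0. *)
Definition test_field (T : R) (phi : R -> vfield R) : Prop :=
  [/\ smooth (fun z : R * space3 R => phi z.1 z.2),
      forall t, torus_periodic (phi t),
      exists2 b, b < T & forall t x, b < t -> phi t x = 0 &
      forall t x, t \in `[0, T[ -> div (phi t) x = 0].

Definition weak_integrand (F v phi : R -> vfield R) (t : R) (x : space3 R) : R :=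
  \sum_(i < 3) v t x 0 i * derive1 (fun s => phi s x 0 i) t
  + \sum_(i < 3) \sum_(j < 3)
      v t x 0 i * v t x 0 j * partial j (fun y => phi t y 0 i) x
  + dot (F t x) (phi t x).

Definition weak_solution (T : R) (F : R -> vfield R) (vin : vfield R)
    (v : R -> vfield R) : Prop :=
  [/\ forall t, torus_periodic (v t), measurable_field T v, distr_div_free T v &
      forall phi, test_field T phi ->
        (\int[mu]_(t in `]0%R, T[) \int[mu3]_(x in cube)
            (weak_integrand F v phi t x)%:E
         + \int[mu3]_(x in cube) (dot (vin x) (phi 0 x))%:E = 0)%E].

Definition bounded_field (T : R) (v : R -> vfield R) : Prop :=
  exists M : R, {ae (mu \x mu3)%E, forall z, spacetime T z ->
    enorm (v z.1 z.2) <= M}.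

Definition energy (u : vfield R) : \bar R :=
  (\int[mu3]_(x in cube) (dot (u x) (u x))%:E)%E.

Definition LinftyL2 (T : R) (v : R -> vfield R) : Prop :=
  exists M : R, {ae mu, forall t, t \in `]0, T[ -> (energy (v t) <= M%:E)%E}.

Definition admissible (T : R) (F : R -> vfield R) (vin : vfield R)
    (v : R -> vfield R) : Prop :=
  LinftyL2 T v /\
  {ae mu, forall t, t \in `]0, T[ ->
    (energy (v t) <= energy vin
     + 2%:E * \int[mu]_(s in `]0%R, t[) \int[mu3]_(x in cube)
         (dot (F s x) (v s x))%:E)%E}.

Definition same_field (T : R) (v w : R -> vfield R) : Prop :=
  {ae (mu \x mu3)%E, forall z, spacetime T z -> v z.1 z.2 = w z.1 z.2}.

Definition body_force (T : R) (F : R -> vfield R) : Prop :=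
  [/\ forall t, torus_periodic (F t), measurable_field T F & distr_div_free T F].

End Torus.

(* Main.v *)
Require Import Defs.
From HB Require Import structures.
From mathcomp Require Import all_boot all_order all_algebra.
From mathcomp Require Import all_classical all_reals all_analysis.
From mathcomp Require Import measurable_realfun.
From mathcomp Require Import ring lra.

Set Implicit Arguments.
Unset Strict Implicit.
Unset Printing Implicit Defensive.

Import Order.TTheory GRing.Theory Num.Theory.
Import numFieldNormedType.Exports.

Local Open Scope classical_set_scope.
Local Open Scope ring_scope.

(** The solutions are two-and-a-half dimensional: no field depends on the third
coordinate, the horizontal velocity is a shear u, and the third component is a
scalar theta carried by u.  As the tensor square of a shear is divergence free,
such a pair solves the Euler equations with zero pressure and the force
(d_t u, 0).  Non-uniqueness comes from mixing theta perfectly at time 1, with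
horizontal shears alone, and then unmixing it in two different ways.

Mixing.  Time [0, 1[ is cut into infinitely many stages [T n, T n.+1[.  During
stage n the torus is sheared in one horizontal direction (the direction
alternates with n) by a triangle wave of amplitude scale n and wavelength
scale n.+1, where scale n.+1 = scale n / 256 ^ n.+1; the shear is switched on
smoothly and comes back to rest at the end of the stage.  At time T n the
initial profile theta0 = sin (2 pi x_1) has become theta n = theta0 o Z n, where
Z n is the inverse of the flow.  A triangle wave pushes the uniform measure of a
period to the uniform measure of its range.  Therefore, with A n the average of
theta n over segments of length scale n, averaging theta n.+1 over one
wavelength gives back A n, up to the Lipschitz constant of theta n times
scale n.+1 (A_step), and these errors are summable; besides, theta n - A n tends
to 0 weakly, as the segments become short (A_weak).  Followed along the flow, the averages converge uniformly to a
continuous function beta with |beta| <= 7/16 (beta_near, beta_bound), and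
theta0 o Z n - beta o Z n tends to 0 weakly (matched_beta): at time 1 the profile
theta0 cannot be told from beta.

Unmixing.  On ]1, 2] the shears are run backwards, with the force reflected in
time.  The first solution carries theta0 again, and is symmetric in time; the
second one carries beta.  Both are weak solutions: on each stage the weak
formulation is the transport identity (stage_weak), and the only possible
defect, a jump at time 1, is excluded by the weak convergence above
(ftc_across, weak_formulation).  Shears preserve the measure, so theta
contributes the constant 1/2 to the energy before time 1, and either 1/2 or
at most (7/16)^2 after it, while the horizontal kinetic energy equals the work
of the force (work_integral); hence both are admissible (admissible_sol).  At
the end, at time 2, they carry theta0 and beta, which differ (not_same_sol).

Regularity.  The time left at the beginning of stage n is scale n `^ gamma, with
gamma = (1 + alpha') / 2.  Up to constants, the gradient of the velocity is at
most 768 ^ n / scale n in stage n, so that the C^alpha' norm is at most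
768 ^ n times scale n `^ (- alpha'), which is integrable in time because
alpha' < gamma.  The force has size scale n `^ (1 - 2 * gamma) and gradient
larger by the factor 1 / scale n.+1, and for sigma = (1 - gamma) / 4 the power
1 + sigma of its C^sigma norm, times the length of the stage, is a power of
scale n with exponent 2 sigma + 7 sigma^2 > 0, up to factors geometric in n.
All the geometric factors are absorbed by scale_decay, as scale n decays
superexponentially. *)

(** * Measurability of continuous functions *)

(** Caratheodory functions: f is the pointwise limit of the functions obtained
by rounding the first variable down to a multiple of 1 / n.+1, and each of these
is measurable because it takes countably many slices.  Iterating the lemma gives
the joint measurability of continuous functions on products, for the product
sigma-algebra. *)
Lemma measurable_fun_caratheodory (R : realType) d (T : measurableType d) (f : R * T -> R) :
  (forall y, continuous (fun x => f (x, y))) ->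
  (forall x, measurable_fun setT (fun y => f (x, y))) ->
  measurable_fun setT f.
Proof.
move=> cf mf.
pose g (n : nat) (x : R) : R := (Num.floor (x * n.+1%:R))%:~R / n.+1%:R.
have gI n x : g n x <= x < g n x + n.+1%:R^-1.
  have n0 : 0 < n.+1%:R :> R by rewrite ltr0n.
  have /andP[h1 h2] := floor_itv (x * n.+1%:R).
  rewrite /g ler_pdivrMr// h1 /= -[X in _ + X]mul1r -mulrDl ltr_pdivlMr//.
  by move: h2; rewrite intrD.
pose F n (z : R * T) := f (g n z.1, z.2).
apply: (@measurable_realfun.measurable_fun_cvg _ _ _ setT F).
- move=> n _ Y mY; rewrite setTI.
  pose A (k : int) := [set z : R * T | Num.floor (z.1 * n.+1%:R) = k].
  have -> : F n @^-1` Y = \bigcup_(k in [set: int])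
      (A k `&` [set z | Y (f (k%:~R / n.+1%:R, z.2))]).
    apply/seteqP; split => z /=.
      by move=> Yz; exists (Num.floor (z.1 * n.+1%:R)).
    by move=> [k _ [/= <-]].
  apply: countable_bigcupT_measurable; first exact: countableP.
  move=> k; apply: measurableI.
  + have -> : A k = (fst : R * T -> R) @^-1` `[k%:~R / n.+1%:R, (k + 1)%:~R / n.+1%:R[.
      apply/seteqP; split => z /=; rewrite in_itv /= ler_pdivrMr ?ltr0n// ltr_pdivlMr ?ltr0n//.
        by rewrite /A /= => <-; exact: floor_itv.
      by move=> h; apply: floor_def.
    rewrite -[X in measurable X]setTI; exact: measurable_fst.
  + have h := measurableT_comp (mf (k%:~R / n.+1%:R)) (@measurable_snd _ _ R T).
    by have := h measurableT Y mY; rewrite setTI.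
- move=> [x y] _; rewrite /F /=.
  have gx : g n x @[n --> \oo] --> x.
    apply: (@squeeze_cvgr _ _ _ _ (fun n => x - n.+1%:R^-1) (fun n => x)).
    + near=> n; have /andP[h1 h2] := gI n x; rewrite h1 andbT.
      by rewrite lerBlDr ltW.
    + rewrite -[X in _ --> X]subr0; apply: cvgB; first exact: cvg_cst.
      exact: cvg_harmonic.
    + exact: cvg_cst.
  by apply: (@cvg_comp _ _ _ (fun n => g n x) (fun x => f (x, y)) _ _ _ gx); exact: cf.
Unshelve. all: by end_near. Qed.

Lemma continuous_pair (S T U : topologicalType) (f : S -> T) (g : S -> U) :
  continuous f -> continuous g -> continuous (fun x => (f x, g x)).
Proof. by move=> cf cg x; apply: cvg_pair; [exact: cf | exact: cg]. Qed.

Lemma continuous_comp2 (S T U : topologicalType) (f : S -> T) (g : T -> U) :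
  continuous f -> continuous g -> continuous (fun x => g (f x)).
Proof. by move=> cf cg x; apply: continuous_comp; [exact: cf | exact: cg]. Qed.

Lemma continuous_fst (S T : topologicalType) : continuous (@fst S T).
Proof. by move=> x; exact: cvg_fst. Qed.

Lemma continuous_snd (S T : topologicalType) : continuous (@snd S T).
Proof. by move=> x; exact: cvg_snd. Qed.

Lemma continuous_pairl (S T : topologicalType) (y : T) : continuous (fun x : S => (x, y)).
Proof. by move=> x; apply: cvg_pair; [exact: cvg_id | exact: cvg_cst]. Qed.

Lemma continuous_pairr (S T : topologicalType) (x : S) : continuous (fun y : T => (x, y)).
Proof. by move=> y; apply: cvg_pair; [exact: cvg_cst | exact: cvg_id]. Qed.

Lemma continuous_measurable2 (R : realType) (f : R * R -> R) :
  continuous f -> measurable_fun setT f.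
Proof.
move=> cf; apply: measurable_fun_caratheodory => [y|x].
  by apply: continuous_comp2 cf; exact: continuous_pairl.
apply: continuous_measurable_fun.
by apply: continuous_comp2 cf; exact: continuous_pairr.
Qed.

Lemma continuous_measurable3 (R : realType) (f : space3 R -> R) :
  continuous f -> measurable_fun setT f.
Proof.
move=> cf.
suff h : measurable_fun setT (fun z : R * (R * R) => f (z.2, z.1)).
  have -> : f = (fun z : R * (R * R) => f (z.2, z.1)) \o (@unstable.swap _ _).
    by apply/funext => -[].
  exact: (measurableT_comp h (@measurable_swap _ _ (R * R)%type R)).
apply: measurable_fun_caratheodory => [y|x] /=.
  by apply: continuous_comp2 cf; exact: continuous_pairr.
apply: continuous_measurable2.
by apply: continuous_comp2 cf; exact: continuous_pairl.
Qed.

Lemma continuous_measurable4 (R : realType) (f : R * space3 R -> R) :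
  continuous f -> measurable_fun setT f.
Proof.
move=> cf; apply: measurable_fun_caratheodory => [y|x].
  by apply: continuous_comp2 cf; exact: continuous_pairl.
apply: continuous_measurable3.
by apply: continuous_comp2 cf; exact: continuous_pairr.
Qed.

(** * Fubini theorem on rectangles *)

Section prod_sigma.
Local Open Scope ereal_scope.
Context d1 d2 (T1 : measurableType d1) (T2 : measurableType d2) (R : realType).
Variable m1 : {sigma_finite_measure set T1 -> \bar R}.
Variable m2 : {sigma_finite_measure set T2 -> \bar R}.

Lemma product_sigma_finite : sigma_finite setT (m1 \x m2).
Proof.
have /sigma_finiteP[F [TF ndF Foo]] := sigma_finiteT m1.
have /sigma_finiteP[G [TG ndG Goo]] := sigma_finiteT m2.
exists (fun n => F n `*` G n).
  rewrite -setXTT TF TG predeqE => -[x y]; split.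
    move=> [/= [n _ Fnx] [k _ Gky]]; exists (maxn n k) => //; split.
    - by move: x Fnx; exact/subsetPset/ndF/leq_maxl.
    - by move: y Gky; exact/subsetPset/ndG/leq_maxr.
  by move=> [n _ []/= ? ?]; split; exists n.
move=> k; have [? ?] := Foo k; have [? ?] := Goo k.
split; first exact: measurableX.
by rewrite product_measure1E// lte_mul_pinfty// ge0_fin_numE.
Qed.

(** Bundled with its sigma-finiteness, a product measure can be a factor of a further
product. *)
Definition product_sfm : {sigma_finite_measure set (T1 * T2)%type -> \bar R} :=
  HB.pack (m1 \x m2)
    (Measure_isSigmaFinite.Build _ _ _ (m1 \x m2) product_sigma_finite).
End prod_sigma.

Section fubini_rectangle.
Local Open Scope ereal_scope.
Context d1 d2 (T1 : measurableType d1) (T2 : measurableType d2) (R : realType).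
Variable m1 : {sigma_finite_measure set T1 -> \bar R}.
Variable m2 : {sigma_finite_measure set T2 -> \bar R}.
Variables (D1 : set T1) (D2 : set T2) (f : T1 * T2 -> R) (M : R).
Hypotheses (mD1 : measurable D1) (mD2 : measurable D2).
Hypotheses (fD1 : m1 D1 < +oo) (fD2 : m2 D2 < +oo).
Hypothesis mf : measurable_fun setT f.
Hypothesis bf : forall x y, D1 x -> D2 y -> (`|f (x, y)| <= M)%R.

Lemma integrable_rectangle : (m1 \x m2).-integrable (D1 `*` D2) (EFin \o f).
Proof.
apply: measurable_bounded_integrable.
- exact: measurableX.
- rewrite [X in X < _]product_measure1E //; apply: lte_mul_pinfty => //.
  by rewrite ge0_fin_numE.
- by apply: measurable_funTS.
- exists M; split; first exact: num_real.
  by move=> N MN [x y] [/= Dx Dy]; apply: (le_trans (bf Dx Dy)); exact: ltW.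
Qed.

(* Extension by zero turns integrals over a rectangle into integrals over the
whole product, where the Fubini theorem applies. *)
Let g := (EFin \o f) \_ (D1 `*` D2).

Let ig : (m1 \x m2).-integrable setT g.
Proof. exact: (integrable_mkcond _ (measurableX mD1 mD2)).1 integrable_rectangle. Qed.

Let gE1 x : \int[m2]_y g (x, y) =
  ((fun x => \int[m2]_(y in D2) (f (x, y))%:E) \_ D1) x.
Proof.
rewrite /g patchE; case: ifPn => Dx.
  rewrite [RHS]integral_mkcond; apply: eq_integral => y _; rewrite !patchE.
  by rewrite in_setX Dx.
rewrite -[RHS](integral0 m2 setT); apply: eq_integral => y _; rewrite patchE.
by rewrite in_setX (negbTE Dx).
Qed.

Let gE2 y : \int[m1]_x g (x, y) =
  ((fun y => \int[m1]_(x in D1) (f (x, y))%:E) \_ D2) y.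
Proof.
rewrite /g patchE; case: ifPn => Dy.
  rewrite [RHS]integral_mkcond; apply: eq_integral => x _; rewrite !patchE.
  by rewrite in_setX Dy andbT.
rewrite -[RHS](integral0 m1 setT); apply: eq_integral => x _; rewrite patchE.
by rewrite in_setX (negbTE Dy) andbF.
Qed.

Lemma integral_rectangle12 :
  \int[m1 \x m2]_(z in D1 `*` D2) (f z)%:E =
  \int[m1]_(x in D1) \int[m2]_(y in D2) (f (x, y))%:E.
Proof.
rewrite [LHS]integral_mkcond -[LHS](integral12_prod_meas1 ig) [RHS]integral_mkcond.
by apply: eq_integral => x _; rewrite /fubini_F gE1.
Qed.

Lemma integral_rectangle21 :
  \int[m1 \x m2]_(z in D1 `*` D2) (f z)%:E =
  \int[m2]_(y in D2) \int[m1]_(x in D1) (f (x, y))%:E.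
Proof.
rewrite [LHS]integral_mkcond -[LHS](integral21_prod_meas1 ig) [RHS]integral_mkcond.
by apply: eq_integral => x _; rewrite /fubini_G gE2.
Qed.

Lemma integrable_rectangle_section :
  m1.-integrable D1 (fun x => \int[m2]_(y in D2) (f (x, y))%:E).
Proof.
apply: (integrable_mkcond _ mD1).2; have := integrable_fubini_F ig.
by congr (integrable _ _ _); apply/funext => x; rewrite -gE1.
Qed.

End fubini_rectangle.

(** * Continuity and calculus in one variable *)

Lemma continuous_id_fun (T : topologicalType) : continuous (fun x : T => x).
Proof. by move=> x; exact: cvg_id. Qed.

Lemma continuous_cst_fun (T U : topologicalType) (c : U) : continuous (fun _ : T => c).
Proof. by move=> x; exact: cvg_cst. Qed.

Section continuous_algebra.
Context {R : realType} (T : topologicalType).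
Implicit Types f g : T -> R.

Lemma continuous_add f g : continuous f -> continuous g -> continuous (fun x => f x + g x).
Proof. by move=> cf cg x; apply: cvgD; [exact: cf | exact: cg]. Qed.

Lemma continuous_opp f : continuous f -> continuous (fun x => - f x).
Proof. by move=> cf x; apply: cvgN; exact: cf. Qed.

Lemma continuous_mul f g : continuous f -> continuous g -> continuous (fun x => f x * g x).
Proof. by move=> cf cg x; apply: cvgM; [exact: cf | exact: cg]. Qed.

Lemma continuous_exprn f n : continuous f -> continuous (fun x => f x ^+ n).
Proof.
move=> cf; elim: n => [|n IH]; first exact: continuous_cst_fun.
have -> : (fun x => f x ^+ n.+1) = (fun x => f x * f x ^+ n) by apply/funext => x; rewrite exprS.
exact: continuous_mul.
Qed.

Lemma continuous_abs f : continuous f -> continuous (fun x => `|f x|).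
Proof. by move=> cf x; apply: cvg_norm; exact: cf. Qed.

Lemma continuous_sum (n : nat) (F : 'I_n -> T -> R) :
  (forall i, continuous (F i)) -> continuous (fun x => \sum_(i < n) F i x).
Proof.
move=> cF; elim: n F cF => [|n IH] F cF.
  by under eq_fun do rewrite big_ord0; exact: continuous_cst_fun.
under eq_fun do rewrite big_ord_recl.
by apply: continuous_add; [exact: cF | apply: IH].
Qed.

Lemma continuous_fst_fun (S U : topologicalType) (f : T -> S * U) :
  continuous f -> continuous (fun x => (f x).1).
Proof. by move=> cf; apply: continuous_comp2 cf _; exact: continuous_fst. Qed.

Lemma continuous_snd_fun (S U : topologicalType) (f : T -> S * U) :
  continuous f -> continuous (fun x => (f x).2).
Proof. by move=> cf; apply: continuous_comp2 cf _; exact: continuous_snd. Qed.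
End continuous_algebra.

(** Syntax-directed proofs of continuity; the goals are unfolded forms of
[continuous], which is why the patterns mention [continuous_at]. *)
Ltac cont_step :=
  lazymatch goal with
  | |- forall z, continuous_at z (fun x => x) => exact: continuous_id_fun
  | |- forall z, continuous_at z (fun x => @?f x + @?g x) => apply: (@continuous_add _ _ f g)
  | |- forall z, continuous_at z (fun x => - @?f x) => apply: (@continuous_opp _ _ f)
  | |- forall z, continuous_at z (fun x => @?f x * @?g x) => apply: (@continuous_mul _ _ f g)
  | |- forall z, continuous_at z (fun x => @?f x ^+ ?n) => apply: (@continuous_exprn _ _ f n)
  | |- forall z, continuous_at z (fun x => `|@?f x|) => apply: (@continuous_abs _ _ f)
  | |- forall z, continuous_at z (fun x => (@?f x, @?g x)) => apply: (@continuous_pair _ _ _ f g)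
  | |- forall z, continuous_at z (fun x => fst (@?f x)) => apply: (@continuous_fst_fun _ _ _ f)
  | |- forall z, continuous_at z (fun x => snd (@?f x)) => apply: (@continuous_snd_fun _ _ _ f)
  | |- forall z, continuous_at z (fun _ => ?c) => exact: continuous_cst_fun
  | |- forall z, continuous_at z fst => exact: continuous_fst
  | |- forall z, continuous_at z snd => exact: continuous_snd
  | |- forall z, continuous_at z id => exact: continuous_id_fun
  end.
Ltac cont := repeat first [assumption | cont_step].

Section calculus.
Context {R : realType}.
Local Notation mu := (@lebesgue_measure R).
Implicit Types (f F p : R -> R) (a b c : R).

Lemma FTC2_closed F f a b : a <= b -> continuous f ->
  (forall x, a <= x <= b -> is_derive x 1 F (f x)) ->
  (\int[mu]_(x in `[a, b]) (f x)%:E = (F b - F a)%:E)%E.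
Proof.
rewrite le_eqVlt => /predU1P[<- _ _|ab cf dF].
  by rewrite set_itv1 integral_set1 subrr.
have cF x : a <= x <= b -> {for x, continuous F}.
  by move=> xab; apply/differentiable_continuous/derivable1_diffP; case: (dF x xab).
rewrite (@continuous_FTC2 _ f F)//.
- exact: continuous_subspaceT.
- split.
  + move=> x; rewrite in_itv /= => /andP[ax xb].
    by have [] := dF x; rewrite ?(ltW ax) ?(ltW xb).
  + by apply: cvg_at_right_filter; apply: cF; rewrite lexx ltW.
  + by apply: cvg_at_left_filter; apply: cF; rewrite lexx ltW.
- move=> x; rewrite in_itv /= => /andP[ax xb]; rewrite derive1E.
  by apply: derive_val; apply: dF; rewrite !ltW.
Qed.

Lemma MVT_closed F f a b : a <= b ->
  (forall x, a <= x <= b -> is_derive x 1 F (f x)) ->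
  exists2 c, a <= c <= b & F b - F a = f c * (b - a).
Proof.
move=> ab dF; have [] := @MVT_segment R F f a b ab.
- by move=> x; rewrite in_itv /= => /andP[ax xb]; apply: dF; rewrite !ltW.
- apply: derivable_within_continuous => x; rewrite in_itv /= => xab.
  by have [] := dF _ xab.
- by move=> c; rewrite in_itv /=; exists c.
Qed.

Lemma antiderivative p a b : continuous p ->
  exists F, forall x, a < x < b -> is_derive x 1 F (p x).
Proof.
move=> cp; exists (fun x => \int[mu]_(t in `[a, x]) p t) => x /andP[ax xb].
have ip : mu.-integrable `[a, b] (EFin \o p).
  by apply: continuous_compact_integrable; [exact: segment_compact|exact: continuous_subspaceT].
have [d1 d2] := continuous_FTC1_closed xb ip ax (cp x).
by apply: DeriveDef => //; rewrite -derive1E.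
Qed.

Lemma is_derive_comp_shift F f c x :
  is_derive (x + c) 1 F (f (x + c)) -> is_derive x 1 (fun x => F (x + c)) (f (x + c)).
Proof.
move=> h; have := @is_derive1_comp R F (fun x => x + c) x _ _ h.
have h2 : is_derive x 1 (fun x : R => x + c) 1.
  by rewrite -[X in is_derive _ _ _ X]addr0; apply: is_deriveD.
by move=> /(_ _ h2); rewrite mulr1.
Qed.

(** With F a primitive of p, both sides are values of F (y + 1) - F y, whose derivative
in y vanishes by periodicity. *)
Lemma integral_periodic_shift p c : continuous p -> (forall x, p (x + 1) = p x) ->
  (\int[mu]_(x in `[0%R, 1%R]) (p (x + c))%:E = \int[mu]_(x in `[0%R, 1%R]) (p x)%:E)%E.
Proof.
move=> cp pp; pose N : R := `|c| + 2.
have [F dF] := antiderivative (- N) N cp.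
have cN : - N + 2 <= c <= N - 2 by rewrite /N; have [h|h] := ger0P c; apply/andP; split; lra.
have c0 : 2 <= N by rewrite /N lerDr.
clearbody N.
have E y : y \in `[Num.min 0 c, Num.max 0 c] ->
   (\int[mu]_(x in `[0%R, 1%R]) (p (x + y))%:E = (F (y + 1) - F y)%:E)%E.
  rewrite in_itv /= => /andP[]; rewrite ge_min le_max => y1 y2.
  have yN : -N + 2 <= y <= N - 2.
    by move: y1 y2 => /orP[] + /orP[]; lra.
  rewrite (addrC y) -[in F y](add0r y).
  apply: (@FTC2_closed (fun x => F (x + y)) (fun x => p (x + y))) => //.
  - by apply: continuous_comp2 => // x; apply: cvgD => //; exact: cvg_cst.
  - by move=> x x01; apply: is_derive_comp_shift; apply: dF; lra.
have m0 : 0 \in `[Num.min 0 c, Num.max 0 c] by rewrite in_itv/= ge_min le_max lexx.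
have mc : c \in `[Num.min 0 c, Num.max 0 c] by rewrite in_itv/= ge_min le_max lexx !orbT.
rewrite (E _ mc).
transitivity (\int[mu]_(x in `[0%R, 1%R]) (p (x + 0)%R)%:E)%E; last first.
  by apply: eq_integral => x _; rewrite addr0.
rewrite (E _ m0); congr (_%:E).
pose D y := F (y + 1) - F y.
have dD y : y \in `[Num.min 0 c, Num.max 0 c] -> is_derive y 1 D 0.
  rewrite in_itv /= => /andP[]; rewrite ge_min le_max => y1 y2.
  have yN : -N + 2 <= y <= N - 2.
    by move: y1 y2 => /orP[] + /orP[]; lra.
  have -> : 0 = p (y + 1) - p y by rewrite pp subrr.
  by apply: is_deriveB; [apply: is_derive_comp_shift; apply: dF; lra | apply: dF; lra].
have dD' (x : R) : Num.min 0 c <= x <= Num.max 0 c -> is_derive x 1 D ((fun=> 0) x).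
  by move=> xc; apply: dD; rewrite in_itv.
have mM : Num.min 0 c <= Num.max 0 c by rewrite le_max ge_min lexx.
have [k _ ] := MVT_closed mM dD'.
rewrite mul0r => /eqP; rewrite subr_eq0 => /eqP.
by case: (lerP 0 c) => h.
Qed.

End calculus.

(** * Integrals over the torus *)

Section cube_integral.
Context {R : realType}.
Local Notation mu := (@lebesgue_measure R).
Local Notation mu3 := ((mu \x mu) \x mu)%E.
Local Notation cube := (@cube R).
Implicit Types (h g : space3 R -> R).

(** The measures of the cube as sigma-finite measures; they are convertible to the
product measures that define the integrals over the torus. *)
Definition mu2s := product_sfm mu mu.
Definition mu3s := product_sfm mu2s mu.

Definition cint h : R := (\int[mu3]_(x in cube) h x)%R.

Lemma lebesgue_unit_itv : mu `[0, 1] = 1%E.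
Proof. by rewrite lebesgue_measure_itv /= lte01 oppr0 adde0. Qed.

Lemma measurable_cube : measurable cube.
Proof. by apply: measurableX => //; apply: measurableX. Qed.

Lemma mu3_cube : mu3s cube = 1%E.
Proof.
pose I : set R := `[0, 1]%classic.
have mI : measurable I by exact: measurable_itv.
have -> : mu3s cube = (mu2s (I `*` I) * mu I)%E.
  exact: (product_measure1E mu2s mu (measurableX mI mI) mI).
have -> : mu2s (I `*` I) = (mu I * mu I)%E by exact: (product_measure1E mu mu mI mI).
by rewrite lebesgue_unit_itv !mule1.
Qed.

Lemma mu3_cube_lty : (mu3s cube < +oo)%E.
Proof. by rewrite mu3_cube ltey. Qed.

Lemma continuous_bounded_cube h : continuous h ->
  exists M, forall x, cube x -> `|h x| <= M.
Proof.
move=> ch.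
have cc : compact cube by apply: compact_setX; [apply: compact_setX|]; exact: segment_compact.
have : compact (h @` cube).
  by apply: continuous_compact => //; exact: continuous_subspaceT.
move=> /compact_bounded[M [_ HM]]; exists (M + 1) => x cx.
by apply: (HM (M + 1)); [rewrite ltrDl|exists x].
Qed.

Lemma continuous_bounded_slab (f : R * space3 R -> R) a b : continuous f ->
  exists M, forall t x, a <= t <= b -> cube x -> `|f (t, x)| <= M.
Proof.
move=> ch.
have cc : compact (`[a, b] `*` cube).
  apply: compact_setX; first exact: segment_compact.
  by apply: compact_setX; [apply: compact_setX|]; exact: segment_compact.
have : compact (f @` (`[a, b] `*` cube)).
  by apply: continuous_compact => //; exact: continuous_subspaceT.
move=> /compact_bounded[M [_ HM]]; exists (M + 1) => t x tab cx.
by apply: (HM (M + 1)); [rewrite ltrDl|exists (t, x) => //; split => //=; rewrite in_itv].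
Qed.

Lemma integrable_cube h : continuous h -> mu3s.-integrable cube (EFin \o h).
Proof.
move=> ch; have [M hM] := continuous_bounded_cube ch.
apply: measurable_bounded_integrable.
- exact: measurable_cube.
- exact: mu3_cube_lty.
- by apply: measurable_funTS; exact: continuous_measurable3.
- exists M; split; first exact: num_real.
  by move=> N MN x cx; apply: (le_trans (hM _ cx)); exact: ltW.
Qed.

Lemma cintE h : continuous h -> (\int[mu3]_(x in cube) (h x)%:E = (cint h)%:E)%E.
Proof.
move=> ch; rewrite /cint /Rintegral fineK //.
exact: (integrable_fin_num (mu := mu3s) measurable_cube (integrable_cube ch)).
Qed.

Lemma eq_cint h g : (forall x, cube x -> h x = g x) -> cint h = cint g.
Proof. by move=> hg; apply: eq_Rintegral => x /set_mem; exact: hg. Qed.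

Lemma cintD h g : continuous h -> continuous g ->
  cint (fun x => h x + g x) = cint h + cint g.
Proof.
move=> ch cg.
exact: (RintegralD (mu := mu3s) measurable_cube (integrable_cube ch) (integrable_cube cg)).
Qed.

Lemma cintB h g : continuous h -> continuous g ->
  cint (fun x => h x - g x) = cint h - cint g.
Proof.
move=> ch cg.
exact: (RintegralB (mu := mu3s) measurable_cube (integrable_cube ch) (integrable_cube cg)).
Qed.

Lemma cintZ k h : continuous h -> cint (fun x => k * h x) = k * cint h.
Proof.
move=> ch; exact: (RintegralZl (mu := mu3s) k measurable_cube (integrable_cube ch)).
Qed.

Lemma cint_cst k : cint (fun=> k) = k.
Proof.
rewrite [LHS](_ : _ = k * fine (mu3s cube)); last exact: (Rintegral_cst mu3s measurable_cube).
by rewrite mu3_cube mulr1.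
Qed.

Lemma le_cint h g : continuous h -> continuous g ->
  (forall x, cube x -> h x <= g x) -> cint h <= cint g.
Proof.
move=> ch cg hg.
exact: (le_Rintegral (mu := mu3s) measurable_cube (integrable_cube ch) (integrable_cube cg)).
Qed.

Lemma cint_bound h M : continuous h -> (forall x, cube x -> `|h x| <= M) ->
  `|cint h| <= M.
Proof.
move=> ch hM; rewrite ler_norml.
have cM (k : R) : continuous (fun _ : space3 R => k) by move=> ?; exact: cvg_cst.
rewrite -[X in _ <= _ <= X](cint_cst M) -[X in X <= _ <= _](cint_cst (- M)).
by apply/andP; split; apply: le_cint => // x /hM; rewrite ler_norml => /andP[].
Qed.

(** Fubini in the form used for transport identities: G x is known from the
fundamental theorem of calculus along the path of x. *)
Lemma integral_swap (f : R * space3 R -> R) (G : space3 R -> R) a b :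
  continuous f ->
  (forall x, \int[mu]_(t in `[a, b]) (f (t, x))%:E = (G x)%:E)%E ->
  (\int[mu]_(t in `[a, b]) (cint (fun x => f (t, x)))%:E =
   \int[mu3]_(x in cube) (G x)%:E)%E /\
  mu.-integrable `[a, b] (fun t => (cint (fun x => f (t, x)))%:E).
Proof.
move=> cf fG.
have [M hM] := continuous_bounded_slab a b cf.
have mf := continuous_measurable4 cf.
have bf t x : `[a, b]%classic t -> cube x -> `|f (t, x)| <= M.
  by rewrite /= in_itv /= => tab cx; exact: hM.
have fab : (mu `[a, b] < +oo)%E by rewrite lebesgue_measure_itv; case: ifP => _; rewrite ?ltey.
have fc := mu3_cube_lty.
have mab : measurable `[a, b] by [].
have cE t : (\int[mu3]_(x in cube) (f (t, x))%:E = (cint (fun x => f (t, x)))%:E)%E.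
  by apply: cintE; apply: continuous_comp2 cf; exact: continuous_pairr.
have E1 := integral_rectangle12 (m1 := mu) (m2 := mu3s) mab measurable_cube fab fc mf bf.
have E2 := integral_rectangle21 (m1 := mu) (m2 := mu3s) mab measurable_cube fab fc mf bf.
have I1 := integrable_rectangle_section (m1 := mu) (m2 := mu3s) mab measurable_cube fab fc mf bf.
split.
- transitivity (\int[mu]_(t in `[a, b]) \int[mu3]_(x in cube) (f (t, x))%:E)%E.
    by apply: eq_integral => t _; rewrite cE.
  apply: (etrans (esym E1)); rewrite E2; apply: eq_integral => x _; exact: fG.
- apply: eq_integrable I1; first by [].
  by move=> t _; rewrite -cE.
Qed.

End cube_integral.

Section torus_shift.
Context {R : realType}.
Local Notation mu := (@lebesgue_measure R).
Implicit Types (h : space3 R -> R) (x : space3 R) (i : 'I_3).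

(** Translation along a coordinate axis, written by cases so that coordinates
compute. *)
Definition moved i (c : R) x : space3 R :=
  match val i with
  | 0%N => (x.1.1 + c, x.1.2, x.2)
  | 1%N => (x.1.1, x.1.2 + c, x.2)
  | _ => (x.1.1, x.1.2, x.2 + c)
  end.

Lemma movedE i c x : moved i c x = x + c *: unit_vec i.
Proof.
case: x => -[x1 x2] x3; case: i => -[|[|[|//]]] ? /=; rewrite /moved /= /unit_vec /=;
  congr ((_, _), _) => /=; rewrite ?mulr0 ?mulr1 ?addr0 //;
  by rewrite /GRing.scale /= ?mulr0 ?mulr1 ?addr0.
Qed.

Lemma moved0 i x : moved i 0 x = x.
Proof. by rewrite movedE scale0r addr0. Qed.

Lemma movedD i a b x : moved i a (moved i b x) = moved i (a + b) x.
Proof. by rewrite !movedE scalerDl -addrA [b *: _ + _]addrC. Qed.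

Lemma moved_comm i j a b x : moved i a (moved j b x) = moved j b (moved i a x).
Proof. by rewrite !movedE addrAC. Qed.

Lemma periodic_moved1 (W : Type) (f : space3 R -> W) i x :
  torus_periodic f -> f (moved i 1 x) = f x.
Proof. by move=> pf; rewrite movedE scale1r pf. Qed.

Lemma continuous_moved (T : topologicalType) i (c : T -> R) (f : T -> space3 R) :
  continuous c -> continuous f -> continuous (fun y => moved i (c y) (f y)).
Proof.
move=> cc cf x; have -> : (fun y => moved i (c y) (f y)) = (fun y => f y + c y *: unit_vec i).
  by apply/funext => y; rewrite movedE.
by apply: cvgD; [exact: cf|apply: cvgZr_tmp; exact: cc].
Qed.

Local Notation I := (`[0%R, 1%R]%classic : set R).

(** Three orders of integration, the innermost variable being each of the three
coordinates in turn. *)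
Lemma cint_iter h : continuous h ->
  [/\ ((cint h)%:E = \int[mu2s]_(p in I `*` I) \int[mu]_(c in I) (h (p, c))%:E)%E,
      ((cint h)%:E = \int[mu]_(c in I) \int[mu]_(a in I) \int[mu]_(b in I) (h ((a, b), c))%:E)%E &
      ((cint h)%:E = \int[mu]_(c in I) \int[mu]_(b in I) \int[mu]_(a in I) (h ((a, b), c))%:E)%E].
Proof.
move=> ch.
have [M hM] := continuous_bounded_cube ch.
have mI : measurable I by exact: measurable_itv.
have mII : measurable (I `*` I) by exact: measurableX.
have fI : (mu I < +oo)%E by rewrite lebesgue_unit_itv ltey.
have eII : mu2s (I `*` I) = (mu I * mu I)%E by exact: (product_measure1E mu mu mI mI).
have fII : (mu2s (I `*` I) < +oo)%E by rewrite eII lebesgue_unit_itv mule1 ltey.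
have mh := continuous_measurable3 ch.
have bh p c : (I `*` I) p -> I c -> `|h (p, c)| <= M by move=> Ip Ic; exact: hM.
have E1 := integral_rectangle12 (m1 := mu2s) (m2 := mu) mII mI fII fI mh bh.
have E2 := integral_rectangle21 (m1 := mu2s) (m2 := mu) mII mI fII fI mh bh.
have mhc c : measurable_fun setT (fun p : R * R => h (p, c)).
  by apply: continuous_measurable2; apply: continuous_comp2 ch; exact: continuous_pairl.
have bhc c a b : I c -> I a -> I b -> `|h ((a, b), c)| <= M.
  by move=> Ic Ia Ib; exact: hM.
have E3 c (Ic : I c) := integral_rectangle12 (m1 := mu) (m2 := mu) mI mI fI fI (mhc c) (fun a b => @bhc c a b Ic).
have E4 c (Ic : I c) := integral_rectangle21 (m1 := mu) (m2 := mu) mI mI fI fI (mhc c) (fun a b => @bhc c a b Ic).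
rewrite -cintE //; split.
- exact: E1.
- by apply: (etrans E2); apply: eq_integral => c /set_mem Ic; exact: E3.
- by apply: (etrans E2); apply: eq_integral => c /set_mem Ic; exact: E4.
Qed.

(** A shear of the torus preserves the integral: on each line in direction i the
displacement c is constant, so that the shear restricts to a rotation of a
circle. *)
Lemma cint_moved h i (c : space3 R -> R) : continuous h -> torus_periodic h ->
  continuous c -> (forall r x, c (moved i r x) = c x) ->
  cint (fun x => h (moved i (c x) x)) = cint h.
Proof.
move=> ch ph cc ic; apply: EFin_inj.
have cg : continuous (fun x => h (moved i (c x) x)).
  by apply: continuous_comp2 ch; apply: continuous_moved; cont.
have key : forall x, (\int[mu]_(s in I) (h (moved i (c (moved i s x)) (moved i s x)))%:E
     = \int[mu]_(s in I) (h (moved i s x))%:E)%E.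
  move=> x; rewrite -(@integral_periodic_shift _ (fun s => h (moved i s x)) (c x)).
  - by apply: eq_integral => s _; rewrite ic movedD addrC.
  - apply: continuous_comp2 ch; apply: continuous_moved; cont.
  - by move=> s; rewrite addrC -movedD periodic_moved1.
have [E1 E2 E3] := cint_iter ch; have [F1 F2 F3] := cint_iter cg.
case: i key {ic cg} E1 E2 E3 F1 F2 F3 => -[|[|[|//]]] i3 key E1 E2 E3 F1 F2 F3.
- rewrite F3 E3; apply: eq_integral => x3 _; apply: eq_integral => x2 _.
  have := key ((0, x2), x3); rewrite /moved /= => k.
  by apply: (etrans _ (etrans k _)); apply: eq_integral => s _; rewrite add0r.
- rewrite F2 E2; apply: eq_integral => x3 _; apply: eq_integral => x1 _.
  have := key ((x1, 0), x3); rewrite /moved /= => k.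
  by apply: (etrans _ (etrans k _)); apply: eq_integral => s _; rewrite add0r.
- rewrite F1 E1; apply: eq_integral => -[x1 x2] _.
  have := key ((x1, x2), 0); rewrite /moved /= => k.
  by apply: (etrans _ (etrans k _)); apply: eq_integral => s _; rewrite add0r.
Qed.

End torus_shift.

(** * A chain rule for partial derivatives *)

Section chain_rule.
Context {R : realType}.

Lemma is_derive_cvg (V W : normedModType R) (f : V -> W) (x v : V) (l : W) :
  h^-1 *: (f (h *: v + x) - f x) @[h --> 0^'] --> l -> is_derive x v f l.
Proof.
move=> fl; have d : derivable f x v by apply/cvg_ex; exists l.
by apply: DeriveDef => //; apply: cvg_lim fl.
Qed.

Lemma is_deriveE (V W : normedModType R) (f : V -> W) (x v : V) (l : W) :
  is_derive x v f l -> h^-1 *: (f (h *: v + x) - f x) @[h --> 0^'] --> l.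
Proof. by move=> [d <-]; exact: d. Qed.

(** A product is differentiable at a zero of its second factor as soon as the first
factor is continuous there. *)
Lemma is_derive_mul0 (q w : R -> R) (t w' : R) : {for t, continuous q} ->
  is_derive t 1 w w' -> w t = 0 -> is_derive t 1 (fun s => q s * w s) (q t * w').
Proof.
move=> cq /is_deriveE dw w0; apply: is_derive_cvg.
have -> : (fun h : R => h^-1 *: (q (h *: 1 + t) * w (h *: 1 + t) - q t * w t)) =
  (fun h => q (h *: 1 + t) * (h^-1 *: (w (h *: 1 + t) - w t))).
  by apply/funext => h; rewrite w0 mulr0 !subr0 /GRing.scale /= mulrCA.
apply: cvgM => //.
have ht : h *: 1 + t @[h --> (0:R)^'] --> t.
  rewrite -[X in _ --> X]add0r -[X in _ --> X + _](scale0r (1 : R)).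
  apply: cvgD; last exact: cvg_cst.
  by apply: cvgZr_tmp; apply: nbhs_dnbhs.
exact: (@cvg_comp _ _ _ (fun h : R => h *: 1 + t) q _ _ _ ht cq).
Qed.

Lemma is_derive_line (V : normedModType R) (g : V -> R) (x e : V) (s : R) :
  derivable g (x + s *: e) e ->
  is_derive s 1 (fun s => g (x + s *: e)) ('D_e g (x + s *: e)).
Proof.
move=> dg; apply: is_derive_cvg.
have -> : (fun h : R => h^-1 *: (g (x + (h *: 1 + s) *: e) - g (x + s *: e))) =
  (fun h => h^-1 *: (g (h *: e + (x + s *: e)) - g (x + s *: e))).
  apply/funext => h; congr (_ *: (g _ - _)).
  have -> : h *: (1 : R) = h by rewrite /GRing.scale /= mulr1.
  by rewrite scalerDl addrCA.
exact: dg.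
Qed.

(** Differentiation of g along a curve c s + a s e, when the derivative A along the
curve with a frozen at time t is known.  By the mean value theorem the increment due
to a is 'D_e g (c s + q s e) (a s - a t) with q s between a t and a s. *)
Lemma is_derive_chain (V : normedModType R) (g : V -> R) (e : V) (c : R -> V)
    (a : R -> R) (t A a' : R) :
  (forall x, derivable g x e) -> continuous ('D_e g) -> {for t, continuous c} ->
  is_derive t 1 a a' -> is_derive t 1 (fun s => g (c s + a t *: e)) A ->
  is_derive t 1 (fun s => g (c s + a s *: e)) (A + 'D_e g (c t + a t *: e) * a').
Proof.
move=> dg cg cc da dA.
have ca : {for t, continuous a}.
  by apply/differentiable_continuous/derivable1_diffP; case: da.
have mvt s : exists q : R, g (c s + a s *: e) - g (c s + a t *: e) =
    'D_e g (c s + q *: e) * (a s - a t) /\ Num.min (a s) (a t) <= q <= Num.max (a s) (a t).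
  have dl (x : R) : is_derive x 1 (fun r => g (c s + r *: e)) ((fun r => 'D_e g (c s + r *: e)) x).
    exact: is_derive_line.
  have [h|h] := lerP (a t) (a s).
  - have [q hq E] := MVT_closed h (fun x _ => dl x).
    by exists q.
  - have [q hq E] := MVT_closed (ltW h) (fun x _ => dl x).
    by exists q; split => //; rewrite -opprB E -mulrN opprB.
(* A choice of the mean value point; the squeeze below makes it continuous at t. *)
pose q s := xget 0 [set q : R | g (c s + a s *: e) - g (c s + a t *: e) =
    'D_e g (c s + q *: e) * (a s - a t) /\ Num.min (a s) (a t) <= q <= Num.max (a s) (a t)].
have qP s : g (c s + a s *: e) - g (c s + a t *: e) =
    'D_e g (c s + q s *: e) * (a s - a t) /\ Num.min (a s) (a t) <= q s <= Num.max (a s) (a t).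
  by have [r hr] := mvt s; have := @xgetPex _ 0 _ (mvt s).
have qt : q t = a t.
  by have [_] := qP t; rewrite minxx maxxx => /le_anti.
have cq : {for t, continuous q}.
  have h1 : (fun s => Num.min (a s) (a t)) s @[s --> t] --> a t.
    rewrite -[X in _ --> X]minxx; apply: (@continuous_min _ _ a (fun=> a t)) => //.
    exact: cvg_cst.
  have h2 : (fun s => Num.max (a s) (a t)) s @[s --> t] --> a t.
    rewrite -[X in _ --> X]maxxx; apply: (@continuous_max _ _ a (fun=> a t)) => //.
    exact: cvg_cst.
  rewrite /prop_for /continuous_at qt.
  by apply: (squeeze_cvgr _ h1 h2); near=> s; have [] := qP s.
have -> : (fun s => g (c s + a s *: e)) =
    (fun s => g (c s + a t *: e) + 'D_e g (c s + q s *: e) * (a s - a t)).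
  by apply/funext => s; rewrite -(qP s).1 addrCA subrr addr0.
apply: is_deriveD.
have cD : {for t, continuous (fun s => 'D_e g (c s + q s *: e))}.
  apply: (@continuous_comp _ _ _ (fun s => c s + q s *: e) ('D_e g)); last exact: cg.
  by apply: cvgD => //; apply: cvgZr_tmp.
have dw : is_derive t 1 (fun s => a s - a t) a'.
  by rewrite -[X in is_derive _ _ _ X]subr0; apply: is_deriveB.
have := is_derive_mul0 cD dw (subrr _).
by rewrite qt.
Unshelve. all: by end_near. Qed.

End chain_rule.

(** * The weak formulation along a shear flow *)

Section stage.
Context {R : realType}.
Local Notation mu := (@lebesgue_measure R).
Implicit Types (g : R * space3 R -> R).

Definition dt g : R * space3 R -> R := 'D_((1, 0) : R * space3 R) g.
Definition dx (i : 'I_3) g : R * space3 R -> R := 'D_((0, unit_vec i) : R * space3 R) g.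

Definition periodic4 g := forall t, torus_periodic (fun x => g (t, x)).

(** What the proofs need of the components of test fields: all directional
derivatives, once, continuous. *)
Definition test_scalar g :=
  [/\ continuous g, forall v, (forall z, derivable g z v) /\ continuous ('D_v g)
    & periodic4 g].

Lemma eq_derive_increment (U V W : normedModType R) (h : U -> W) (k : V -> W) u v a b :
  (forall r : R, h (r *: u + a) - h a = k (r *: v + b) - k b) ->
  'D_u h a = 'D_v k b.
Proof.
move=> hk; rewrite /derive.
suff -> : (fun r : R => r^-1 *: ((h \o shift a) (r *: u) - h a)) =
  (fun r : R => r^-1 *: ((k \o shift b) (r *: v) - k b)) by [].
by apply/funext => r /=; rewrite hk.
Qed.

Lemma periodic4_derive g v : periodic4 g -> periodic4 ('D_v g).
Proof.
move=> pg t x i; apply: eq_derive_increment => r; rewrite (pg t x i).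
have -> : (r *: v + (t, x + unit_vec i) : R * space3 R) =
    ((r *: v).1 + t, ((r *: v).2 + x) + unit_vec i) by rewrite -addrA.
by rewrite (pg _ _ i).
Qed.

Lemma partialE g i t x : partial i (fun y => g (t, y)) x = dx i g (t, x).
Proof.
apply: eq_derive_increment => r; congr (g _ - _).
by congr (_, _); rewrite /= scaler0 add0r.
Qed.

Lemma derive1_dt g t x : derive1 (fun s => g (s, x)) t = dt g (t, x).
Proof.
rewrite derive1E; apply: eq_derive_increment => r; congr (g _ - _).
by congr (_, _); rewrite /= scaler0 add0r.
Qed.

(** The velocity is s' t f in the direction d, where f does not vary in the
directions d and 3, and the third component Th carried by this shear.  The
trajectories can be written down: [Psi] is the Lagrangian flow, and [back]
inverts its horizontal part.  The third component is constant along the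
trajectories, hence the displacement t Th. *)
Section lagrange.
Variables (d : 'I_3) (s s' : R -> R) (f Th : space3 R -> R).
Hypotheses (ds : forall t : R, is_derive t 1 s (s' t)) (cs : continuous s).
Hypotheses (cs' : continuous s').
Hypotheses (cf : continuous f) (pf : torus_periodic f).
Hypotheses (fd : forall r x, f (moved d r x) = f x).
Hypotheses (f3 : forall r x, f (moved ord_max r x) = f x).
Hypotheses (cTh : continuous Th) (pTh : torus_periodic Th).
Hypotheses (Th3 : forall r x, Th (moved ord_max r x) = Th x).

Definition back t x := moved d (- (s t * f x)) x.
Definition Psi t x := moved ord_max (t * Th x) (moved d (s t * f x) x).

(** The material derivative; the three coordinates of space-time are switched on one
after the other. *)
Lemma is_derive_along g (t : R) x : test_scalar g ->
  is_derive t 1 (fun r : R => g (r, Psi r x))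
    (dt g (t, Psi t x) + dx d g (t, Psi t x) * (s' t * f x)
     + dx ord_max g (t, Psi t x) * Th x).
Proof.
move=> [cg dg pg].
pose e0 : R * space3 R := (1, 0).
pose e1 : R * space3 R := (0, unit_vec d).
pose e2 : R * space3 R := (0, unit_vec ord_max).
have E r a b : (0, x) + r *: e0 + a *: e1 + b *: e2 =
    (r, moved ord_max b (moved d a x)).
  rewrite !movedE; congr (_, _) => /=; last by rewrite scaler0 addr0.
  by rewrite add0r !scaler0 !addr0 /GRing.scale /= mulr1.
have E' r a b : (0, x) + b *: e2 + r *: e0 + a *: e1 =
    (r, moved ord_max b (moved d a x)).
  by rewrite -E [in RHS]addrAC; congr (_ + _); rewrite addrAC.
have cline (y v : R * space3 R) : continuous (fun t : R => y + t *: v).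
  move=> r; apply: cvgD; first exact: cvg_cst.
  by apply: cvgZr_tmp; exact: cvg_id.
have dsf : is_derive t 1 (fun r : R => s r * f x) (s' t * f x).
  have -> : (fun r => s r * f x) = (fun r => f x *: s r).
    by apply/funext => r; rewrite mulrC.
  by rewrite mulrC; apply: is_deriveZ.
have dTh : is_derive t 1 (fun r : R => r * Th x) (Th x).
  have -> : (fun r : R => r * Th x) = (fun r : R => Th x *: r).
    by apply/funext => r; rewrite mulrC.
  rewrite -[X in is_derive _ _ _ X]mulr1.
  exact: (@is_deriveZ _ _ _ id (Th x) t 1 1 _).
have -> : (fun r : R => g (r, Psi r x)) =
    (fun r => g (((0, x) + r *: e0 + (s r * f x) *: e1) + (r * Th x) *: e2)).
  by apply/funext => r; rewrite E.
have h1 : is_derive t 1 (fun r : R => g (((0, x) + (t * Th x) *: e2 + r *: e0) + (s t * f x) *: e1))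
    (dt g (t, Psi t x)).
  have -> : (fun r : R => g (((0, x) + (t * Th x) *: e2 + r *: e0) + (s t * f x) *: e1)) =
     (fun r => g (((0, x) + (t * Th x) *: e2 + (s t * f x) *: e1) + r *: e0)).
    by apply/funext => r; rewrite addrAC.
  have -> : dt g (t, Psi t x) =
      'D_e0 g (((0, x) + (t * Th x) *: e2 + (s t * f x) *: e1) + t *: e0).
    by rewrite addrAC E'.
  by apply: is_derive_line; exact: (dg e0).1.
have h2 := is_derive_chain (dg e1).1 (dg e1).2 (cline _ e0 t) dsf h1.
have h3 : is_derive t 1 (fun r : R => g (((0, x) + r *: e0 + (s r * f x) *: e1) + (t * Th x) *: e2))
   (dt g (t, Psi t x) + dx d g (t, Psi t x) * (s' t * f x)).
  move: h2; rewrite E'; under eq_fun do rewrite E' -E.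
  exact: id.
have cc : {for t, continuous (fun r : R => (0, x) + r *: e0 + (s r * f x) *: e1)}.
  apply: cvgD; first exact: cline.
  apply: cvgZr_tmp; apply: cvgM; [exact: cs|exact: cvg_cst].
by have := is_derive_chain (dg e2).1 (dg e2).2 cc dTh h3; rewrite E.
Qed.

Lemma back_moved3 t r x : back t (moved ord_max r x) = moved ord_max r (back t x).
Proof. by rewrite /back f3 moved_comm. Qed.

Lemma back_periodic t x i : back t (x + unit_vec i) = back t x + unit_vec i.
Proof. by rewrite /back pf !movedE addrAC. Qed.

Lemma back_Psi t x : Th (back t (Psi t x)) = Th x.
Proof.
rewrite /Psi back_moved3 Th3 /back fd movedD addNr; congr (Th _).
by rewrite movedE scale0r addr0.
Qed.

Lemma continuous_Psi : continuous (fun z : R * space3 R => (z.1, Psi z.1 z.2)).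
Proof.
have cs1 : continuous (fun z : R * space3 R => s z.1).
  by apply: continuous_comp2 cs; exact: continuous_fst.
have cf2 : continuous (fun z : R * space3 R => f z.2).
  by apply: continuous_comp2 cf; exact: continuous_snd.
have cT2 : continuous (fun z : R * space3 R => Th z.2).
  by apply: continuous_comp2 cTh; exact: continuous_snd.
by apply: continuous_pair; [cont|apply: continuous_moved; [cont|apply: continuous_moved; cont]].
Qed.

(** The flow is the composition of two shears. *)
Lemma cint_Psi t (K : space3 R -> R) : continuous K -> torus_periodic K ->
  cint (fun x => K (Psi t x)) = cint K.
Proof.
move=> cK pK.
pose c2 y := t * Th (back t y).
have cb : continuous (fun y => back t y).
  by apply: continuous_moved; cont.
have cc2 : continuous c2.
  by apply: continuous_mul; [cont|apply: continuous_comp2 cTh].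
have ic2 r x : c2 (moved ord_max r x) = c2 x by rewrite /c2 back_moved3 Th3.
rewrite -(cint_moved cK pK cc2 ic2).
pose k2 y := K (moved ord_max (c2 y) y).
have ck2 : continuous k2.
  by apply: continuous_comp2 cK; apply: continuous_moved; cont.
have pk2 : torus_periodic k2.
  by move=> x i; rewrite /k2 /c2 back_periodic pTh !movedE addrAC pK.
rewrite -(@cint_moved _ k2 d (fun x => s t * f x)) //.
- apply: eq_cint => x _; rewrite /k2 /c2 /Psi; congr (K (moved _ (_ * _) _)).
  by rewrite /back fd movedD addNr moved0.
- by cont.
- by move=> r x; rewrite fd.
Qed.

(** The transport identity tested against g, for a quantity W written in Lagrangian
coordinates, whose time derivative W' is the contribution of the force: in these
coordinates the integrand K is the time derivative of W g, so the fundamental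
theorem of calculus applies for each trajectory, and Fubini and the invariance
of the measure under the flow bring the result back to Eulerian coordinates. *)
Lemma stage_scalar g (W W' : R * space3 R -> R) a b : a <= b -> test_scalar g ->
  continuous W -> continuous W' -> periodic4 W -> periodic4 W' ->
  (forall (t : R) x, is_derive t 1 (fun r : R => W (r, x)) (W' (t, x))) ->
  (forall t r x, W (t, moved ord_max r x) = W (t, x)) ->
  (forall t r x, W' (t, moved ord_max r x) = W' (t, x)) ->
  let K t x := W (t, back t x) * (dt g (t, x) + dx d g (t, x) * (s' t * f x)
     + dx ord_max g (t, x) * Th (back t x)) + W' (t, back t x) * g (t, x) in
  let E t := cint (fun x => W (t, back t x) * g (t, x)) in
  [/\ \int[mu]_(t in `[a, b]) cint (K t) = E b - E a,
      mu.-integrable `[a, b] (EFin \o (fun t => cint (K t))),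
      forall t, continuous (K t) &
      forall t, continuous (fun x => W (t, back t x) * g (t, x))].
Proof.
move=> ab tg cW cW' pW pW' dW W3 W3' K E; have [cg dg pg] := tg.
have backPsi U t x : (forall r y, U (t, moved ord_max r y) = U (t, y)) ->
    U (t, back t (Psi t x)) = U (t, x) :> R.
  by move=> U3; rewrite /Psi back_moved3 U3 /back fd movedD addNr moved0.
have cd v : continuous ('D_v g) := (dg v).2.
have ccomp (U : R * space3 R -> R) t : continuous U -> continuous (fun x => U (t, x)).
  by move=> cU; apply: continuous_comp2 cU; exact: continuous_pairr.
pose H z := W z * g (z.1, Psi z.1 z.2).
pose f4 z := W z * (dt g (z.1, Psi z.1 z.2) + dx d g (z.1, Psi z.1 z.2) * (s' z.1 * f z.2)
     + dx ord_max g (z.1, Psi z.1 z.2) * Th z.2) + W' z * g (z.1, Psi z.1 z.2).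
have cf4 : continuous f4.
  have cPsi (U : R * space3 R -> R) : continuous U -> continuous (fun z => U (z.1, Psi z.1 z.2)).
    by move=> cU; apply: continuous_comp2 cU; exact: continuous_Psi.
  have h1 : continuous (fun z : R * space3 R => s' z.1).
    by apply: continuous_comp2 cs'; exact: continuous_fst.
  have h2 : continuous (fun z : R * space3 R => f z.2).
    by apply: continuous_comp2 cf; exact: continuous_snd.
  have h3 : continuous (fun z : R * space3 R => Th z.2).
    by apply: continuous_comp2 cTh; exact: continuous_snd.
  by do 2 ?[apply: continuous_add]; repeat (first [apply: continuous_add|apply: continuous_mul|assumption|apply: cPsi|exact: cd]).
have dH (t : R) x : is_derive t 1 (fun r => H (r, x)) (f4 (t, x)).
  have h := @is_deriveM _ _ (fun r => W (r, x)) (fun r => g (r, Psi r x)) t 1 _ _ (dW t x) (is_derive_along t x tg).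
  apply: is_derive_eq h _.
  by rewrite /f4 /GRing.scale /= [g _ * _]mulrC.
have IH x : (\int[mu]_(t in `[a, b]) (f4 (t, x))%:E = (H (b, x) - H (a, x))%:E)%E.
  apply: (@FTC2_closed _ (fun r => H (r, x)) (fun r => f4 (r, x))) => //.
  by apply: continuous_comp2 cf4; exact: continuous_pairl.
have cK t : continuous (K t).
  have cb (U : R * space3 R -> R) : continuous U -> continuous (fun x => U (t, back t x)).
    move=> cU; apply: continuous_comp2 cU.
    by apply: continuous_pair; [cont|apply: continuous_moved; cont].
  have cThb : continuous (fun x => Th (back t x)).
    by apply: continuous_comp2 cTh; apply: continuous_moved; cont.
  by repeat (first [apply: continuous_add|apply: continuous_mul|assumption|exact: continuous_cst_fun|apply: cb|apply: ccomp|exact: cd]).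
have KE t : cint (fun x => f4 (t, x)) = cint (K t).
  rewrite -(@cint_Psi t (K t)) //.
  - apply: eq_cint => x _; rewrite /f4 /K /= !backPsi //.
    by rewrite back_Psi /Psi f3 fd.
  - move=> x i; rewrite /K !back_periodic pW pW' pTh pf.
    have pd v : 'D_v g (t, x + unit_vec i) = 'D_v g (t, x) by exact: (periodic4_derive _ pg).
    by rewrite (pg t) /dt /dx !pd.
have cE t : continuous (fun x => W (t, back t x) * g (t, x)).
  apply: continuous_mul; last exact: ccomp.
  apply: continuous_comp2 cW.
  by apply: continuous_pair; [cont|apply: continuous_moved; cont].
have EE t : cint (fun x => H (t, x)) = E t.
  rewrite /E -(@cint_Psi t (fun x => W (t, back t x) * g (t, x))) //.
  - by apply: eq_cint => x _; rewrite backPsi.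
  - by move=> x i; rewrite back_periodic pW (pg t).
have [I1 I2] := integral_swap cf4 IH.
have cH t : continuous (fun x => H (t, x)).
  apply: (ccomp H); apply: continuous_mul => //.
  by apply: continuous_comp2 cg; exact: continuous_Psi.
split => //.
- apply: EFin_inj; rewrite /Rintegral fineK; last first.
    apply: integrable_fin_num => //; apply: eq_integrable I2 => // t _.
    by rewrite /= KE.
  transitivity (\int[mu]_(t in `[a, b]) (cint (fun x => f4 (t, x)))%:E)%E.
    by apply: eq_integral => t _; rewrite KE.
  rewrite I1 cintE; last by apply: continuous_add => //; apply: continuous_opp.
  by rewrite cintB // !EE.
- by apply: eq_integrable I2 => // t _; rewrite /= KE.
Qed.

End lagrange.
End stage.

(** * The triangle wave *)

Section triangle_wave.
Context {R : realType}.
Local Notation mu := (@lebesgue_measure R).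
Implicit Types (y z : R) (q : R -> R).

Definition av q : R := \int[mu]_(r in `[0, 1]) q r.

Lemma integrable_unit q : continuous q -> mu.-integrable `[0, 1] (EFin \o q).
Proof.
move=> cq; apply: continuous_compact_integrable; first exact: segment_compact.
exact: continuous_subspaceT.
Qed.

Lemma avE q : continuous q -> (\int[mu]_(r in `[0%R, 1%R]) (q r)%:E = (av q)%:E)%E.
Proof.
move=> cq; rewrite /av /Rintegral fineK //.
by apply: integrable_fin_num => //; exact: integrable_unit.
Qed.

Lemma avB q q' : continuous q -> continuous q' ->
  av (fun r => q r - q' r) = av q - av q'.
Proof. by move=> cq cq'; apply: RintegralB => //; exact: integrable_unit. Qed.

Lemma av_cst (k : R) : av (fun=> k) = k.
Proof. by rewrite /av Rintegral_cst //= lebesgue_unit_itv mulr1. Qed.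

Lemma av_bound q (M : R) : continuous q -> (forall r, 0 <= r <= 1 -> `|q r| <= M) ->
  `|av q| <= M.
Proof.
move=> cq qM; rewrite ler_norml -[X in _ <= _ <= X]av_cst -[X in X <= _ <= _]av_cst.
have cc (k : R) : continuous (fun _ : R => k) by exact: continuous_cst_fun.
apply/andP; split; apply: le_Rintegral => //; try exact: integrable_unit.
- by move=> x /=; rewrite in_itv /= => /qM; rewrite ler_norml => /andP[].
- by move=> x /=; rewrite in_itv /= => /qM; rewrite ler_norml => /andP[].
Qed.

Lemma eq_av q q' : (forall r, 0 <= r <= 1 -> q r = q' r) -> av q = av q'.
Proof. by move=> h; apply: eq_Rintegral => r /set_mem /=; rewrite in_itv /=; exact: h. Qed.

Lemma av_shift q c : continuous q -> (forall r, q (r + 1) = q r) ->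
  av (fun r => q (r + c)) = av q.
Proof.
by move=> cq pq; rewrite /av /Rintegral integral_periodic_shift.
Qed.

(** Vanishes at the half-integers and equals 1 at the integers. *)
Definition tri y : R := `|2 * (y - (Num.floor y)%:~R) - 1|.

(** With [tri_eq], this says that tri is the supremum over the integers k of
1 - 2 |y - k|, from which the Lipschitz bound, the periodicity and the symmetry
follow without any case analysis. *)
Lemma tri_ge (k : int) y : 1 - 2 * `|y - k%:~R| <= tri y.
Proof.
have /andP[h1 h2] := floor_itv y; rewrite intrD in h2; rewrite /tri.
have [kf|kf] := lerP k (Num.floor y).
  have : k%:~R <= (Num.floor y)%:~R :> R by rewrite ler_int.
  move=> k1; rewrite ger0_norm; last lra.
  have := ler_norm (- (2 * (y - (Num.floor y)%:~R) - 1)); rewrite normrN; lra.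
have : (Num.floor y)%:~R + 1 <= k%:~R :> R by rewrite -[1]/(1%:~R) -intrD ler_int lezD1.
move=> k1; rewrite ler0_norm; last lra.
have := ler_norm (2 * (y - (Num.floor y)%:~R) - 1); lra.
Qed.

Lemma tri_eq y : exists k : int, tri y = 1 - 2 * `|y - k%:~R|.
Proof.
have /andP[h1 h2] := floor_itv y; rewrite intrD in h2; rewrite /tri.
have [h|h] := lerP (2 * (y - (Num.floor y)%:~R)) 1.
  by exists (Num.floor y); rewrite ger0_norm; lra.
by exists (Num.floor y + 1); rewrite intrD ler0_norm; lra.
Qed.

Lemma tri_lip y z : `|tri y - tri z| <= 2 * `|y - z|.
Proof.
have H u v : tri u - tri v <= 2 * `|u - v|.
  have [k ->] := tri_eq u; have := tri_ge k v.
  have : `|v - k%:~R| <= `|u - v| + `|u - k%:~R|.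
    by rewrite (distrC u v); apply: le_trans (ler_normD _ _); rewrite addrA subrK.
  by move=> *; lra.
rewrite ler_norml H andbT; have := H z y; rewrite distrC => *; lra.
Qed.

Lemma tri_ge0 y : 0 <= tri y. Proof. exact: normr_ge0. Qed.

Lemma tri_le1 y : tri y <= 1.
Proof. by have [k ->] := tri_eq y; rewrite gerBl mulr_ge0. Qed.

Lemma triDz y (m : int) : tri (y + m%:~R) = tri y.
Proof.
apply/eqP; rewrite eq_le; apply/andP; split.
- have [k ->] := tri_eq (y + m%:~R); apply: le_trans (tri_ge (k - m) y).
  by rewrite intrB opprB addrCA addrA [y + _]addrC addrC.
- have [k ->] := tri_eq y; apply: le_trans (tri_ge (k + m) _).
  by rewrite intrD opprD addrACA subrr addr0.
Qed.

Lemma triDn y (m : nat) : tri (y + m%:R) = tri y.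
Proof. exact: (triDz y m). Qed.

Lemma triN y : tri (- y) = tri y.
Proof.
have H u : tri (- u) <= tri u.
  have [k ->] := tri_eq (- u); apply: le_trans (tri_ge (- k) u).
  by rewrite mulrNz -opprD normrN opprK.
by apply/eqP; rewrite eq_le H -{1}[y]opprK H.
Qed.

Lemma tri_unit y : 0 <= y <= 1 -> tri y = `|2 * y - 1|.
Proof.
move=> /andP[y0]; rewrite le_eqVlt => /predU1P[->|y1].
  have -> : tri 1 = tri 0 by rewrite -(triDn 0 1) add0r.
  by rewrite /tri floor0 subr0 mulr0 sub0r normrN normr1 ger0_norm; lra.
by rewrite /tri (@floor_def _ y 0) ?subr0 // y0.
Qed.

Lemma lipschitz_continuous (q : R -> R) (L : R) :
  (forall y z, `|q y - q z| <= L * `|y - z|) -> continuous q.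
Proof.
move=> hq y; apply/cvgrPdist_le => e e0; near=> z.
apply: (le_trans (hq y z)).
have L1 : 0 < `|L| + 1 by rewrite ltr_wpDl.
apply: (@le_trans _ _ ((`|L| + 1) * `|y - z|)).
  by rewrite ler_wpM2r //; apply: (le_trans (ler_norm L)); rewrite lerDl.
rewrite -ler_pdivlMl //; near: z.
apply: (@cvgr_dist_le _ _ _ _ _ (fun z : R => z)); first exact: cvg_id.
by rewrite mulr_gt0 ?invr_gt0.
Unshelve. all: by end_near. Qed.

Lemma continuous_tri : continuous tri.
Proof. exact: lipschitz_continuous tri_lip. Qed.

(** Both branches of the wave cover the unit interval linearly, each on a set of half
the length. *)
Lemma av_tri_unit (G : R -> R) : continuous G -> av (fun r => G `|2 * r - 1|) = av G.
Proof.
move=> cG; have [F dF] := @antiderivative R G (-1) 2 cG.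
have cGa : continuous (fun r : R => G `|2 * r - 1|).
  by apply: continuous_comp2 cG; cont.
have dF' (k b : R) (r : R) : -1 < k * r + b < 2 ->
    is_derive r 1 (fun r : R => F (k * r + b)) (G (k * r + b) * k).
  move=> h; have dk : is_derive r 1 (fun r : R => k * r + b) k.
    rewrite -[X in is_derive _ _ _ X]addr0; apply: is_deriveD.
    rewrite -[X in is_derive _ _ _ X]mulr1.
    exact: (@is_deriveZ _ _ _ id k r 1 1 _).
  exact: (@is_derive1_comp R F (fun r : R => k * r + b) r _ _ (dF _ h) dk).
have half0 : 0 <= (2^-1 : R) by rewrite invr_ge0.
have E1 : (\int[mu]_(r in `[0%R, 2^-1%R]) (G `|2 * r - 1|)%:E = (2^-1 * (F 1 - F 0))%:E)%E.
  transitivity (\int[mu]_(r in `[0%R, 2^-1%R]) (G ((-2) * r + 1))%:E)%E.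
    apply: eq_integral => r /set_mem /=; rewrite in_itv /= => /andP[r0 r1].
    by rewrite ler0_norm; [congr (G _)%:E|]; lra.
  pose Q (r : R) := - 2^-1 * F (-2 * r + 1).
  transitivity (Q 2^-1 - Q 0)%:E; last first.
    congr (_%:E); rewrite /Q mulr0 add0r (_ : -2 * 2^-1 + 1 = 0 :> R); last lra.
    by lra.
  apply: (@FTC2_closed _ Q (fun r => G (-2 * r + 1))) => //.
    by apply: continuous_comp2 cG; cont.
  move=> r r01; have h : -1 < (-2) * r + 1 < 2 by apply/andP; split; lra.
  have -> : G (-2 * r + 1) = - 2^-1 *: (G (-2 * r + 1) * -2) by rewrite /GRing.scale /=; lra.
  by apply: is_deriveZ; exact: dF'.
have E2 : (\int[mu]_(r in `[2^-1%R, 1%R]) (G `|2 * r - 1|)%:E = (2^-1 * (F 1 - F 0))%:E)%E.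
  transitivity (\int[mu]_(r in `[2^-1%R, 1%R]) (G (2 * r + -1))%:E)%E.
    apply: eq_integral => r /set_mem /=; rewrite in_itv /= => /andP[r0 r1].
    by rewrite ger0_norm //; lra.
  pose Q (r : R) := 2^-1 * F (2 * r + -1).
  transitivity (Q 1 - Q 2^-1)%:E; last first.
    congr (_%:E); rewrite /Q (_ : 2 * 1 + -1 = 1 :> R); last lra.
    by rewrite (_ : 2 * 2^-1 + -1 = 0 :> R); lra.
  apply: (@FTC2_closed _ Q (fun r => G (2 * r + -1))) => //.
  - lra.
  - by apply: continuous_comp2 cG; cont.
  move=> r r01; have h : -1 < 2 * r + -1 < 2 by apply/andP; split; lra.
  have -> : G (2 * r + -1) = 2^-1 *: (G (2 * r + -1) * 2) by rewrite /GRing.scale /=; lra.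
  by apply: is_deriveZ; exact: dF'.
have E3 : av G = F 1 - F 0.
  apply: EFin_inj; rewrite -avE //; apply: FTC2_closed => // r r01.
  by apply: dF; apply/andP; split; lra.
rewrite E3; apply: EFin_inj; rewrite -avE //.
have -> : `[0%R, 1%R]%classic = (`[0%R, 2^-1%R[ `|` `[2^-1%R, 1%R])%classic :> set R.
  by rewrite -itv_bndbnd_setU // bnd_simp //; lra.
rewrite integral_setU //; last first.
- apply/disj_setPS => r [/=]; rewrite !in_itv /= => /andP[_ h1] /andP[h2 _].
  by have := lt_le_trans h1 h2; rewrite ltxx.
- rewrite -itv_bndbnd_setU //; [|by rewrite bnd_simp; lra ..].
  by apply: measurable_funTS; apply/measurable_EFinP; exact: continuous_measurable_fun.
transitivity ((2^-1 * (F 1 - F 0))%:E + (2^-1 * (F 1 - F 0))%:E)%E; last first.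
  by rewrite -EFinD; congr (_%:E); lra.
congr (_ + _)%E; last exact: E2.
apply: etrans E1; apply: integral_itv_bndo_bndc.
by apply: measurable_funTS; apply/measurable_EFinP; exact: continuous_measurable_fun.
Qed.

(** The triangle wave pushes the uniform measure of a period, with any phase c, to the
uniform measure of the unit interval.  This is the whole mixing mechanism. *)
Lemma av_tri (G : R -> R) c : continuous G -> av (fun r => G (tri (c - r))) = av G.
Proof.
move=> cG; rewrite -[RHS](av_tri_unit cG).
have cq : continuous (fun r => G (tri r)).
  by apply: continuous_comp2 cG; exact: continuous_tri.
have -> : av (fun r => G `|2 * r - 1|) = av (fun r => G (tri r)).
  by apply: eq_av => r r01; rewrite tri_unit.
rewrite -[RHS](@av_shift (fun r => G (tri r)) (- c)) //; last first.
  by move=> r; rewrite (triDn r 1).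
by apply: eq_av => r _; rewrite -triN opprB.
Qed.

End triangle_wave.

(** * The cascade of shears *)

Section cascade.
Context {R : realType}.
Implicit Types (x y : space3 R) (n m k : nat) (r s : R).

(** The frequencies 256 ^ (n (n + 1) / 2) are integers, so that the waves are periodic
on the torus, and grow faster than any geometric sequence. *)
Fixpoint freq n : nat := if n is m.+1 then (freq m * 256 ^ m.+1)%N else 1%N.

Definition scale n : R := (freq n)%:R^-1.

Definition dir n : 'I_3 :=
  if odd n then @Ordinal 3 1 isT else @Ordinal 3 0 isT.

(** The coordinate on which the shear of stage n depends. *)
Definition across n x : R := if odd n then x.1.1 else x.1.2.

Definition shear n x : R := scale n * tri (across n x * (freq n.+1)%:R).

Definition Phi n s x := moved (dir n) (s * shear n x) x.

Lemma freq_gt0 n : (0 < freq n)%N.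
Proof. by elim: n => //= n IH; rewrite muln_gt0 IH expn_gt0. Qed.

Lemma freqR_gt0 n : 0 < (freq n)%:R :> R.
Proof. by rewrite ltr0n freq_gt0. Qed.

Lemma scale_gt0 n : 0 < scale n.
Proof. by rewrite invr_gt0 freqR_gt0. Qed.

Lemma scaleS n : scale n = scale n.+1 * 256 ^+ n.+1.
Proof.
by rewrite /scale /= natrM invfM natrX -mulrA mulVf ?mulr1 // expf_neq0.
Qed.

Lemma scale_freq n : scale n * (freq n)%:R = 1.
Proof. by rewrite /scale mulVf // gt_eqF // freqR_gt0. Qed.

Lemma scale_le1 n : scale n <= 1.
Proof. by rewrite invf_le1 ?freqR_gt0 // ler1n freq_gt0. Qed.

Lemma across_moved n r x : across n (moved (dir n) r x) = across n x.
Proof. by rewrite /across /dir; case: (odd n). Qed.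

Lemma across_moved3 n r x : across n (moved ord_max r x) = across n x.
Proof. by rewrite /across; case: (odd n). Qed.

Lemma across_movedS n r x : across n (moved (dir n.+1) r x) = across n x + r.
Proof. by rewrite /across /dir /=; case: (odd n). Qed.

Lemma continuous_across n : continuous (across n).
Proof. by rewrite /across; case: (odd n); cont. Qed.

Lemma shear_moved n r x : shear n (moved (dir n) r x) = shear n x.
Proof. by rewrite /shear across_moved. Qed.

Lemma shear_moved3 n r x : shear n (moved ord_max r x) = shear n x.
Proof. by rewrite /shear across_moved3. Qed.

Lemma continuous_shear n : continuous (shear n).
Proof.
have ca := @continuous_across n.
apply: continuous_mul; first by cont.
by apply: continuous_comp2 continuous_tri; cont.
Qed.

Lemma shear_periodic n : torus_periodic (shear n).
Proof.
move=> x i; have [c E] : exists c : nat, across n (x + unit_vec i) = across n x + c%:R.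
  by rewrite /across /unit_vec; case: (odd n); [exists (i == 0%N :> nat)|exists (i == 1%N :> nat)].
by rewrite /shear E mulrDl -natrM triDn.
Qed.

Lemma shear_ge0 n x : 0 <= shear n x.
Proof. by rewrite mulr_ge0 ?tri_ge0 // ltW ?scale_gt0. Qed.

Lemma shear_le n x : shear n x <= scale n.
Proof. by rewrite ler_piMr ?tri_le1 // ltW ?scale_gt0. Qed.

(** No profile depends on the third coordinate, so Lipschitz constants refer to the
first two. *)
Definition dist12 x y := `|x.1.1 - y.1.1| + `|x.1.2 - y.1.2|.

Lemma shear_lip n x y :
  `|shear n x - shear n y| <= 2 * 256 ^+ n.+1 * `|across n x - across n y|.
Proof.
rewrite /shear -mulrBr normrM gtr0_norm ?scale_gt0 //.
apply: (@le_trans _ _ (scale n * (2 * `|across n x * (freq n.+1)%:R - across n y * (freq n.+1)%:R|))).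
  by rewrite ler_pM2l ?scale_gt0 // tri_lip.
rewrite -mulrBl normrM [`|_%:R|]gtr0_norm ?freqR_gt0 //= natrM natrX.
rewrite le_eqVlt; apply/orP; left; apply/eqP.
transitivity ((scale n * (freq n)%:R) * (2 * 256 ^+ n.+1 * `|across n x - across n y|)).
  by ring.
by rewrite scale_freq mul1r.
Qed.

Lemma Phi_moved3 n s r x : Phi n s (moved ord_max r x) = moved ord_max r (Phi n s x).
Proof. by rewrite /Phi shear_moved3 moved_comm. Qed.

Lemma Phi_periodic n s x i : Phi n s (x + unit_vec i) = Phi n s x + unit_vec i.
Proof. by rewrite /Phi shear_periodic !movedE addrAC. Qed.

Lemma PhiD n r s x : Phi n r (Phi n s x) = Phi n (r + s) x.
Proof. by rewrite /Phi shear_moved movedD mulrDl. Qed.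

Lemma Phi0 n x : Phi n 0 x = x.
Proof. by rewrite /Phi mul0r moved0. Qed.

Lemma continuous_Phi n (T : topologicalType) (s : T -> R) (f : T -> space3 R) :
  continuous s -> continuous f -> continuous (fun z => Phi n (s z) (f z)).
Proof.
move=> cs cf.
have csf : continuous (fun z => shear n (f z)) by exact: continuous_comp2 (@continuous_shear n).
by apply: continuous_moved; cont.
Qed.

(** X n is the flow map of the first n stages and Z n its inverse. *)
Fixpoint Z n x := if n is m.+1 then Z m (Phi m (-1) x) else x.
Fixpoint X n x := if n is m.+1 then Phi m 1 (X m x) else x.

Lemma XZ n x : X n (Z n x) = x.
Proof. by elim: n x => //= n IH x; rewrite IH PhiD subrr Phi0. Qed.

Lemma Z_moved3 n r x : Z n (moved ord_max r x) = moved ord_max r (Z n x).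
Proof. by elim: n x => //= n IH x; rewrite Phi_moved3 IH. Qed.

Lemma Z_periodic n x i : Z n (x + unit_vec i) = Z n x + unit_vec i.
Proof. by elim: n x => //= n IH x; rewrite Phi_periodic IH. Qed.

Lemma X_moved3 n r x : X n (moved ord_max r x) = moved ord_max r (X n x).
Proof. by elim: n x => //= n IH x; rewrite IH Phi_moved3. Qed.

Lemma X_periodic n x i : X n (x + unit_vec i) = X n x + unit_vec i.
Proof. by elim: n x => //= n IH x; rewrite IH Phi_periodic. Qed.

Lemma continuous_Z n : continuous (Z n).
Proof.
elim: n => [|n IH]; first exact: continuous_id_fun.
by apply: continuous_comp2 IH; apply: continuous_Phi; cont.
Qed.

Lemma continuous_X n : continuous (X n).
Proof.
elim: n => [|n IH]; first exact: continuous_id_fun.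
by apply: continuous_Phi; cont.
Qed.

Definition lip12 (L : R) (g : space3 R -> R) :=
  forall x y, `|g x - g y| <= L * dist12 x y.

Lemma lip12_moved3 L g r x : lip12 L g -> g (moved ord_max r x) = g x.
Proof.
move=> Lg; apply/eqP; rewrite -subr_eq0 -normr_eq0 -normr_le0.
by have := Lg (moved ord_max r x) x; rewrite normr_id /dist12 /moved /= !subrr normr0 addr0 mulr0.
Qed.

(** The gradient of the shear of stage n is 2 scale n / scale n.+1 = 2 * 256 ^ n.+1. *)
Lemma dist12_Phi n s x y : `|s| <= 1 ->
  dist12 (Phi n s x) (Phi n s y) <= (1 + 2 * 256 ^+ n.+1) * dist12 x y.
Proof.
move=> s1; have hL := shear_lip n x y.
have hs : `|s * shear n x - s * shear n y| <= 2 * 256 ^+ n.+1 * `|across n x - across n y|.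
  by rewrite -mulrBr normrM; apply: le_trans hL; rewrite ler_piMl.
have D (u v a b : R) : `|u + a - (v + b)| <= `|u - v| + `|a - b|.
  by rewrite opprD addrACA ler_normD.
have : 0 <= (2 * 256 ^+ n.+1 : R) by rewrite mulr_ge0 // exprn_ge0.
move: hs; rewrite /dist12 /Phi /dir /moved /across.
move: (2 * 256 ^+ n.+1) => P; case: (odd n) => /= hs P0.
- have := D x.1.2 y.1.2 (s * shear n x) (s * shear n y).
  have := mulr_ge0 P0 (normr_ge0 (x.1.2 - y.1.2)).
  by rewrite mulrDl mul1r mulrDr; lra.
- have := D x.1.1 y.1.1 (s * shear n x) (s * shear n y).
  have := mulr_ge0 P0 (normr_ge0 (x.1.1 - y.1.1)).
  by rewrite mulrDl mul1r mulrDr; lra.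
Qed.

Lemma lip12_Phi L g n s : 0 <= L -> `|s| <= 1 -> lip12 L g ->
  lip12 (L * (1 + 2 * 256 ^+ n.+1)) (fun x => g (Phi n s x)).
Proof.
move=> L0 s1 Lg x y; apply: (le_trans (Lg _ _)); rewrite -mulrA ler_wpM2l //.
exact: dist12_Phi.
Qed.

Lemma lip12_continuous L g : lip12 L g -> continuous g.
Proof.
move=> Lg x; apply/cvgrPdist_le => e e0; near=> y.
apply: (le_trans (Lg x y)).
have L1 : 0 < `|L| + 1 by rewrite ltr_wpDl.
apply: (@le_trans _ _ ((`|L| + 1) * dist12 x y)).
  rewrite ler_wpM2r //; first by rewrite addr_ge0.
  by apply: (le_trans (ler_norm L)); rewrite lerDl.
rewrite -ler_pdivlMl //; near: y.
have c1 : continuous (fun y => dist12 x y) by rewrite /dist12; cont.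
have := c1 x; rewrite /continuous_at /dist12 !subrr normr0 addr0.
move=> /cvgrPdist_le /(_ ((`|L| + 1)^-1 * e)); rewrite mulr_gt0 ?invr_gt0 // => /(_ isT).
apply: filterS => y; rewrite sub0r normrN ger0_norm // /dist12; by rewrite addr_ge0.
Unshelve. all: by end_near. Qed.

End cascade.

(** * The limit of the averages *)

Section limit_of_averages.
Context {R : realType}.
Local Notation mu := (@lebesgue_measure R).
Implicit Types (x y z : space3 R) (n m k : nat) (r s : R) (g : space3 R -> R).

Lemma geometric_limit (a : nat -> R) (C : R) :
  (forall n, `|a n.+1 - a n| <= C * 2^-1 ^+ n) ->
  exists l, forall n, `|l - a n| <= 2 * C * 2^-1 ^+ n.
Proof.
move=> ha.
have C0 : 0 <= C by have := ha 0; rewrite expr0 mulr1; apply: le_trans.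
pose e n : R := 2 * C * 2^-1 ^+ n.
have eS n : e n = 2 * e n.+1 by rewrite /e exprS; field.
have eE n : C * 2^-1 ^+ n = e n.+1 by rewrite /e exprS; field.
have e0 n : 0 <= e n by rewrite /e !mulr_ge0 // exprn_ge0 // invr_ge0.
have incr m n : (m <= n)%N -> a m - e m <= a n - e n /\ a n + e n <= a m + e m.
  elim: n => [|n IH]; first by rewrite leqn0 => /eqP ->.
  rewrite leq_eqVlt => /predU1P[-> //|]; rewrite ltnS => /IH[h1 h2].
  have := ha n; rewrite eE ler_norml => /andP[h3 h4].
  by have := eS n; split; lra.
have uv m n : a m - e m <= a n + e n.
  have [mn|nm] := leqP m n.
    by have [h _] := incr _ _ mn; have := e0 n; lra.
  by have [_ h] := incr _ _ (ltnW nm); have := e0 m; lra.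
pose U := range (fun m => a m - e m).
have hU : has_sup U.
  by split; [exists (a 0 - e 0); exists 0|exists (a 0 + e 0) => _ [m _ <-]].
exists (sup U) => n; rewrite ler_norml -/(e n); apply/andP; split.
- have : a n - e n <= sup U by apply: sup_upper_bound => //; exists n.
  by lra.
- have : sup U <= a n + e n by apply: ge_sup; [case: hU|move=> _ [m _ <-]].
  by lra.
Qed.

Definition theta0 x : R := sin (2 * pi * x.1.1).

Definition theta n x := theta0 (Z n x).

(** Average over a segment of length scale n, the displacement range of stage n, in the
direction of the shear. *)
Definition avg n g x := av (fun r => g (moved (dir n) (- (scale n * r)) x)).

Definition A n := avg n (theta n).

(** 8 >= 2 pi is the Lipschitz constant of theta0, and the factor
1 + 2 * 256 ^ n.+1 of each stage is at most 3 * 256 ^ n.+1. *)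
Definition lipconst n : R := 8 * 3 ^+ n * (freq n)%:R.

Lemma lipconst_ge0 n : 0 <= lipconst n.
Proof. by rewrite !mulr_ge0 // exprn_ge0. Qed.

Lemma sin_lip (a b : R) : `|sin a - sin b| <= `|a - b|.
Proof.
wlog ab : a b / a <= b.
  by move=> H; case/orP: (le_total a b); [exact: H|rewrite distrC (distrC a); exact: H].
have [c _] := MVT_closed ab (fun (r : R) _ => is_derive_sin r).
rewrite distrC (distrC a) => ->; rewrite normrM ler_piMl //.
by rewrite ler_norml cos_geN1 cos_le1.
Qed.

Lemma continuous_theta0 : continuous theta0.
Proof.
apply: (@continuous_comp2 _ _ _ (fun x : space3 R => 2 * pi * x.1.1) sin); first by cont.
exact: continuous_sin.
Qed.

Lemma theta0_periodic : torus_periodic theta0.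
Proof.
move=> x i; rewrite /theta0 /=.
have -> : (x.1.1 + (i == 0%N :> nat)%:R) = x.1.1 + (i == 0%N :> nat)%:R :> R by [].
case: (i == 0%N :> nat); last by rewrite addr0.
by rewrite mulrDr mulr1 -(sinD2pi (2 * pi * x.1.1)); congr (sin (_ + _)); rewrite mulr_natl.
Qed.

Lemma theta0_bound x : `|theta0 x| <= 1.
Proof. exact: sin_max. Qed.

Lemma theta0_lip : lip12 8 theta0.
Proof.
move=> x y; apply: (le_trans (sin_lip _ _)).
rewrite -mulrBr normrM ger0_norm ?mulr_ge0 ?pi_ge0 //.
rewrite /dist12 [X in _ <= X]mulrDr.
have h1 : 2 * pi * `|x.1.1 - y.1.1| <= 8 * `|x.1.1 - y.1.1|.
  by rewrite ler_wpM2r //; have := pihalf_lt2 R; lra.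
by apply: (le_trans h1); rewrite lerDl mulr_ge0.
Qed.

Lemma theta_lip n : lip12 (lipconst n) (theta n).
Proof.
elim: n => [|n IH].
  by rewrite /lipconst expr0 !mulr1; exact: theta0_lip.
move=> x y; rewrite /theta /= -/(theta n _) -/(theta n _).
have N1 : `|-1| <= 1 :> R by rewrite normrN normr1.
have := lip12_Phi n (lipconst_ge0 n) N1 IH x y; move/le_trans; apply.
rewrite ler_wpM2r ?addr_ge0 // /lipconst /= natrM natrX.
have -> : 8 * 3 ^+ n.+1 * ((freq n)%:R * 256 ^+ n.+1) =
   (8 * 3 ^+ n * (freq n)%:R) * (3 * 256 ^+ n.+1) :> R by rewrite exprS; ring.
rewrite ler_wpM2l ?lipconst_ge0 //.
have : 1 <= (256 : R) ^+ n.+1 by rewrite exprn_ege1 // ler1n.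
lra.
Qed.

Lemma theta_bound n x : `|theta n x| <= 1.
Proof. exact: theta0_bound. Qed.

Lemma continuous_theta n : continuous (theta n).
Proof. exact: lip12_continuous (@theta_lip n). Qed.

Lemma theta_periodic n : torus_periodic (theta n).
Proof. by move=> x i; rewrite /theta Z_periodic theta0_periodic. Qed.

Lemma lip_line L g i x r s : 0 <= L -> lip12 L g ->
  `|g (moved i r x) - g (moved i s x)| <= L * `|r - s|.
Proof.
move=> L0 Lg; apply: (le_trans (Lg _ _)); rewrite ler_wpM2l // /dist12 /moved.
by case: (val i) => [|[|k]] /=; rewrite ?subrr ?normr0 ?addr0 ?add0r // opprD addrACA subrr add0r.
Qed.

Lemma dist12_moved i r x y : dist12 (moved i r x) (moved i r y) = dist12 x y.
Proof.
have E (a b c : R) : a + c - (b + c) = a - b by lra.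
by rewrite /dist12 /moved; case: (val i) => [|[|k]] /=; rewrite ?E.
Qed.

Lemma continuous_avg_integrand n g x : continuous g ->
  continuous (fun r => g (moved (dir n) (- (scale n * r)) x)).
Proof. by move=> cg; apply: continuous_comp2 cg; apply: continuous_moved; cont. Qed.

Lemma avg_lip n L g : 0 <= L -> lip12 L g -> lip12 L (avg n g).
Proof.
move=> L0 Lg x y; have cg := lip12_continuous Lg.
rewrite /avg -avB; [|exact: continuous_avg_integrand ..].
apply: av_bound => [|r r01].
  apply: continuous_add; first exact: continuous_avg_integrand.
  by apply: continuous_opp; exact: continuous_avg_integrand.
by apply: (le_trans (Lg _ _)); rewrite dist12_moved.
Qed.

Lemma A_lip n : lip12 (lipconst n) (A n).
Proof. by apply: avg_lip; [exact: lipconst_ge0|exact: theta_lip]. Qed.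

Lemma A_periodic n : torus_periodic (A n).
Proof.
move=> x i; apply: eq_av => r _; rewrite -[RHS](theta_periodic n _ i).
by rewrite !movedE addrAC.
Qed.

(** scale 0 = 1, so this is the average of a sine over its period. *)
Lemma A0_eq0 x : A 0 x = 0.
Proof.
rewrite /A /avg.
have -> : (fun r => theta 0 (moved (dir 0) (- (scale 0 * r)) x)) =
   (fun r => sin (2 * pi * (x.1.1 - r))).
  by apply/funext => r; rewrite /theta /= /theta0 /scale /= invr1 mul1r.
set q := fun r => _.
have cq : continuous q.
  by apply: (@continuous_comp2 _ _ _ (fun r : R => 2 * pi * (x.1.1 - r)) sin); [cont|exact: continuous_sin].
have qh r : q (r + 2^-1) = - q r.
  rewrite /q (_ : 2 * pi * (x.1.1 - (r + 2^-1)) = 2 * pi * (x.1.1 - r) - pi); last by field.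
  by rewrite -[in RHS](subrK pi (2 * pi * (x.1.1 - r))) sinDpi opprK.
have q1 r : q (r + 1) = q r.
  have -> : r + 1 = r + 2^-1 + 2^-1 by field.
  by rewrite !qh opprK.
have := av_shift 2^-1 cq q1.
have -> : (fun r => q (r + 2^-1)) = (fun r => 0 - q r) by apply/funext => r; rewrite qh sub0r.
rewrite avB //; last exact: continuous_cst_fun.
by rewrite av_cst; lra.
Qed.

(** Going from theta n to theta n.+1 composes with the shear of stage n, and the average
A n.+1 runs over one wavelength of this shear.  If theta n were evaluated at the
base point x, this average would be exactly A n x, by [av_tri]; the error is
a displacement by at most scale n.+1. *)
Lemma A_step n x : `|A n.+1 x - A n x| <= lipconst n * scale n.+1.
Proof.
have cth := @continuous_theta n.
set c := across n x * (freq n.+1)%:R.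
pose G u := theta n (moved (dir n) (- (scale n * u)) x).
have cG : continuous G by exact: continuous_avg_integrand.
have -> : A n x = av (fun r => G (tri (c - r))) by rewrite av_tri.
rewrite /A /avg -avB.
- apply: av_bound => [|r /andP[r0 r1]].
  + apply: continuous_add; first by apply: continuous_avg_integrand; exact: continuous_theta.
    apply: continuous_opp; apply: continuous_comp2 cG.
    by apply: continuous_comp2 continuous_tri; cont.
  + rewrite /theta /= -/(theta n _) /Phi /G /shear across_movedS.
    have -> : (across n x - scale n.+1 * r) * (freq n.+1)%:R = c - r.
      by rewrite mulrBl mulrAC scale_freq mul1r.
    rewrite mulN1r moved_comm.
    set y := moved (dir n) _ x.
    rewrite -[X in _ - theta n X](moved0 (dir n.+1)).
    apply: (le_trans (lip_line _ _ _ _ (lipconst_ge0 n) (@theta_lip n))).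
    have s0 : 0 <= scale n.+1 :> R by exact: ltW (scale_gt0 _).
    by rewrite ler_wpM2l ?lipconst_ge0 // subr0 normrN ger0_norm ?mulr_ge0 // ler_piMr.
- by apply: continuous_avg_integrand; exact: continuous_theta.
- by apply: continuous_comp2 cG; apply: continuous_comp2 continuous_tri; cont.
Qed.

Lemma lipconst_scale n : lipconst n * scale n.+1 <= 2^-1 ^+ n / 32.
Proof.
rewrite /lipconst.
have -> : scale n.+1 = scale n / 256 ^+ n.+1 :> R.
  by rewrite [in RHS]scaleS mulfK // expf_neq0.
have -> : 8 * 3 ^+ n * (freq n)%:R * (scale n / 256 ^+ n.+1) =
    (scale n * (freq n)%:R) * (8 * 3 ^+ n / 256 ^+ n.+1) :> R by ring.
rewrite scale_freq mul1r exprS invfM.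
have -> : 8 * 3 ^+ n * (256^-1 / 256 ^+ n) = (3 / 256) ^+ n / 32 :> R.
  by rewrite expr_div_n; field; rewrite expf_neq0.
rewrite ler_wpM2r //; apply: lerXn2r; rewrite ?nnegrE //; lra.
Qed.

Definition lag_average n x := A n (X n x).

(** The increment of A and the displacement of the flow during stage n, of length at most
scale n; the latter is paid for by the Lipschitz constant of A n, which is
controlled through A n.-1 because scale n times the constant of A n itself is not
small.  As A 0 = 0, the sum of these bounds is a bound of |beta|. *)
Lemma lag_average_step n x : `|lag_average n.+1 x - lag_average n x| <= 7 / 32 * 2^-1 ^+ n.
Proof.
rewrite /lag_average /=; set y := X n x; set z := Phi n 1 y.
have h1 := le_trans (A_step n z) (lipconst_scale n).
have zy L g : 0 <= L -> lip12 L g -> `|g z - g y| <= L * scale n.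
  move=> L0 Lg; rewrite /z /Phi mul1r.
  have := lip_line (dir n) y (shear n y) 0 L0 Lg.
  rewrite moved0 subr0 [X in L * X]ger0_norm ?shear_ge0 // => /le_trans; apply.
  by rewrite ler_wpM2l // shear_le.
case: n @y @z h1 zy => [|n] y z h1 zy.
  by move: h1; rewrite !A0_eq0; lra.
have h2 := le_trans (A_step n z) (lipconst_scale n).
have h3 := le_trans (A_step n y) (lipconst_scale n).
have h4 := le_trans (zy _ _ (lipconst_ge0 n) (@A_lip n)) (lipconst_scale n).
move: h1 h2 h3 h4; rewrite exprS; move: (2^-1 ^+ n) => e.
rewrite !ler_norml => /andP[a1 a2] /andP[b1 b2] /andP[c1 c2] /andP[d1 d2].
by apply/andP; split; lra.
Qed.

(** The limit of the averages along the flow, selected through its rate of convergence. *)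
Definition beta x : R := xget 0 [set l | forall n, `|l - lag_average n x| <= 2 * (7 / 32) * 2^-1 ^+ n].

Lemma beta_near n x : `|beta x - lag_average n x| <= 7 / 16 * 2^-1 ^+ n.
Proof.
have h := geometric_limit (fun n => @lag_average_step n x).
have := @xgetPex _ 0 _ h n; rewrite -/(beta x).
by rewrite (_ : 2 * (7 / 32) = 7 / 16 :> R) //; lra.
Qed.

Lemma beta_bound x : `|beta x| <= 7 / 16.
Proof. by have := beta_near 0 x; rewrite /lag_average A0_eq0 subr0 expr0 mulr1. Qed.

Lemma continuous_lag_average n : continuous (lag_average n).
Proof.
by apply: continuous_comp2 (lip12_continuous (@A_lip n)); exact: continuous_X.
Qed.

Lemma cvg_half (c : R) : c * 2^-1 ^+ n @[n --> \oo] --> 0.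
Proof.
have := @cvg_geometric R c 2^-1; rewrite /geometric; apply.
by rewrite ger0_norm ?invr_ge0 //; lra.
Qed.

Lemma continuous_beta : continuous beta.
Proof.
move=> x; apply/cvgrPdist_le => e e0.
have [N hN] : exists N, 7 / 16 * 2^-1 ^+ N <= e / 3.
  have /cvgrPdist_le /(_ (e / 3)) := cvg_half (7 / 16).
  rewrite divr_gt0 // => /(_ isT)[N _ /(_ N (leqnn N))].
  rewrite /= sub0r normrN => h; exists N; apply: le_trans h; exact: ler_norm.
near=> y.
have h1 := le_trans (beta_near N x) hN; have h2 := le_trans (beta_near N y) hN.
have h3 : `|lag_average N x - lag_average N y| <= e / 3.
  near: y; have /cvgrPdist_le := (@continuous_lag_average N : continuous (lag_average N)) x; apply.
  by rewrite divr_gt0.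
by move: h1 h2 h3; rewrite !ler_norml => /andP[? ?] /andP[? ?] /andP[? ?]; apply/andP; split; lra.
Unshelve. all: by end_near. Qed.

Lemma beta_periodic : torus_periodic beta.
Proof.
move=> x i; rewrite /beta; congr (xget _ _); apply/seteqP; split => l /= h n;
  by have := h n; rewrite /lag_average X_periodic A_periodic.
Qed.

Lemma beta_moved3 r x : beta (moved ord_max r x) = beta x.
Proof.
rewrite /beta; congr (xget _ _); apply/seteqP; split => l /= h n;
  by have := h n; rewrite /lag_average X_moved3 (lip12_moved3 _ _ (@A_lip n)).
Qed.

Lemma beta_Z_near n x : `|beta (Z n x) - A n x| <= 7 / 16 * 2^-1 ^+ n.
Proof. by have := beta_near n (Z n x); rewrite /lag_average XZ. Qed.

End limit_of_averages.

(** * Weak convergence *)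

Section weak_limit.
Context {R : realType}.
Local Notation mu := (@lebesgue_measure R).
Implicit Types (x y z : space3 R) (n m k : nat) (r s : R) (g psi : space3 R -> R).

Lemma cint_Phi n s g : continuous g -> torus_periodic g ->
  cint (fun x => g (Phi n s x)) = cint g.
Proof.
move=> cg pg; apply: (cint_moved (i := dir n) (c := fun x => s * shear n x)) => //.
- by apply: continuous_mul; [cont|exact: continuous_shear].
- by move=> r x; rewrite shear_moved.
Qed.

Lemma cint_Z n g : continuous g -> torus_periodic g ->
  cint (fun x => g (Z n x)) = cint g.
Proof.
move=> cg pg; elim: n => //= n IH.
rewrite -IH -(@cint_Phi n (-1) (fun x => g (Z n x))) //.
- by apply: continuous_comp2 cg; exact: continuous_Z.
- by move=> x i; rewrite Z_periodic pg.
Qed.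

(** Moving the average from theta n to psi by a translation, the difference is the
oscillation of psi over a segment of length scale n. *)
Lemma A_weak n psi (M : R) : continuous psi -> torus_periodic psi ->
  (forall i r x, `|psi (moved i r x) - psi x| <= M * `|r|) ->
  `|cint (fun x => theta n x * psi x) - cint (fun x => A n x * psi x)| <= M * scale n.
Proof.
move=> cpsi ppsi lpsi.
have cth := @continuous_theta R n.
have s0 : 0 <= scale n :> R by exact: ltW (scale_gt0 _).
have M0 : 0 <= M.
  by have := lpsi ord0 1 0; rewrite normr1 mulr1; apply: le_trans.
pose f (z : R * space3 R) := theta n (moved (dir n) (- (scale n * z.1)) z.2) * psi z.2.
have cf : continuous f.
  apply: continuous_mul; last by apply: continuous_comp2 cpsi; exact: continuous_snd.
  by apply: continuous_comp2 cth; apply: continuous_moved; cont.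
have fG x : (\int[mu]_(r in `[0%R, 1%R]) (f (r, x))%:E = (A n x * psi x)%:E)%E.
  have cq : continuous (fun r => theta n (moved (dir n) (- (scale n * r)) x)).
    exact: continuous_avg_integrand.
  rewrite avE; last by apply: (continuous_comp2 _ cf); exact: continuous_pairl.
  congr (_%:E); rewrite /f /= /av RintegralZr //; exact: integrable_unit.
have [E _] := integral_swap cf fG.
have cA : continuous (A n : space3 R -> R) by exact: lip12_continuous (@A_lip _ n).
rewrite cintE in E; last by apply: continuous_mul.
have cfr r : cint (fun x => f (r, x)) =
    cint (fun x => theta n x * psi (moved (dir n) (scale n * r) x)).
  rewrite -(@cint_moved _ (fun x => f (r, x)) (dir n) (fun=> scale n * r)) //.
  - by apply: eq_cint => x _; rewrite /f /= movedD addNr moved0.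
  - by apply: (continuous_comp2 _ cf); exact: continuous_pairr.
  - by move=> x i; rewrite /f /= ppsi !movedE addrAC theta_periodic.
  - exact: continuous_cst_fun.
set I0 := cint (fun x => theta n x * psi x).
have bf r : 0 <= r <= 1 -> `|I0 - cint (fun x => f (r, x))| <= M * scale n.
  move=> /andP[r0 r1]; rewrite cfr.
  have cpm : continuous (fun x => psi (moved (dir n) (scale n * r) x)).
    by apply: continuous_comp2 cpsi; apply: continuous_moved; cont.
  rewrite /I0 -cintB; [|by apply: continuous_mul ..].
  apply: cint_bound => [|x _].
    by apply: continuous_add; [|apply: continuous_opp]; apply: continuous_mul.
  rewrite -mulrBr normrM -[X in _ <= X]mul1r; apply: ler_pM => //.
    exact: theta_bound.
  rewrite distrC; apply: (le_trans (lpsi _ _ _)).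
  by rewrite ler_wpM2l // ger0_norm ?mulr_ge0 // ler_piMr.
have iF : mu.-integrable `[0, 1] (EFin \o (fun r => cint (fun x => f (r, x)))).
  exact: (integral_swap cf fG).2.
have EA : cint (fun x => A n x * psi x) = \int[mu]_(r in `[0, 1]) cint (fun x => f (r, x)).
  by rewrite /Rintegral E.
have ic (k : R) : mu.-integrable `[0, 1] (EFin \o (fun _ : R => k)).
  by apply: integrable_unit; exact: continuous_cst_fun.
rewrite EA -[I0]av_cst /av -RintegralB //.
rewrite ler_norml -[X in _ <= _ <= X]av_cst -[X in X <= _ <= _]av_cst.
have iB : mu.-integrable `[0, 1] (EFin \o (fun r => I0 - cint (fun x => f (r, x)))).
  exact: (integrableB _ (ic I0) iF).
by apply/andP; split; apply: le_Rintegral => // r /=; rewrite in_itv /= => /bf;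
  rewrite ler_norml => /andP[].
Qed.

Lemma beta_A_weak n psi (M : R) : continuous psi -> (forall x, `|psi x| <= M) ->
  `|cint (fun x => beta (Z n x) * psi x) - cint (fun x => A n x * psi x)|
    <= M * 2^-1 ^+ n.
Proof.
move=> cpsi bpsi.
have M0 : 0 <= M by apply: le_trans (bpsi 0).
have cA : continuous (A n : space3 R -> R) by exact: lip12_continuous (@A_lip _ n).
have cb : continuous (fun x : space3 R => beta (Z n x)).
  by apply: continuous_comp2 continuous_beta; exact: continuous_Z.
rewrite -cintB; [|by apply: continuous_mul ..].
apply: cint_bound => [|x _].
  by apply: continuous_add; [|apply: continuous_opp]; apply: continuous_mul.
rewrite -mulrBl normrM mulrC; apply: ler_pM => //.
apply: (le_trans (beta_Z_near n x)).
by rewrite ler_piMl ?exprn_ge0 ?invr_ge0 //; lra.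
Qed.

(** Sine and cosine are translates of each other and their squares add up to 1. *)
Lemma cint_theta0_sqr : cint (fun x : space3 R => theta0 x ^+ 2) = 2^-1.
Proof.
have cs : continuous (fun x : space3 R => theta0 x ^+ 2).
  by apply: continuous_exprn; exact: continuous_theta0.
have cc : continuous (fun x : space3 R => cos (2 * pi * x.1.1) ^+ 2).
  apply: continuous_exprn.
  by apply: (@continuous_comp2 _ _ _ (fun x : space3 R => 2 * pi * x.1.1) cos); [cont|exact: continuous_cos].
have E : cint (fun x : space3 R => cos (2 * pi * x.1.1) ^+ 2) = cint (fun x : space3 R => theta0 x ^+ 2).
  rewrite -[RHS](@cint_moved _ _ ord0 (fun=> 4^-1)) //.
  - apply: eq_cint => x _; rewrite /theta0 /=; congr (_ ^+ 2).
    by rewrite -sinDpihalf; congr (sin _); field.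
  - by move=> x i; rewrite theta0_periodic.
  - exact: continuous_cst_fun.
have : cint (fun x : space3 R => cos (2 * pi * x.1.1) ^+ 2 + theta0 x ^+ 2) = 1.
  rewrite -[RHS](@cint_cst R 1); apply: eq_cint => x _.
  by rewrite /theta0 cos2Dsin2.
rewrite cintD // E; lra.
Qed.

End weak_limit.

(** * Time: stages accumulating at time 1 *)

Section fundamental_theorem_across.
Context {R : realType}.
Local Notation mu := (@lebesgue_measure R).
Variables (T : nat -> R) (K E : R -> R).
Hypotheses (T0 : T 0%N = 0) (TS : forall n, T n <= T n.+1).
Hypothesis T1 : T n @[n --> \oo] --> (1 : R).
Hypothesis iK : mu.-integrable `[0, 2] (EFin \o K).
Hypothesis left_piece : forall n a c, T n <= a -> a <= c -> c <= T n.+1 ->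
  \int[mu]_(t in `[a, c]) K t = E c - E a.
Hypothesis right_piece : forall n a c, 2 - T n.+1 <= a -> a <= c -> c <= 2 - T n ->
  \int[mu]_(t in `[a, c]) K t = E c - E a.
(** E need not converge at time 1 from either side; only its values at mirrored times
are compared. *)
Hypothesis gap : E (2 - T n) - E (T n) @[n --> \oo] --> (0 : R).

Let T_ge0 n : 0 <= T n.
Proof. by elim: n => [|n IH]; rewrite ?T0 // (le_trans IH). Qed.

Let T_nd : {homo T : n m / (n <= m)%N >-> n <= m}.
Proof. by apply: homo_leq => // ? ? ?; exact: le_trans. Qed.

Let T_le1 n : T n <= 1.
Proof.
rewrite -(cvg_lim _ T1)//; apply: nondecreasing_cvgn_le => //.
by apply/cvg_ex; exists 1.
Qed.

Let P t := \int[mu]_(s in `[0, t]) K s.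

Let P_add a c : 0 <= a -> a <= c -> c <= 2 -> P c - P a = \int[mu]_(t in `[a, c]) K t.
Proof.
move=> a0 ac c2.
have ic : mu.-integrable `[0, c] (EFin \o K).
  apply: integrableS iK => //.
  by apply: subset_itvl; rewrite bnd_simp.
rewrite /P (Rintegral_itvB ic) ?bnd_simp // Rintegral_itv_obnd_cbnd //.
apply: integrableS ic => //.
by apply: subset_itvr; rewrite bnd_simp.
Qed.

Let D t := P t - E t.

Let D_left n a c : T n <= a -> a <= c -> c <= T n.+1 -> D c = D a.
Proof.
move=> h1 h2 h3; have t1 := T_le1 n.+1; have t0 := T_ge0 n.
have a0 : 0 <= a by lra.
have c2 : c <= 2 by lra.
by have := P_add a0 h2 c2; rewrite (left_piece h1 h2 h3) /D; lra.
Qed.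

Let D_right n a c : 2 - T n.+1 <= a -> a <= c -> c <= 2 - T n -> D c = D a.
Proof.
move=> h1 h2 h3; have t1 := T_le1 n.+1; have t0 := T_ge0 n.
have a0 : 0 <= a by lra.
have c2 : c <= 2 by lra.
by have := P_add a0 h2 c2; rewrite (right_piece h1 h2 h3) /D; lra.
Qed.

Let DT n : D (T n) = D 0.
Proof. by elim: n => [|n <-]; [rewrite T0|apply: (D_left (n := n))]. Qed.

Let DT' n : D (2 - T n) = D 2.
Proof.
elim: n => [|n <-]; first by rewrite T0 subr0.
by apply/esym; apply: (D_right (n := n)) => //; rewrite lerD2l lerN2.
Qed.

(* The primitive P is continuous at 1, hence P (2 - T n) - P (T n) tends to 0, and so does
the gap of E: the constants of P - E on the two sides agree. *)
Let D2 : D 2 = D 0.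
Proof.
have ab : 0 < 2 :> R by [].
have /continuous_within_itvP -/(_ ab)[cP _ _] := parameterized_integral_continuous (ltW ab) iK.
have cP1 : P t @[t --> (1 : R)] --> P 1.
  by apply: cP; rewrite in_itv /=; lra.
have l1 : P (T n) @[n --> \oo] --> P 1 by exact: (@cvg_comp _ _ _ T P _ _ _ T1 cP1).
have l2 : P (2 - T n) @[n --> \oo] --> P 1.
  have T2 : 2 - T n @[n --> \oo] --> (1 : R).
    rewrite [X in _ --> X](_ : 1 = 2 - 1 :> R); last lra.
    by apply: cvgB => //; exact: cvg_cst.
  exact: (@cvg_comp _ _ _ (fun n => 2 - T n) P _ _ _ T2 cP1).
have l4 : D 2 - D 0 @[n --> \oo] --> P 1 - P 1 - 0.
  have -> : (fun _ : nat => D 2 - D 0) =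
      (fun n => P (2 - T n) - P (T n) - (E (2 - T n) - E (T n))).
    by apply/funext => n; rewrite -(DT' n) -(DT n) /D; lra.
  exact: (cvgB (cvgB l2 l1) gap).
have e1 : limn (fun _ : nat => D 2 - D 0) = P 1 - P 1 - 0 by exact: cvg_lim l4.
have e2 : limn (fun _ : nat => D 2 - D 0) = D 2 - D 0.
  by apply: cvg_lim => //; exact: cvg_cst.
by move: e1; rewrite e2; lra.
Qed.

Lemma ftc_across t : 0 <= t -> t <= 2 -> t != 1 -> P t = E t - E 0.
Proof.
move=> t0 t2 t1.
have D0 : D 0 = - E 0 by rewrite /D /P set_itv1 Rintegral_set1 sub0r.
suff : D t = D 0 by rewrite D0 /D; lra.
have near1 u : u < 1 -> exists n, u < T n.
  move=> u1; have /cvgrPdist_lt /(_ (1 - u)) := T1; rewrite subr_gt0 => /(_ u1)[N _ /(_ N (leqnn N))].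
  rewrite /= => h; exists N; have := ler_norm (1 - T N); lra.
have find u : 0 <= u -> u < 1 -> exists n, T n <= u <= T n.+1.
  move=> u0 /near1[m um]; elim: m um => [|m IH] um; first by move: um; rewrite T0; lra.
  by have [h|h] := lerP (T m) u; [exists m; rewrite h ltW | exact: IH].
case: (ltrgtP t 1) t1 => // t1 _.
- have [n /andP[h1 h2]] := find t t0 t1.
  by rewrite (D_left (lexx _) h1 h2) DT.
- have u0 : 0 <= 2 - t by lra.
  have u1 : 2 - t < 1 by lra.
  have [n /andP[h1 h2]] := find _ u0 u1.
  have h3 : 2 - T n.+1 <= t by lra.
  have h4 : t <= 2 - T n by lra.
  by rewrite -(D_right h3 h4 (lexx _)) DT' D2.
Qed.

End fundamental_theorem_across.

Section time_pieces.
Context {R : realType}.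
Local Notation mu := (@lebesgue_measure R).
Variable delta : nat -> R.
Hypotheses (delta0 : delta 0%N = 1) (delta_gt0 : forall n, 0 < delta n).
Hypothesis (delta_lt : forall n, delta n.+1 < delta n).
Hypothesis (delta_cvg : delta n @[n --> \oo] --> (0 : R)).

(** delta n is the time left before time 1 when stage n starts, and tau n the length of
this stage. *)
Definition T n := 1 - delta n.
Definition tau n := delta n - delta n.+1.
(** The second half of the time interval is the mirror image of the first one: [b] tells
the halves apart, and the clock runs backwards in the second one. *)
Definition clock (b : bool) (t : R) := if b then 2 - t else t.
Definition side (t : R) : bool := 1 <= t.
Definition idx (r : R) : nat := xget 0%N [set n | T n <= r < T n.+1].
Definition stage t := idx (clock (side t) t).
Definition piece b n : set R := [set t | T n <= clock b t < T n.+1].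

Lemma tau_gt0 n : 0 < tau n.
Proof. by rewrite subr_gt0. Qed.

Lemma T0 : T 0 = 0. Proof. by rewrite /T delta0 subrr. Qed.

Lemma TS_lt n : T n < T n.+1.
Proof. by rewrite /T; have := delta_lt n; lra. Qed.

Lemma T_lt1 n : T n < 1.
Proof. by rewrite /T; have := delta_gt0 n; lra. Qed.

Lemma T_tau n : T n.+1 = T n + tau n.
Proof. by rewrite /T /tau; lra. Qed.

Lemma T_homo : {homo T : n m / (n <= m)%N >-> n <= m}.
Proof. by apply: homo_leq => // [? ? ?|n]; [exact: le_trans|exact: ltW (TS_lt n)]. Qed.

Lemma T_ge0 n : 0 <= T n.
Proof. by rewrite -T0 T_homo. Qed.

Lemma T_cvg : T n @[n --> \oo] --> (1 : R).
Proof.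
rewrite -[X in _ --> X]subr0; apply: cvgB => //; exact: cvg_cst.
Qed.

Lemma idxE n r : T n <= r < T n.+1 -> idx r = n.
Proof.
move=> /andP[h1 h2]; have /andP[m1 m2] : T (idx r) <= r < T (idx r).+1.
  by have := @xgetPex _ 0%N [set n | T n <= r < T n.+1]; apply; exists n; rewrite /= h1.
move: m1 m2; set m := idx r => m1 m2.
by apply/eqP; case: ltngtP => // /T_homo; lra.
Qed.

Lemma clockK b : involutive (clock b).
Proof. by move=> t; rewrite /clock; case: b => //; rewrite opprB addrCA subrr addr0. Qed.

Lemma piece_side b n t : piece b n t -> side t = b.
Proof.
rewrite /piece /side /clock /= => /andP[h1 h2].
have h3 := T_lt1 n.+1; case: b h1 h2 => h1 h2.
  by apply/idP; lra.
by apply/negbTE; rewrite -ltNge; lra.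
Qed.

Lemma piece_stage b n t : piece b n t -> stage t = n.
Proof. by move=> pt; rewrite /stage (piece_side pt); exact: idxE. Qed.

Lemma piece_cover t : 0 <= t <= 2 -> t != 1 -> exists b n, piece b n t.
Proof.
move=> t02 t1; have [b [r0 r1]] : exists b, 0 <= clock b t /\ clock b t < 1.
  by case: (ltrgtP t 1) t1 => // h _; [exists false|exists true]; rewrite /clock; lra.
have [m rm] : exists m, clock b t < T m.
  have /cvgrPdist_lt /(_ (1 - clock b t)) := T_cvg; rewrite subr_gt0 => /(_ r1)[N _ /(_ N (leqnn N))].
  by rewrite /= => h; exists N; have := ler_norm (1 - T N); lra.
exists b; elim: m rm => [|m IH] rm; first by move: rm; rewrite T0; lra.
by have [h|h] := lerP (T m) (clock b t); [exists m; rewrite /piece /= h | exact: IH].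
Qed.

Lemma piece_itv b n : piece b n =
  if b then `]2 - T n.+1, 2 - T n]%classic else `[T n, T n.+1[%classic.
Proof.
apply/seteqP; rewrite /piece /clock.
by case: b; split => t /=; rewrite in_itv /= => /andP[h1 h2]; apply/andP; split; lra.
Qed.

Lemma measurable_piece b n : measurable (piece b n).
Proof. by rewrite piece_itv; case: b; exact: measurable_itv. Qed.

Lemma mu_piece b n : mu (piece b n) = (tau n)%:E.
Proof.
have h := delta_lt n.
rewrite piece_itv; case: b; rewrite lebesgue_measure_itv /= lte_fin;
  rewrite ifT -?EFinB /T; by [congr (_%:E); rewrite /tau; lra | lra].
Qed.

Lemma piece_sub b n t : piece b n t -> 0 <= t <= 2.
Proof.
have h1 := T_ge0 n; have h2 := T_lt1 n.+1.
by rewrite /piece /clock /=; case: b => /andP[h3 h4]; apply/andP; split; lra.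
Qed.

Lemma piece_neq1 b n t : piece b n t -> t != 1.
Proof.
have h2 := T_lt1 n.+1.
rewrite /piece /clock /=; case: b => /andP[h3 h4]; apply/eqP => t1; subst t; lra.
Qed.

Definition pieces n := piece false n `|` piece true n.

Lemma pieces_cover : \bigcup_n pieces n = `[0, 2]%classic `\` [set 1].
Proof.
apply/seteqP; split => t /=.
  by move=> [n _ [|] h]; split; [rewrite in_itv /= (piece_sub h)|exact/eqP/(piece_neq1 h)
    |rewrite in_itv /= (piece_sub h)|exact/eqP/(piece_neq1 h)].
rewrite in_itv /= => -[t02 /eqP t1]; have [b [n h]] := piece_cover t02 t1.
by exists n => //; case: b h => h; [right|left].
Qed.

Lemma measurable_pieces n : measurable (pieces n).
Proof. by apply: measurableU; exact: measurable_piece. Qed.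

Lemma measurable_fun_pieces d d' (X : measurableType d) (U : measurableType d')
    (p : X -> R) (h : X -> U) : measurable_fun setT p ->
  (forall b n, measurable_fun (p @^-1` piece b n) h) ->
  measurable_fun (p @^-1` [set 1]) h -> measurable_fun (p @^-1` `[0, 2]) h.
Proof.
move=> mp mh mh1.
have mpre A : measurable A -> measurable (p @^-1` A).
  by move=> mA; rewrite -[X in measurable X]setTI; exact: mp.
have -> : p @^-1` `[0, 2] = p @^-1` [set 1] `|` \bigcup_n (p @^-1` pieces n).
  rewrite -preimage_bigcup pieces_cover -preimage_setU setDUK //.
  by move=> t -> /=; rewrite in_itv /=; lra.
apply/measurable_funU.
- by apply: mpre; exact: measurable_set1.
- by apply: bigcup_measurable => n _; apply: mpre; exact: measurable_pieces.
split => //; apply/measurable_fun_bigcup.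
  by move=> n; apply: mpre; exact: measurable_pieces.
move=> n; rewrite /pieces preimage_setU; apply/measurable_funU.
- by apply: mpre; exact: measurable_piece.
- by apply: mpre; exact: measurable_piece.
by split; exact: mh.
Qed.

Lemma measurable_fun_stage d' (U : measurableType d') (h : R -> U) :
  (forall b n, measurable_fun (piece b n) h) -> measurable_fun (`[0, 2]%classic : set R) h.
Proof.
move=> mh; apply: (@measurable_fun_pieces _ _ _ _ id h) => //=.
by rewrite preimage_id; exact: measurable_fun_set1.
Qed.

Lemma measurable_step (c : nat -> R) :
  measurable_fun (`[0, 2]%classic : set R) (fun t => (c (stage t))%:E).
Proof.
apply: measurable_fun_stage => b n.
apply: (@eq_measurable_fun _ _ _ _ _ (fun=> (c n)%:E)); last exact: measurable_cst.
by move=> t /set_mem /piece_stage ->.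
Qed.

Lemma step_integral_lty (c : nat -> R) (C : R) : (forall n, 0 <= c n) ->
  (forall n, c n * tau n <= C * 2^-1 ^+ n) ->
  (\int[mu]_(t in `[0%R, 2%R]) (c (stage t))%:E < +oo)%E.
Proof.
move=> c0 cC.
have C0 : 0 <= C.
  by have := cC 0; rewrite expr0 mulr1; apply: le_trans; rewrite mulr_ge0 // ltW // tau_gt0.
have -> : (\int[mu]_(t in `[0%R, 2%R]) (c (stage t))%:E =
    \int[mu]_(t in `[0%R, 2%R] `\` [set 1%R]) (c (stage t))%:E)%E.
  apply: ge0_negligible_integral => //.
  - exact: measurable_step.
  - by move=> t _; rewrite lee_fin.
  - exact: lebesgue_measure_set1.
rewrite -pieces_cover ge0_integral_bigcup //; last first.
- apply/trivIsetP => n m _ _ nm; apply/seteqP; split => // t [h1 h2].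
  have E k : pieces k t -> stage t = k by move=> [|] /piece_stage.
  by move: nm; rewrite -(E _ h1) -(E _ h2) eqxx.
- by move=> t _; rewrite lee_fin.
- rewrite pieces_cover; apply: measurable_funS (measurable_step c) => //.
- exact: measurable_pieces.
apply: (@le_lt_trans _ _ (4 * C)%:E); last by rewrite ltey.
have bn n : (\int[mu]_(t in pieces n) (c (stage t))%:E <= (2 * C * 2^-1 ^+ n)%:E)%E.
  have -> : (\int[mu]_(t in pieces n) (c (stage t))%:E = \int[mu]_(t in pieces n) (cst (c n)%:E) t)%E.
    by apply: eq_integral => t /set_mem [|] /piece_stage ->.
  rewrite integral_cst //; last exact: measurable_pieces.
  apply: (@le_trans _ _ ((c n)%:E * ((tau n)%:E + (tau n)%:E))%E).
    apply: lee_wpmul2l; first by rewrite lee_fin.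
    rewrite -{1}(mu_piece false) -(mu_piece true); apply: measureU2; exact: measurable_piece.
  by rewrite -EFinD -EFinM lee_fin; have := cC n; lra.
apply: lime_le.
  apply: is_cvg_nneseries => n _ _; apply: integral_ge0 => t _; by rewrite lee_fin.
near=> n; rewrite big_mkord.
apply: (@le_trans _ _ (\sum_(i < n) (2 * C * 2^-1 ^+ i)%:E)%E).
  by apply: lee_sum => i _.
rewrite sumEFin lee_fin.
suff : \sum_(i < n) 2 * C * 2^-1 ^+ i = 4 * C - 4 * C * 2^-1 ^+ n.
  by move=> ->; rewrite gerBl !mulr_ge0 // exprn_ge0 // invr_ge0.
elim: (n) => [|k IH]; first by rewrite big_ord0 expr0; lra.
by rewrite big_ord_recr /= IH exprS; field.
Unshelve. all: by end_near. Qed.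

End time_pieces.

Section profile.
Context {R : realType}.
Local Notation mu := (@lebesgue_measure R).
Variable delta : nat -> R.
Hypothesis (delta_lt : forall n, delta n.+1 < delta n).
Local Notation T := (T delta).
Local Notation tau := (tau delta).

Definition sgb (b : bool) : R := if b then -1 else 1.
(** Increases from 0 to 1 on the unit interval, with vanishing derivative at both ends, so
that the velocity vanishes at the ends of each stage and the stages fit together
continuously.  [ramp1] and [ramp2] are its derivatives. *)
Definition ramp (r : R) := 3 * r ^+ 2 - 2 * r ^+ 3.
Definition ramp1 (r : R) := 6 * r - 6 * r ^+ 2.
Definition ramp2 (r : R) := 6 - 12 * r.
Definition phase b n (t : R) := (clock b t - T n) / tau n.
(** The fraction of the shear of stage n performed at time t, followed by its first and
second time derivatives; in the second half of the time interval the clock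
contributes a sign to the first one. *)
Definition prof b n t := ramp (phase b n t).
Definition prof1 b n t := sgb b / tau n * ramp1 (phase b n t).
Definition prof2 b n t := ramp2 (phase b n t) / tau n ^+ 2.

Lemma is_derive_affine (k m t : R) : is_derive t 1 (fun t : R => k * t + m) k.
Proof.
rewrite -[X in is_derive _ _ _ X]addr0; apply: is_deriveD.
rewrite -[X in is_derive _ _ _ X]mulr1.
exact: (@is_deriveZ _ _ _ id k t 1 1 _).
Qed.

Lemma phaseE b n : phase b n =
  (fun t => (sgb b / tau n) * t + ((if b then 2 else 0) - T n) / tau n).
Proof.
apply/funext => t; rewrite /phase /clock /sgb; case: b; ring.
Qed.

Lemma is_derive_prof b n (t : R) : is_derive t 1 (prof b n) (prof1 b n t).
Proof.
have dr := is_derive_affine (sgb b / tau n) (((if b then 2 else 0) - T n) / tau n) t.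
rewrite -phaseE in dr.
have d := is_deriveB (is_deriveZ 3 (is_deriveX 2 dr)) (is_deriveZ 2 (is_deriveX 3 dr)).
apply: is_derive_eq d _.
rewrite /prof1 /ramp1 /GRing.scale /= expr1; ring.
Qed.

Lemma is_derive_prof1 b n (t : R) : is_derive t 1 (prof1 b n) (prof2 b n t).
Proof.
have dr := is_derive_affine (sgb b / tau n) (((if b then 2 else 0) - T n) / tau n) t.
rewrite -phaseE in dr.
have d := is_deriveZ (sgb b / tau n) (is_deriveB (is_deriveZ 6 dr) (is_deriveZ 6 (is_deriveX 2 dr))).
apply: is_derive_eq d _.
rewrite /prof2 /ramp2 /GRing.scale /= expr1.
have -> : sgb b / tau n * (6 * (sgb b / tau n) - 6 * (2%:R * phase b n t * (sgb b / tau n))) =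
   (sgb b * sgb b) * ((6 - 12 * phase b n t) / tau n ^+ 2).
  by rewrite expr2 invfM; ring.
have -> : sgb b * sgb b = 1 by rewrite /sgb; case: (b); ring.
by rewrite mul1r.
Qed.

Lemma continuous_phase b n : continuous (phase b n).
Proof. by rewrite phaseE; cont. Qed.

Lemma continuous_prof b n : continuous (prof b n).
Proof. by have := @continuous_phase b n => h; rewrite /prof /ramp; cont. Qed.

Lemma continuous_prof1 b n : continuous (prof1 b n).
Proof. by have := @continuous_phase b n => h; rewrite /prof1 /ramp1; cont. Qed.

Lemma continuous_prof2 b n : continuous (prof2 b n).
Proof. by have := @continuous_phase b n => h; rewrite /prof2 /ramp2; cont. Qed.

Lemma tau_pos n : 0 < tau n. Proof. exact: tau_gt0. Qed.

Lemma phase_itv b n t : T n <= clock b t <= T n.+1 -> 0 <= phase b n t <= 1.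
Proof.
move=> /andP[h1 h2]; have t0 := tau_pos n; rewrite /phase.
have := T_tau delta n => E; apply/andP; split.
  by apply: divr_ge0; [rewrite subr_ge0|exact: ltW].
by rewrite ler_pdivrMr // mul1r; lra.
Qed.

Lemma phase_lo b n t : clock b t = T n -> phase b n t = 0.
Proof. by move=> h; rewrite /phase h subrr mul0r. Qed.

Lemma phase_hi b n t : clock b t = T n.+1 -> phase b n t = 1.
Proof.
by move=> h; rewrite /phase h T_tau addrAC subrr add0r divff // gt_eqF // tau_pos.
Qed.

Lemma ramp_itv r : 0 <= r <= 1 -> 0 <= ramp r <= 1.
Proof.
move=> /andP[r0 r1]; apply/andP; split.
  have -> : ramp r = r ^+ 2 * (3 - 2 * r) by rewrite /ramp; ring.
  by rewrite mulr_ge0 ?sqr_ge0 //; lra.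
rewrite -subr_ge0; have -> : 1 - ramp r = (1 - r) ^+ 2 * (1 + 2 * r) by rewrite /ramp; ring.
by rewrite mulr_ge0 ?sqr_ge0 //; lra.
Qed.

Lemma ramp1_itv r : 0 <= r <= 1 -> 0 <= ramp1 r <= 2.
Proof.
move=> /andP[r0 r1]; apply/andP; split.
  have -> : ramp1 r = 6 * r * (1 - r) by rewrite /ramp1; ring.
  by rewrite !mulr_ge0 //; lra.
rewrite -subr_ge0; have -> : 2 - ramp1 r = 6 * (r - 2^-1) ^+ 2 + 2^-1 by rewrite /ramp1; field.
by apply: addr_ge0; rewrite ?invr_ge0 // mulr_ge0 // sqr_ge0.
Qed.

Lemma ramp2_itv r : 0 <= r <= 1 -> `|ramp2 r| <= 6.
Proof. by move=> /andP[r0 r1]; rewrite /ramp2 ler_norml; apply/andP; split; lra. Qed.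

Lemma prof_itv b n t : T n <= clock b t <= T n.+1 -> 0 <= prof b n t <= 1.
Proof. by move=> /phase_itv; exact: ramp_itv. Qed.

Lemma prof1_bound b n t : T n <= clock b t <= T n.+1 -> `|prof1 b n t| <= 2 / tau n.
Proof.
move=> /phase_itv /ramp1_itv /andP[h1 h2]; rewrite /prof1 normrM.
have -> : `|sgb b / tau n| = (tau n)^-1.
  by rewrite normrM /sgb [`|_^-1|]gtr0_norm ?invr_gt0 ?tau_pos //; case: (b); rewrite ?normrN normr1 mul1r.
by rewrite mulrC ler_pM2r ?invr_gt0 ?tau_pos // ger0_norm.
Qed.

Lemma prof2_bound b n t : T n <= clock b t <= T n.+1 -> `|prof2 b n t| <= 6 / tau n ^+ 2.
Proof.
move=> /phase_itv /ramp2_itv h; rewrite /prof2 normrM.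
rewrite [X in _ * X]gtr0_norm ?invr_gt0 ?exprn_gt0 ?tau_pos //.
by rewrite ler_pM2r // invr_gt0 exprn_gt0 ?tau_pos.
Qed.

Lemma prof_lo b n t : clock b t = T n -> prof b n t = 0 /\ prof1 b n t = 0.
Proof. by move=> /phase_lo h; rewrite /prof /prof1 /ramp /ramp1 h; split; ring. Qed.

Lemma prof_hi b n t : clock b t = T n.+1 -> prof b n t = 1 /\ prof1 b n t = 0.
Proof. by move=> /phase_hi h; rewrite /prof /prof1 /ramp /ramp1 h; split; ring. Qed.

End profile.

(** * The fields of one stage *)

Lemma sum3E {R : realType} (F : 'I_3 -> R) : \sum_(i < 3) F i = F ord0 + (F 1 + F ord_max).
Proof.
by rewrite !big_ord_recl big_ord0 addr0; congr (_ + (F _ + F _)); exact/val_inj.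
Qed.

Section stage_fields.
Context {R : realType}.
Local Notation mu := (@lebesgue_measure R).
Variable delta : nat -> R.
Local Notation prof := (prof delta).
Local Notation prof1 := (prof1 delta).
Local Notation prof2 := (prof2 delta).
Implicit Types (g : space3 R -> R) (phi : R -> vfield R) (b : bool) (n : nat).

(** The profiles that the flow may carry. *)
Definition profile_ok g :=
  [/\ continuous g, torus_periodic g & forall r x, g (moved ord_max r x) = g x].

Definition carried b n g (t : R) x := g (Z n (Phi n (- prof b n t) x)).

Definition vel b n g (t : R) : vfield R := fun x => \row_(i < 3)
  if i == dir n then prof1 b n t * shear n x
  else if i == ord_max then carried b n g t x else 0.

Definition frc b n (t : R) : vfield R := fun x => \row_(i < 3)
  if i == dir n then prof2 b n t * shear n x else 0.

Lemma dir_neq3 n : (dir n == ord_max) = false.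
Proof. by rewrite /dir; case: (odd n). Qed.

Lemma sum3_dir n (F : 'I_3 -> R) :
  (forall i, i != dir n -> i != ord_max -> F i = 0) ->
  \sum_(i < 3) F i = F (dir n) + F ord_max.
Proof.
move=> F0; rewrite (bigD1 (dir n)) //= (bigD1 ord_max) /=; last by rewrite eq_sym dir_neq3.
by rewrite big1 ?addr0 // => i /andP[]; exact: F0.
Qed.

Lemma vel_dir b n g t x : vel b n g t x 0 (dir n) = prof1 b n t * shear n x.
Proof. by rewrite mxE eqxx. Qed.

Lemma vel_3 b n g t x : vel b n g t x 0 ord_max = carried b n g t x.
Proof. by rewrite mxE eq_sym dir_neq3 eqxx. Qed.

Lemma vel_0 b n g t x i : i != dir n -> i != ord_max -> vel b n g t x 0 i = 0.
Proof. by move=> /negbTE h1 /negbTE h2; rewrite mxE h1 h2. Qed.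

Lemma frc_dir b n t x : frc b n t x 0 (dir n) = prof2 b n t * shear n x.
Proof. by rewrite mxE eqxx. Qed.

Lemma frc_0 b n t x i : i != dir n -> frc b n t x 0 i = 0.
Proof. by move=> /negbTE h1; rewrite mxE h1. Qed.

Lemma test_scalar_coord phi i :
  smooth (fun z : R * space3 R => phi z.1 z.2) ->
  (forall t, torus_periodic (phi t)) ->
  test_scalar (fun z : R * space3 R => phi z.1 z.2 0 i).
Proof.
move=> sphi pphi; set f := fun z : R * space3 R => phi z.1 z.2.
have ccoord (h : R * space3 R -> 'rV[R]_3) : continuous h -> continuous (fun z => h z 0 i).
  by move=> ch; exact: (@continuous_comp2 _ _ _ h (fun M : 'rV[R]_3 => M 0 i) ch (@coord_continuous _ _ _ 0 i)).
have [cf df] := sphi 1%N; split.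
- exact: ccoord.
- move=> v; have [dv cv] := df v; split.
    by move=> z; have /derivable_mxP/(_ 0 i) := dv z.
  have -> : 'D_v (fun z => f z 0 i) = (fun z => 'D_v f z 0 i).
    by apply/funext => z; rewrite (derive_mx (dv z)) mxE.
  exact: ccoord.
- by move=> t x j /=; rewrite pphi.
Qed.

Lemma profile_Z n g : profile_ok g -> profile_ok (fun x => g (Z n x)).
Proof.
move=> [cg pg g3]; split.
- by apply: (continuous_comp2 _ cg); exact: continuous_Z.
- by move=> x i; rewrite Z_periodic pg.
- by move=> r x; rewrite Z_moved3 g3.
Qed.

(** The three components are instances of [stage_scalar].  In Lagrangian coordinates the
horizontal component is the time derivative of the displacement and its
derivative is the force, while the third one is constant in time. *)
Lemma stage_weak b n g phi (s e : R) : s <= e -> profile_ok g ->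
  smooth (fun z : R * space3 R => phi z.1 z.2) -> (forall t, torus_periodic (phi t)) ->
  let K t := cint (weak_integrand (frc b n) (vel b n g) phi t) in
  let E t := cint (fun x => dot (vel b n g t x) (phi t x)) in
  [/\ \int[mu]_(t in `[s, e]) K t = E e - E s,
      mu.-integrable `[s, e] (EFin \o K),
      forall t, continuous (weak_integrand (frc b n) (vel b n g) phi t) &
      forall t, continuous (fun x => dot (vel b n g t x) (phi t x))].
Proof.
move=> se og sphi pphi K E.
have [cZ pZ Z3] := profile_Z n og.
pose d := dir n.
pose gphi (i : 'I_3) (z : R * space3 R) : R := phi z.1 z.2 0 i.
pose W (i : 'I_3) (z : R * space3 R) := if i == d then prof1 b n z.1 * shear n z.2
  else if i == ord_max then g (Z n z.2) else 0.
pose W' (i : 'I_3) (z : R * space3 R) := if i == d then prof2 b n z.1 * shear n z.2 else 0.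
pose bk t x := back d (prof b n) (shear n) t x.
have bkE t x : bk t x = Phi n (- prof b n t) x.
  by rewrite /bk /back /Phi mulNr.
have Wvel i t x : W i (t, bk t x) = vel b n g t x 0 i.
  rewrite mxE /W /= /carried -bkE; case: ifP => // _.
  by rewrite /bk /back shear_moved.
have W'frc i t x : W' i (t, bk t x) = frc b n t x 0 i.
  by rewrite mxE /W' /=; case: ifP => // _; rewrite /bk /back shear_moved.
pose Ki i t x := W i (t, bk t x) * (dt (gphi i) (t, x) + dx d (gphi i) (t, x) * (prof1 b n t * shear n x)
     + dx ord_max (gphi i) (t, x) * g (Z n (bk t x))) + W' i (t, bk t x) * gphi i (t, x).
pose Ei i t := cint (fun x => W i (t, bk t x) * gphi i (t, x)).
have csh : continuous (fun z : R * space3 R => shear n z.2).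
  by apply: continuous_comp2 (@continuous_shear R n); exact: continuous_snd.
have cp1 : continuous (fun z : R * space3 R => prof1 b n z.1).
  by apply: continuous_comp2 (@continuous_prof1 _ _ _ _); exact: continuous_fst.
have cp2 : continuous (fun z : R * space3 R => prof2 b n z.1).
  by apply: continuous_comp2 (@continuous_prof2 _ _ _ _); exact: continuous_fst.
have cgz : continuous (fun z : R * space3 R => g (Z n z.2)).
  by apply: continuous_comp2 cZ; exact: continuous_snd.
have S i : [/\ \int[mu]_(t in `[s, e]) cint (Ki i t) = Ei i e - Ei i s,
      mu.-integrable `[s, e] (EFin \o (fun t => cint (Ki i t))),
      forall t, continuous (Ki i t) &
      forall t, continuous (fun x => W i (t, bk t x) * gphi i (t, x))].
  have h1 (t : R) : is_derive t 1 (prof b n) (prof1 b n t) by exact: is_derive_prof.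
  have h2 : test_scalar (gphi i) by exact: test_scalar_coord.
  have h3 : continuous (W i).
    rewrite /W; case: (i == d); first exact: continuous_mul.
    by case: (i == ord_max) => //; exact: continuous_cst_fun.
  have h4 : continuous (W' i).
    rewrite /W'; case: (i == d); first exact: continuous_mul.
    exact: continuous_cst_fun.
  have h5 : periodic4 (W i) by move=> t x j; rewrite /W /= shear_periodic pZ.
  have h6 : periodic4 (W' i) by move=> t x j; rewrite /W' /= shear_periodic.
  have h7 (t : R) x : is_derive t 1 (fun r : R => W i (r, x)) (W' i (t, x)).
    rewrite /W /W' /=; case: (i == d).
      have -> : (fun r => prof1 b n r * shear n x) = shear n x \*: prof1 b n.
        by apply/funext => r; rewrite mulrC.
      by rewrite mulrC; apply: is_deriveZ; exact: is_derive_prof1.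
    exact: is_derive_cst.
  have h8 t r x : W i (t, moved ord_max r x) = W i (t, x).
    by rewrite /W /= shear_moved3 Z3.
  have h9 t r x : W' i (t, moved ord_max r x) = W' i (t, x).
    by rewrite /W' /= shear_moved3.
  exact: (stage_scalar h1 (@continuous_prof _ _ b n) (@continuous_prof1 _ _ b n)
    (@continuous_shear R n) (@shear_periodic R n) (@shear_moved R n) (@shear_moved3 R n)
    cZ pZ Z3 se h2 h3 h4 h5 h6 h7 h8 h9).
have KE t x : weak_integrand (frc b n) (vel b n g) phi t x = Ki ord0 t x + (Ki 1 t x + Ki ord_max t x).
  have -> : Ki ord0 t x + (Ki 1 t x + Ki ord_max t x) = \sum_(i < 3) Ki i t x.
    by rewrite (sum3E (fun i => Ki i t x)).
  rewrite /weak_integrand /dot -!big_split; apply: eq_bigr => i _ /=.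
  rewrite (derive1_dt (gphi i)) /Ki Wvel W'frc mulrDr; congr (_ + _).
  rewrite mulrDr -addrA; congr (_ + _).
  rewrite (sum3_dir (n := n)) => [|j j1 j2]; last by rewrite (vel_0 _ _ _ _ j1 j2) mulr0 mul0r.
  have P j : partial j (fun y => phi t y 0 i) x = dx j (gphi i) (t, x) by exact: (partialE (gphi i)).
  rewrite vel_dir vel_3 !P /carried -bkE.
  by congr (_ + _); rewrite -mulrA; congr (_ * _); exact: mulrC.
have EE t x : dot (vel b n g t x) (phi t x) = W ord0 (t, bk t x) * gphi ord0 (t, x)
    + (W 1 (t, bk t x) * gphi 1 (t, x) + W ord_max (t, bk t x) * gphi ord_max (t, x)).
  by rewrite !Wvel /dot sum3E.
have [S0 S1 S2 S3] := S ord0; have [A0 A1 A2 A3] := S 1; have [B0 B1 B2 B3] := S ord_max.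
have cK t : cint (weak_integrand (frc b n) (vel b n g) phi t) =
    cint (Ki ord0 t) + (cint (Ki 1 t) + cint (Ki ord_max t)).
  rewrite -cintD // -cintD //; last exact: continuous_add.
  by apply: eq_cint => x _; exact: KE.
have cE t : E t = Ei ord0 t + (Ei 1 t + Ei ord_max t).
  rewrite /Ei -cintD // -cintD //; last exact: continuous_add.
  by apply: eq_cint => x _; exact: EE.
have iAB : mu.-integrable `[s, e] (EFin \o (fun t => cint (Ki 1 t) + cint (Ki ord_max t))).
  exact: (integrableD _ A1 B1).
split.
- transitivity (\int[mu]_(t in `[s, e]) (cint (Ki ord0 t) + (cint (Ki 1 t) + cint (Ki ord_max t)))).
    by apply: eq_Rintegral => t _; exact: cK.
  apply: (etrans (RintegralD _ S1 iAB)) => //.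
  rewrite (_ : \int[mu]_(t in `[s, e]) (cint (Ki 1 t) + cint (Ki ord_max t)) = \int[mu]_(t in `[s, e]) cint (Ki 1 t) + \int[mu]_(t in `[s, e]) cint (Ki ord_max t)); last by apply: (etrans (RintegralD _ A1 B1)).
  rewrite S0 A0 B0 !cE; move: (Ei ord0 e) (Ei 1 e) (Ei ord_max e) (Ei ord0 s) (Ei 1 s) (Ei ord_max s).
  by move=> *; ring.
- apply: eq_integrable (integrableD _ S1 iAB) => // t _.
  by rewrite /= /K cK.
- move=> t; have -> : weak_integrand (frc b n) (vel b n g) phi t =
      (fun x => Ki ord0 t x + (Ki 1 t x + Ki ord_max t x)) by apply/funext => x; exact: KE.
  by apply: continuous_add => //; exact: continuous_add.
- move=> t; under eq_fun do rewrite EE.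
  by apply: continuous_add => //; exact: continuous_add.
Qed.

End stage_fields.

(** * Bounds for test functions *)

Section test_function_bounds.
Context {R : realType}.
Implicit Types (g : R * space3 R -> R) (x : space3 R).

Lemma periodic_moved_int (W : Type) (f : space3 R -> W) i (m : int) x :
  torus_periodic f -> f (moved i m%:~R x) = f x.
Proof.
move=> pf; have Hn (k : nat) y : f (moved i k%:R y) = f y.
  elim: k y => [|k IH] y; first by rewrite moved0.
  by rewrite -[k.+1%:R]natr1 -movedD IH periodic_moved1.
case: m => k; first exact: Hn.
by rewrite NegzE mulrNz -(Hn k.+1) movedD subrr moved0.
Qed.

Lemma torus_representative x : exists2 y, cube y &
  forall (W : Type) (f : space3 R -> W), torus_periodic f -> f x = f y.
Proof.
pose m (r : R) : R := - (Num.floor r)%:~R.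
pose y := moved ord_max (m x.2) (moved 1 (m x.1.2) (moved ord0 (m x.1.1) x)).
have fr (r : R) : 0 <= r + m r <= 1.
  by have /andP[h1 h2] := floor_itv r; move: h2; rewrite intrD /m; lra.
exists y.
  by rewrite /y /moved /= /cube /=; split; [split|]; rewrite /= in_itv /=.
by move=> W f pf; rewrite /y /m -!mulrNz !periodic_moved_int.
Qed.

Lemma continuous_bounded_torus g : continuous g -> periodic4 g ->
  exists M, forall t x, 0 <= t <= 2 -> `|g (t, x)| <= M.
Proof.
move=> cg pg; have [M hM] := continuous_bounded_slab 0 2 cg; exists M => t x t02.
have [y cy E] := torus_representative x.
by rewrite (E _ (fun x => g (t, x)) (pg t)); exact: hM.
Qed.

Definition bounded_test (M : R) g := [/\ 0 <= M,
  forall t x, 0 <= t <= 2 -> `|g (t, x)| <= M /\ `|dt g (t, x)| <= M,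
  forall t x i, 0 <= t <= 2 -> `|dx i g (t, x)| <= M,
  forall t x i r, 0 <= t <= 2 -> `|g (t, moved i r x) - g (t, x)| <= M * `|r| &
  forall t s x, 0 <= t -> t <= s -> s <= 2 -> `|g (s, x) - g (t, x)| <= M * (s - t)].

Lemma test_scalar_bounded g : test_scalar g -> exists M, bounded_test M g.
Proof.
move=> [cg dg pg].
have bd v : exists M, forall t x, 0 <= t <= 2 -> `|'D_v g (t, x)| <= M.
  exact: (continuous_bounded_torus (dg v).2 (periodic4_derive v pg)).
have [M0 h0] := continuous_bounded_torus cg pg.
have [Mt ht] := bd (1, 0).
have [M1 h1] := bd (0, unit_vec ord0).
have [M2 h2] := bd (0, unit_vec 1).
have [M3 h3] := bd (0, unit_vec ord_max).
pose M := `|M0| + `|Mt| + `|M1| + `|M2| + `|M3|.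
have ML : [/\ M0 <= M, Mt <= M, M1 <= M, M2 <= M & M3 <= M].
  rewrite /M; have := (ler_norm M0, ler_norm Mt, ler_norm M1, ler_norm M2, ler_norm M3).
  have := (normr_ge0 M0, normr_ge0 Mt, normr_ge0 M1, normr_ge0 M2, normr_ge0 M3).
  by move=> -[[[[a1 a2] a3] a4] a5] [[[[b1 b2] b3] b4] b5]; split; lra.
have [L0 L1 L2 L3 L4] := ML.
have M0' : 0 <= M by rewrite /M !addr_ge0.
have hx t x i : 0 <= t <= 2 -> `|dx i g (t, x)| <= M.
  move=> t02; have [->|->|->] : [\/ i = ord0, i = 1 | i = ord_max].
  - by case: i => -[|[|[|//]]] ?; [apply: Or31|apply: Or32|apply: Or33]; exact/val_inj.
  - exact: le_trans (h1 _ _ t02) _.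
  - exact: le_trans (h2 _ _ t02) _.
  - exact: le_trans (h3 _ _ t02) _.
have dline (y v : R * space3 R) (s : R) :
    is_derive s 1 (fun s => g (y + s *: v)) ('D_v g (y + s *: v)).
  by apply: is_derive_line; exact: (dg v).1.
have E t x i (r : R) : ((t, x) + r *: (0, unit_vec i) : R * space3 R) = (t, moved i r x).
  by rewrite movedE; congr (_, _); rewrite /= scaler0 addr0.
exists M; split => //.
- by move=> t x t02; split; [exact: le_trans (h0 _ _ t02) _|exact: le_trans (ht _ _ t02) _].
- move=> t x i r t02.
  have step y s : 0 <= s -> `|g (t, moved i s y) - g (t, y)| <= M * s.
    move=> s0; have := MVT_closed s0 (fun u _ => dline (t, y) (0, unit_vec i) u).
    rewrite scale0r addr0 E subr0 => -[u _ ->]; rewrite E normrM (ger0_norm s0).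
    by rewrite ler_wpM2r //; exact: hx.
  case/orP: (le_total 0 r) => r0; first by rewrite (ger0_norm r0); exact: step.
  have Nr : 0 <= - r by rewrite oppr_ge0.
  have := step (moved i r x) (- r) Nr.
  by rewrite movedD addNr moved0 distrC (ler0_norm r0).
- move=> t s x t0 ts s2.
  have dl (u : R) : is_derive u 1 (fun u => g (u, x)) (dt g (u, x)).
    have := dline (0, x) (1, 0) u.
    have EE r : ((0, x) + r *: (1, 0) : R * space3 R) = (r, x).
      by congr (_, _); rewrite /= ?scaler0 ?addr0 // add0r /GRing.scale /= mulr1.
    by under eq_fun do rewrite EE; rewrite EE.
  have [u /andP[u1 u2] ->] := MVT_closed ts (fun u _ => dl u).
  rewrite normrM [X in _ * X]ger0_norm ?subr_ge0 //.
  rewrite ler_wpM2r ?subr_ge0 //; apply: le_trans (ht _ _ _) L1.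
  by rewrite (le_trans t0 u1) (le_trans u2 s2).
Qed.

End test_function_bounds.

(** * The solutions *)

Section solution.
Context {R : realType}.
Variable delta : nat -> R.
Hypotheses (delta0 : delta 0%N = 1) (delta_gt0 : forall n, 0 < delta n).
Hypothesis (delta_lt : forall n, delta n.+1 < delta n).
Hypothesis (delta_cvg : delta n @[n --> \oo] --> (0 : R)).
Local Notation T := (T delta).
Local Notation stage := (stage delta).
Local Notation piece := (piece delta).
Local Notation prof := (prof delta).
Local Notation prof1 := (prof1 delta).
Local Notation prof2 := (prof2 delta).
Local Notation vel := (vel delta).
Local Notation frc := (frc delta).
Local Notation carried := (carried delta).
Implicit Types (g : space3 R -> R) (phi : R -> vfield R) (b : bool) (n : nat).

(** g1 is carried before time 1 and g2 after it; both are labelled by the positions at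
time 0, or at time 2. *)
Definition sol g1 g2 (t : R) : vfield R :=
  vel (side t) (stage t) (if side t then g2 else g1) t.

Definition force (t : R) : vfield R := frc (side t) (stage t) t.

Lemma sol_piece g1 g2 b n t : piece b n t ->
  sol g1 g2 t = vel b n (if b then g2 else g1) t.
Proof.
by move=> p; rewrite /sol (piece_side delta_gt0 p) (piece_stage delta_gt0 delta_lt p).
Qed.

Lemma force_piece b n t : piece b n t -> force t = frc b n t.
Proof.
by move=> p; rewrite /force (piece_side delta_gt0 p) (piece_stage delta_gt0 delta_lt p).
Qed.

Lemma vel_lo b n g t : clock b t = T n ->
  vel b n g t = fun x => \row_i (if i == ord_max then g (Z n x) else 0).
Proof.
move=> h; have [p0 p1] := prof_lo h; apply/funext => x; apply/rowP => i.
rewrite !mxE p1 mul0r /carried p0 oppr0 Phi0.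
by case: (eqVneq i (dir n)) => // ->; rewrite dir_neq3.
Qed.

Lemma vel_hi b n g t : clock b t = T n.+1 -> vel b n g t = vel b n.+1 g t.
Proof.
move=> h; rewrite (vel_lo _ h); have [p0 p1] := prof_hi delta_lt h.
apply/funext => x; apply/rowP => i.
rewrite !mxE p1 mul0r /carried p0.
by case: (eqVneq i (dir n)) => // ->; rewrite dir_neq3.
Qed.

Lemma sol_closed_piece g1 g2 b n t : T n <= clock b t <= T n.+1 ->
  sol g1 g2 t = vel b n (if b then g2 else g1) t.
Proof.
move=> /andP[h1]; rewrite le_eqVlt => /predU1P[h2|h2]; last first.
  by apply: sol_piece; rewrite /piece /= h1.
rewrite (vel_hi _ h2); apply: sol_piece; rewrite /piece /= h2 lexx /=.
exact: TS_lt.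
Qed.

Lemma profile_if g1 g2 b : profile_ok g1 -> profile_ok g2 ->
  profile_ok (if b then g2 else g1).
Proof. by case: b. Qed.

Lemma vel_periodic b n g t : profile_ok g -> torus_periodic (vel b n g t).
Proof.
move=> [_ pg _] x i; apply/rowP => j.
by rewrite !mxE shear_periodic /carried Phi_periodic Z_periodic pg.
Qed.

Lemma frc_periodic b n t : torus_periodic (frc b n t).
Proof. by move=> x i; apply/rowP => j; rewrite !mxE shear_periodic. Qed.

Lemma continuous_vel_joint b n g i : profile_ok g ->
  continuous (fun z : R * space3 R => vel b n g z.1 z.2 0 i).
Proof.
move=> [cg _ _]; under eq_fun do rewrite mxE.
case: (i == dir n).
  apply: continuous_mul.
    by apply: continuous_comp2 (@continuous_prof1 _ _ b n); exact: continuous_fst.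
  by apply: continuous_comp2 (@continuous_shear _ n); exact: continuous_snd.
case: (i == ord_max); last exact: continuous_cst_fun.
apply: continuous_comp2 cg; apply: continuous_comp2 (@continuous_Z _ n).
apply: continuous_Phi; last exact: continuous_snd.
apply: continuous_opp.
by apply: continuous_comp2 (@continuous_prof _ _ b n); exact: continuous_fst.
Qed.

Lemma continuous_frc_joint b n i :
  continuous (fun z : R * space3 R => frc b n z.1 z.2 0 i).
Proof.
under eq_fun do rewrite mxE.
case: (i == dir n); last exact: continuous_cst_fun.
apply: continuous_mul.
  by apply: continuous_comp2 (@continuous_prof2 _ _ b n); exact: continuous_fst.
by apply: continuous_comp2 (@continuous_shear _ n); exact: continuous_snd.
Qed.

(** The values at the single time 1 are never specified, but the joint measurability has to
account for them. *)
Lemma measurable_field_pieces (f : R -> vfield R) (F : bool -> nat -> R -> vfield R) :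
  (forall b n t, piece b n t -> f t = F b n t) ->
  (forall b n i, continuous (fun z : R * space3 R => F b n z.1 z.2 0 i)) ->
  (forall i, continuous (fun x => f 1 x 0 i)) ->
  measurable_field 2 f.
Proof.
move=> fF cF cf i.
pose p : R * space3 R -> R := fst.
have mp : measurable_fun setT p by exact: measurable_fst.
have m02 : measurable (p @^-1` `[0, 2]%classic).
  by rewrite -[X in measurable X]setTI; apply: mp => //; exact: measurable_itv.
have mh : measurable_fun (p @^-1` `[0, 2]%classic) (fun z : R * space3 R => f z.1 z.2 0 i).
  apply: (measurable_fun_pieces delta0 delta_gt0 delta_lt delta_cvg mp).
  - move=> b n; apply: (@eq_measurable_fun _ _ _ _ _ (fun z => F b n z.1 z.2 0 i)).
      by move=> z /set_mem /= /fF ->.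
    by apply: measurable_funTS; exact: continuous_measurable4.
  - apply: (@eq_measurable_fun _ _ _ _ _ (fun z => f 1 z.2 0 i)).
      by move=> z /set_mem /= <-.
    apply: measurable_funTS; apply: continuous_measurable4.
    by apply: (continuous_comp2 _ (cf i)); exact: continuous_snd.
apply: (measurable_funS m02 _ mh).
by move=> [t x] /= []; rewrite !in_itv /= => /andP[t0 t2] _; rewrite !ltW.
Qed.

Lemma continuous_section4 (U : topologicalType) (f : R * space3 R -> U) t :
  continuous f -> continuous (fun x => f (t, x)).
Proof. by move=> cf; apply: (continuous_comp2 _ cf); exact: continuous_pairr. Qed.

Lemma measurable_sol g1 g2 : profile_ok g1 -> profile_ok g2 ->
  measurable_field 2 (sol g1 g2).
Proof.
move=> o1 o2; apply: (measurable_field_pieces (F := fun b n => vel b n (if b then g2 else g1))).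
- by move=> b n t; exact: sol_piece.
- by move=> b n i; apply: continuous_vel_joint; exact: profile_if.
- move=> i; rewrite /sol; have h := @continuous_vel_joint (side (1 : R)) (stage (1 : R)) _ i (profile_if (side (1 : R)) o1 o2).
  exact: (@continuous_comp2 _ _ _ (fun x : space3 R => (1 : R, x)) _ (@continuous_pairr _ _ (1 : R)) h).
Qed.

Lemma measurable_force : measurable_field 2 force.
Proof.
apply: (measurable_field_pieces (F := frc)).
- by move=> b n t; exact: force_piece.
- by move=> b n i; exact: continuous_frc_joint.
- move=> i; rewrite /force; have h := @continuous_frc_joint (side (1 : R)) (stage (1 : R)) i.
  exact: (@continuous_comp2 _ _ _ (fun x : space3 R => (1 : R, x)) _ (@continuous_pairr _ _ (1 : R)) h).
Qed.

End solution.

Section solution_weak.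
Context {R : realType}.
Local Notation mu := (@lebesgue_measure R).
Local Notation mu3 := ((mu \x mu) \x mu)%E.
Variable delta : nat -> R.
Hypotheses (delta0 : delta 0%N = 1) (delta_gt0 : forall n, 0 < delta n).
Hypothesis (delta_lt : forall n, delta n.+1 < delta n).
Hypothesis (delta_cvg : delta n @[n --> \oo] --> (0 : R)).
Local Notation T := (T delta).
Local Notation tau := (tau delta).
Local Notation stage := (stage delta).
Local Notation piece := (piece delta).
Local Notation vel := (vel delta).
Local Notation frc := (frc delta).
Local Notation sol := (sol delta).
Local Notation force := (force delta).
Implicit Types (g : space3 R -> R) (phi : R -> vfield R) (b : bool) (n : nat).
Variables (C0 CF : R).
Hypothesis tau_scale : forall n, scale n <= C0 * tau n.
Hypothesis force_sum : forall n, scale n / tau n ^+ 2 * tau n <= CF * 2^-1 ^+ n.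

Let tau_pos n : 0 < tau n. Proof. exact: tau_gt0. Qed.

Let C0_ge0 : 0 <= C0.
Proof.
have := le_trans (ltW (scale_gt0 0)) (tau_scale 0).
by rewrite pmulr_lge0.
Qed.

Lemma norm_sum3 (F : 'I_3 -> R) (c : R) : (forall i, `|F i| <= c) -> `|\sum_(i < 3) F i| <= 3 * c.
Proof.
move=> Fc; apply: (le_trans (ler_norm_sum _ _ _)).
apply: (@le_trans _ _ (\sum_(i < 3) c)); first by apply: ler_sum => i _.
by rewrite sumr_const card_ord mulr_natl.
Qed.

(** The velocity of stage n is at most 2 scale n / tau n, and the carried profile is at most
1. *)
Definition vmax : R := 2 * C0 + 1.

Lemma vel_bound b n g t x i : T n <= clock b t <= T n.+1 -> (forall y, `|g y| <= 1) ->
  `|vel b n g t x 0 i| <= vmax.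
Proof.
move=> ht hg; rewrite mxE /vmax; case: ifP => _.
  apply: (@le_trans _ _ (2 * C0)); last by rewrite lerDl.
  rewrite normrM; apply: (@le_trans _ _ (2 / tau n * scale n)).
    apply: ler_pM => //; first exact: prof1_bound.
    by rewrite ger0_norm ?shear_ge0 // shear_le.
  by rewrite -mulrA ler_pM2l // mulrC ler_pdivrMr // tau_scale.
case: ifP => _; last by rewrite normr0 addr_ge0 // mulr_ge0.
by apply: (le_trans (hg _)); rewrite lerDr mulr_ge0.
Qed.

Lemma frc_bound b n t x i : T n <= clock b t <= T n.+1 ->
  `|frc b n t x 0 i| <= 6 * (scale n / tau n ^+ 2).
Proof.
move=> ht; rewrite mxE; case: ifP => _; last first.
  by rewrite normr0 mulr_ge0 // divr_ge0 ?exprn_ge0 // ltW ?scale_gt0.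
rewrite normrM; apply: (@le_trans _ _ (6 / tau n ^+ 2 * scale n)).
  apply: ler_pM => //; first exact: prof2_bound.
  by rewrite ger0_norm ?shear_ge0 // shear_le.
by rewrite -mulrA [_^-1 * _]mulrC.
Qed.

Lemma piece_closed b n t : piece b n t -> T n <= clock b t <= T n.+1.
Proof. by move=> /andP[h1 h2]; rewrite h1 ltW. Qed.

Lemma sol_bound g1 g2 t x i : (forall y, `|g1 y| <= 1) -> (forall y, `|g2 y| <= 1) ->
  0 <= t <= 2 -> t != 1 -> `|sol g1 g2 t x 0 i| <= vmax.
Proof.
move=> h1 h2 t02 t1; have [b [n p]] := piece_cover delta0 delta_cvg t02 t1.
rewrite (sol_piece delta_gt0 delta_lt g1 g2 p); apply: vel_bound; first exact: piece_closed.
by case: (b).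
Qed.

Lemma weak_integrand_bound (F v phi : R -> vfield R) t x (Vm Fm M : R) :
  (forall i, `|v t x 0 i| <= Vm) -> (forall i, `|F t x 0 i| <= Fm) ->
  (forall i, `|derive1 (fun s => phi s x 0 i) t| <= M) ->
  (forall i j, `|partial j (fun y => phi t y 0 i) x| <= M) ->
  (forall i, `|phi t x 0 i| <= M) ->
  `|weak_integrand F v phi t x| <= 3 * (Vm * M) + 3 * (3 * (Vm * Vm * M)) + 3 * (Fm * M).
Proof.
move=> hv hF h1 h2 h3; rewrite /weak_integrand /dot.
apply: (le_trans (ler_normD _ _)); apply: lerD.
  apply: (le_trans (ler_normD _ _)); apply: lerD.
    by apply: norm_sum3 => i; rewrite normrM; apply: ler_pM.
  apply: norm_sum3 => i; apply: norm_sum3 => j.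
  by rewrite !normrM; apply: ler_pM => //; rewrite ?mulr_ge0 //; apply: ler_pM.
by apply: norm_sum3 => i; rewrite normrM; apply: ler_pM.
Qed.

(** Dominated by the step function M (stage t), of finite integral. *)
Lemma integrable_on_pieces (K : R -> R) (M : nat -> R) (C : R) :
  (forall b n, measurable_fun (piece b n) K) ->
  (forall n, 0 <= M n) -> (forall b n t, piece b n t -> `|K t| <= M n) ->
  (forall n, M n * tau n <= C * 2^-1 ^+ n) ->
  mu.-integrable `[0, 2] (EFin \o K).
Proof.
move=> mK M0 KM MC.
have mK2 : measurable_fun (`[0, 2]%classic : set R) (EFin \o K).
  apply/measurable_EFinP.
  exact: (measurable_fun_stage delta0 delta_gt0 delta_lt delta_cvg mK).
apply/integrableP; split=> //.
apply: le_lt_trans (step_integral_lty delta0 delta_gt0 delta_lt delta_cvg M0 MC).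
have mS := measurable_step delta0 delta_gt0 delta_lt delta_cvg M.
have mN : measurable_fun (`[0, 2]%classic : set R) (fun t => `|(EFin \o K) t|%E).
  exact: measurableT_comp.
have h1 : mu [set (1 : R)] = 0%E by exact: lebesgue_measure_set1.
have sub : `[0, 2]%classic `\` [set (1 : R)] `<=` `[0, 2]%classic by exact: subDsetl.
have -> : (\int[mu]_(t in `[0%R, 2%R]) `|(EFin \o K) t| =
    \int[mu]_(t in `[0%R, 2%R] `\` [set 1%R]) `|(EFin \o K) t|)%E.
  by apply: ge0_negligible_integral.
have -> : (\int[mu]_(t in `[0%R, 2%R]) (M (stage t))%:E =
    \int[mu]_(t in `[0%R, 2%R] `\` [set 1%R]) (M (stage t))%:E)%E.
  by apply: ge0_negligible_integral => // t _; rewrite lee_fin.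
apply: ge0_le_integral => //.
- by apply: measurableD.
- exact: measurable_funS mN.
- exact: measurable_funS mS.
- move=> t [/=]; rewrite in_itv /= => t02 /eqP t1; rewrite lee_fin.
  have [b [n p]] := piece_cover delta0 delta_cvg t02 t1.
  by rewrite (piece_stage delta_gt0 delta_lt p); exact: KM p.
Qed.

Variable CT : R.
Hypothesis tau_sum : forall n, tau n <= CT * 2^-1 ^+ n.

(** [ftc_across] for a function K given by a continuous formula on each stage, with bounds
M n that are summable against the lengths of the stages. *)
Lemma ftc_pieces (K E : R -> R) (Kn En : bool -> nat -> R -> R) (M : nat -> R) (C : R) :
  (forall b n t, piece b n t -> K t = Kn b n t) ->
  (forall b n t, T n <= clock b t <= T n.+1 -> E t = En b n t) ->
  (forall b n a c, a <= c -> \int[mu]_(t in `[a, c]) Kn b n t = En b n c - En b n a /\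
     mu.-integrable `[a, c] (EFin \o Kn b n)) ->
  (forall n, 0 <= M n) -> (forall b n t, piece b n t -> `|K t| <= M n) ->
  (forall n, M n * tau n <= C * 2^-1 ^+ n) ->
  E (2 - T n) - E (T n) @[n --> \oo] --> (0 : R) ->
  mu.-integrable `[0, 2] (EFin \o K) /\
  forall t, 0 <= t -> t <= 2 -> t != 1 -> \int[mu]_(s in `[0, t]) K s = E t - E 0.
Proof.
move=> KE EE IE M0 KM MC gap.
have mKn b n a c : measurable_fun (`[a, c]%classic : set R) (Kn b n).
  have [ac|ca] := lerP a c.
    have [_ /measurable_int] := IE b n a c ac.
    by move/measurable_EFinP.
  by rewrite set_itv_ge ?bnd_simp -?ltNge //; exact: measurable_fun_set0.
have mK b n : measurable_fun (piece b n) K.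
  apply: (@eq_measurable_fun _ _ _ _ _ (Kn b n)).
    by move=> t /set_mem /KE ->.
  rewrite piece_itv; case: b.
    apply: measurable_funS (mKn true n (2 - T n.+1) (2 - T n)) => //.
    by apply: subset_itv; rewrite bnd_simp.
  apply: measurable_funS (mKn false n (T n) (T n.+1)) => //.
  by apply: subset_itv; rewrite bnd_simp.
have iK := integrable_on_pieces mK M0 KM MC.
split=> // t t0 t2 t1.
have int b n a c : a <= c -> (forall s, a <= s <= c -> T n <= clock b s <= T n.+1) ->
    (forall s, a < s < c -> piece b n s) -> \int[mu]_(t in `[a, c]) K t = E c - E a.
  move=> ac hc hp; have [I _] := IE b n a c ac.
  rewrite !(EE b n) ?hc ?lexx ?ac // -I /Rintegral; congr fine.
  apply: eq_integral_itv_bounded.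
  - apply: (@eq_measurable_fun _ _ _ _ _ (Kn b n)).
      by move=> s /set_mem /=; rewrite in_itv /= => /hp /KE ->.
    apply: measurable_funS (mKn b n a c) => //.
    by apply: subset_itv; rewrite bnd_simp.
  - apply: measurable_funS (mKn b n a c) => //.
    by apply: subset_itv; rewrite bnd_simp.
  - by move=> s; rewrite in_itv /= => /hp /KE.
apply: (ftc_across (T0 delta0) _ (T_cvg delta_cvg) iK _ _ gap) => //.
- by move=> n; exact: ltW (TS_lt delta_lt n).
- move=> n a c h1 h2 h3; apply: (int false n) => // s /andP[s1 s2].
    by rewrite /clock (le_trans h1 s1) (le_trans s2 h3).
  by rewrite /piece /= /clock (le_trans h1 (ltW s1)) (lt_le_trans s2 h3).
- move=> n a c h1 h2 h3; apply: (int true n) => // s /andP[s1 s2].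
    by rewrite /clock; apply/andP; split; lra.
  by rewrite /piece /= /clock; apply/andP; split; lra.
Qed.

Lemma test_field_bounded phi : test_field 2 phi ->
  exists M, forall i, bounded_test M (fun z : R * space3 R => phi z.1 z.2 0 i).
Proof.
move=> [sphi pphi _ _].
have /choice[M hM] : forall i, exists M, bounded_test M (fun z : R * space3 R => phi z.1 z.2 0 i).
  by move=> i; apply: test_scalar_bounded; exact: test_scalar_coord.
exists (\sum_(i < 3) M i) => i.
have Mi j : 0 <= M j by have [] := hM j.
have ML : M i <= \sum_(i < 3) M i.
  by rewrite (bigD1 i) //= lerDl sumr_ge0.
have [h0 h1 h2 h3 h4] := hM i; split.
- by rewrite sumr_ge0.
- by move=> t x /(h1 t x)[a1 a2]; split; [exact: le_trans a1 _|exact: le_trans a2 _].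
- by move=> t x j /(h2 t x j) a1; exact: le_trans a1 _.
- by move=> t x j r /(h3 t x j r) a1; apply: (le_trans a1); rewrite ler_wpM2r.
- move=> t s x t0 ts s2; apply: (le_trans (h4 t s x t0 ts s2)).
  by rewrite ler_wpM2r // subr_ge0.
Qed.

(** Quantitative weak convergence to 0 of g1 o Z n - g2 o Z n, tested against bounded
Lipschitz functions: the condition under which g1 may be replaced by g2 at time
1. *)
Definition matched (g1 g2 : space3 R -> R) (eps : nat -> R) :=
  forall n (psi : space3 R -> R) (M : R), continuous psi -> torus_periodic psi ->
    (forall x, `|psi x| <= M) ->
    (forall i r x, `|psi (moved i r x) - psi x| <= M * `|r|) ->
    `|cint (fun x => g2 (Z n x) * psi x) - cint (fun x => g1 (Z n x) * psi x)| <= M * eps n.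

Definition initial (g : space3 R -> R) : vfield R :=
  fun x => \row_i (if i == ord_max then g x else 0).

Lemma sol_T g1 g2 b n :
  sol g1 g2 (clock b (T n)) = initial (fun x => (if b then g2 else g1) (Z n x)).
Proof.
have cT : clock b (clock b (T n)) = T n by rewrite clockK.
rewrite (@sol_closed_piece _ _ delta_gt0 delta_lt _ _ b n); first by rewrite vel_lo.
by rewrite cT lexx /= ltW // TS_lt.
Qed.

Lemma dot_initial g (u : vfield R) x : dot (initial g x) (u x) = g x * u x 0 ord_max.
Proof.
rewrite /dot (bigD1 ord_max) //= mxE eqxx big1 ?addr0 // => i /negbTE h.
by rewrite mxE h mul0r.
Qed.

(** E is the momentum tested against phi, and K its time derivative as prescribed by the
weak formulation.  The momenta at the mirrored times T n and 2 - T n differ by the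
weak gap between g1 and g2 and by the time variation of phi, and both vanish in
the limit; thus no mass of K is lost at time 1.  Finally phi vanishes at time 2. *)
Lemma weak_formulation g1 g2 (eps : nat -> R) phi :
  profile_ok g1 -> profile_ok g2 ->
  (forall y, `|g1 y| <= 1) -> (forall y, `|g2 y| <= 1) ->
  matched g1 g2 eps -> eps n @[n --> \oo] --> (0 : R) ->
  test_field 2 phi ->
  (\int[mu]_(t in `]0%R, 2%R[) \int[mu3]_(x in cube)
      (weak_integrand force (sol g1 g2) phi t x)%:E
   + \int[mu3]_(x in cube) (dot (initial g1 x) (phi 0%R x))%:E = 0)%E.
Proof.
move=> o1 o2 b1 b2 mat eps0 tphi; have [sphi pphi [c c2 phic] _] := tphi.
have [M hM] := test_field_bounded tphi.
have M0 : 0 <= M by have [] := hM ord0.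
have og b : profile_ok (if b then g2 else g1) by exact: profile_if.
pose gb b := if b then g2 else g1 : space3 R -> R.
pose Kn b n t := cint (weak_integrand (frc b n) (vel b n (gb b)) phi t).
pose En b n t := cint (fun x => dot (vel b n (gb b) t x) (phi t x)).
pose K t := cint (weak_integrand force (sol g1 g2) phi t).
pose E t := cint (fun x => dot (sol g1 g2 t x) (phi t x)).
have cwi t : continuous (weak_integrand force (sol g1 g2) phi t).
  have [_ _ /(_ t) + _] := stage_weak delta (side t) (stage t) (lexx 0) (og (side t)) sphi pphi.
  by rewrite /weak_integrand.
have wieq b n t : piece b n t ->
    weak_integrand force (sol g1 g2) phi t = weak_integrand (frc b n) (vel b n (gb b)) phi t.
  move=> p; apply/funext => x; rewrite /weak_integrand.
  by rewrite (force_piece delta_gt0 delta_lt p) (sol_piece delta_gt0 delta_lt g1 g2 p).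
have KE b n t : piece b n t -> K t = Kn b n t by move=> p; rewrite /K (wieq _ _ _ p).
have EE b n t : T n <= clock b t <= T n.+1 -> E t = En b n t.
  by move=> h; rewrite /E (sol_closed_piece delta_gt0 delta_lt g1 g2 h).
have IE b n s e : s <= e -> \int[mu]_(t in `[s, e]) Kn b n t = En b n e - En b n s /\
     mu.-integrable `[s, e] (EFin \o Kn b n).
  by move=> se; have [h1 h2 _ _] := stage_weak delta b n se (og b) sphi pphi.
pose A0 := 3 * (vmax * M) + 3 * (3 * (vmax * vmax * M)).
have vm0 : 0 <= vmax by rewrite /vmax addr_ge0 // mulr_ge0.
have A00 : 0 <= A0 by rewrite /A0 addr_ge0 // !mulr_ge0.
have s0 n : 0 <= scale n / tau n ^+ 2 :> R.
  by rewrite divr_ge0 ?exprn_ge0 // ltW ?scale_gt0.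
pose MM n := A0 + 3 * (6 * (scale n / tau n ^+ 2) * M).
have MM0 n : 0 <= MM n.
  by rewrite /MM addr_ge0 // mulr_ge0 // mulr_ge0 // mulr_ge0.
have KM b n t : piece b n t -> `|K t| <= MM n.
  move=> p; rewrite (KE b n t p); have cl := piece_closed p.
  have t02 : 0 <= t <= 2 by exact: (piece_sub delta0 delta_gt0 delta_lt p).
  have [_ _ cw _] := stage_weak delta b n (lexx 0) (og b) sphi pphi.
  apply: cint_bound; first exact: cw.
  move=> x _; apply: weak_integrand_bound.
  - by move=> i; apply: vel_bound => // y; rewrite /gb; case: (b).
  - by move=> i; apply: frc_bound.
  - by move=> i; rewrite (@derive1_dt _ (fun z => phi z.1 z.2 0 i)); have [_ /(_ t x t02)[_ ]] := hM i.
  - by move=> i j; rewrite (@partialE _ (fun z => phi z.1 z.2 0 i)); have [_ _ /(_ t x j t02)] := hM i.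
  - by move=> i; have [_ /(_ t x t02)[]] := hM i.
have MC n : MM n * tau n <= (A0 * CT + 3 * 6 * M * CF) * 2^-1 ^+ n.
  rewrite /MM mulrDl [X in _ <= X]mulrDl; apply: lerD.
    by rewrite -[X in _ <= X]mulrA ler_wpM2l.
  have -> : 3 * (6 * (scale n / tau n ^+ 2) * M) * tau n =
      3 * 6 * M * (scale n / tau n ^+ 2 * tau n) by ring.
  by rewrite -[X in _ <= X]mulrA ler_wpM2l // !mulr_ge0.

have cT b n : T n <= clock b (clock b (T n)) <= T n.+1.
  by rewrite clockK lexx /= ltW // TS_lt.
have T01 n : 0 <= T n < 1.
  by rewrite T_lt1 // andbT; exact: T_ge0.
have cphi i t : continuous (fun x => phi t x 0 i).
  have [h _ _] := test_scalar_coord i sphi pphi.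
  exact: (continuous_section4 (f := fun z : R * space3 R => phi z.1 z.2 0 i)).
have E_T b n : E (clock b (T n)) = cint (fun x => gb b (Z n x) * phi (clock b (T n)) x 0 ord_max).
  by rewrite /E; congr cint; apply/funext => x; rewrite sol_T dot_initial.
have cg b n : continuous (fun x => gb b (Z n x)) by have [] := profile_Z n (og b).
(* The gap is estimated with phi frozen at time 2 - T n, and then phi is moved back to
time T n, during a time 2 delta n. *)
have gapn n : `|E (2 - T n) - E (T n)| <= M * eps n + 2 * M * delta n.
  have E1 := E_T true n; have E2 := E_T false n; rewrite /clock in E1; rewrite /clock in E2.
  rewrite E1 E2; have [T0' T1'] := andP (T01 n).
  have [_ hb _ hL hT] := hM ord_max.
  have p1 : torus_periodic (fun x => phi (2 - T n) x 0 ord_max).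
    by move=> x i; rewrite (pphi (2 - T n) x i).
  have t2 : 0 <= 2 - T n <= 2 by apply/andP; split; lra.
  have := mat n _ M (@cphi ord_max (2 - T n)) p1 (fun x => (hb _ x t2).1)
    (fun i r x => hL _ x i r t2).
  change (gb true) with g2; change (gb false) with g1.
  set c2' := cint _; set c1' := cint _; set c0' := cint _ => h1.
  have h2 : `|c1' - c0'| <= 2 * M * delta n.
    rewrite -cintB; last 2 first.
    - by apply: continuous_mul; [exact: (cg false n)|exact: cphi].
    - by apply: continuous_mul; [exact: (cg false n)|exact: cphi].
    apply: cint_bound.
      by move=> x; apply: cvgB; (apply: cvgM; [exact: (cg false n)|exact: cphi]).
    move=> x _; rewrite -mulrBr normrM.
    have h := hT (T n) (2 - T n) x T0' _ _.
    apply: (@le_trans _ _ (1 * (M * (2 - T n - T n)))).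
      by apply: ler_pM => //; apply: h; lra.
    by rewrite mul1r /T; lra.
  have -> : c2' - c0' = (c2' - c1') + (c1' - c0') by ring.
  by apply: (le_trans (ler_normD _ _)); exact: lerD.
have gap0 : M * eps n + 2 * M * delta n @[n --> \oo] --> (0 : R).
  have -> : (0 : R) = M * 0 + 2 * M * 0 by rewrite !mulr0 addr0.
  by apply: cvgD; apply: cvgM => //; exact: cvg_cst.
have gap : E (2 - T n) - E (T n) @[n --> \oo] --> (0 : R).
  apply: (@squeeze_cvgr _ _ _ _ (fun n => - (M * eps n + 2 * M * delta n)) (fun n => M * eps n + 2 * M * delta n)) => //.
  - by near=> n; rewrite -ler_norml.
  - by rewrite -[X in _ --> X]oppr0; exact: cvgN.
have [iK FTC] := ftc_pieces KE EE IE MM0 KM MC gap.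
have h2 := FTC 2 ltac:(lra) (lexx _) ltac:(apply/eqP; lra).
have E2 : E 2 = 0.
  rewrite /E -[RHS](cint_cst 0); congr cint; apply/funext => x.
  by rewrite phic // /dot big1 // => i _; rewrite [X in _ * X]mxE mulr0.
have E0 : E 0 = cint (fun x => dot (initial g1 x) (phi 0 x)).
  have := sol_T g1 g2 false 0; rewrite /clock T0 // => h; rewrite /E h.
  by congr cint.
have -> : (\int[mu3]_(x in cube) (dot (initial g1 x) (phi 0 x))%:E = (E 0)%:E)%E.
  rewrite E0 cintE //.
  have -> : (fun x => dot (initial g1 x) (phi 0 x)) = (fun x => g1 x * phi 0 x 0 ord_max).
    by apply/funext => x; rewrite dot_initial.
  by apply: continuous_mul; [case: o1|exact: cphi].
have -> : (\int[mu]_(t in `]0%R, 2%R[) \int[mu3]_(x in cube) (weak_integrand force (sol g1 g2) phi t x)%:E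
   = \int[mu]_(t in `]0%R, 2%R[) (K t)%:E)%E.
  by apply: eq_integral => t _; rewrite cintE.
rewrite E2 in h2.
have -> : (\int[mu]_(t in `]0%R, 2%R[) (K t)%:E = \int[mu]_(t in `[0%R, 2%R]) (K t)%:E)%E.
  rewrite -(@integral_itv_bndoo _ _ _ _ true false) //.
  apply: measurable_funS (measurable_int _ iK) => //.
  by apply: subset_itv; rewrite bnd_simp.
rewrite -(fineK (integrable_fin_num _ iK)) //=.
rewrite -/(Rintegral mu `[0, 2] K) h2 -EFinD; congr EFin; lra.
Unshelve. all: by end_near.
Qed.

(** Integration by parts against a function constant in the direction i: by periodicity the
integral of dx i f over a period vanishes on each line, and averaging over the
translates of the torus in this direction does not change the left-hand side. *)
Lemma cint_mul_partial (f : R * space3 R -> R) (h : space3 R -> R) i t :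
  test_scalar f -> continuous h -> torus_periodic h ->
  (forall r x, h (moved i r x) = h x) ->
  cint (fun x => h x * dx i f (t, x)) = 0.
Proof.
move=> [_ df pf] ch ph hi.
have cd : continuous (dx i f) := (df _).2.
pose q (z : R * space3 R) := h z.2 * dx i f (t, moved i z.1 z.2).
have cm : continuous (fun z : R * space3 R => moved i z.1 z.2).
  by apply: continuous_moved; [exact: continuous_fst|exact: continuous_snd].
have cq : continuous q.
  apply: continuous_mul; first by apply: continuous_comp2 ch; exact: continuous_snd.
  by apply: continuous_comp2 cd; apply: continuous_comp2 cm _; exact: continuous_pairr.
have E x (r : R) : ((t, x) + r *: (0, unit_vec i) : R * space3 R) = (t, moved i r x).
  by rewrite movedE; congr (_, _); rewrite /= scaler0 addr0.
have I x : (\int[mu]_(s in `[0%R, 1%R]) (q (s, x))%:E = 0%:E)%E.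
  have e0 : h x * f (t, moved i 1 x) - h x * f (t, moved i 0 x) = 0.
    by rewrite moved0 (periodic_moved1 _ _ (pf t)) subrr.
  rewrite -[in RHS]e0; apply: (@FTC2_closed _ (fun s : R => h x * f (t, moved i s x)) (fun s => q (s, x))) => //.
  - by apply: continuous_comp2 cq; exact: continuous_pairl.
  - move=> s _; have d : derivable f ((t, x) + s *: (0, unit_vec i)) (0, unit_vec i) by exact: (df _).1.
    have := is_derive_line d; under eq_fun do rewrite E.
    by rewrite E => D; apply: is_deriveZ.
have [S _] := integral_swap cq I.
have C s : cint (fun x => q (s, x)) = cint (fun x => h x * dx i f (t, x)).
  rewrite -(@cint_moved _ (fun x => h x * dx i f (t, x)) i (fun=> s)) //; last exact: continuous_cst_fun.
  - by congr cint; apply/funext => x; rewrite /q /= hi.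
  - by apply: continuous_mul => //; apply: continuous_comp2 cd; exact: continuous_pairr.
  - by move=> x j; rewrite ph; congr (_ * _); exact: (periodic4_derive (0, unit_vec i) pf).
have S' : (\int[mu]_(s in `[0%R, 1%R]) (cint (fun x => h x * dx i f (t, x)))%:E = 0)%E.
  by rewrite -[RHS](integral0 mu3 (@cube R)) -S; apply: eq_integral => s _; rewrite -(C s).
move: (cint _) S' => k.
have mu01 : mu `[(0 : R), 1] = 1%E.
  by rewrite lebesgue_measure_itv /= lte_fin ltr01 oppr0 adde0.
rewrite (integral_cst mu (measurable_itv `[(0 : R), 1])).
rewrite [X in (_ * X)%E](_ : _ = 1%E) ?mule1; last exact: mu01.
by move=> [].
Qed.

(** Each component is constant in its own direction, so every term of the divergence
vanishes separately. *)
Lemma distr_div_free_invariant (v : R -> vfield R) :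
  (forall t i, continuous (fun x => v t x 0 i)) -> (forall t, torus_periodic (v t)) ->
  (forall t i r x, v t (moved i r x) 0 i = v t x 0 i) ->
  distr_div_free 2 v.
Proof.
move=> cv pv iv psi spsi ppsi _; apply: integral0_eq => t _.
have tpsi : test_scalar (fun z : R * space3 R => psi z.1 z.2).
  have [c d] := spsi 1%N; split=> // w; exact: d.
have cs i : continuous (fun x => v t x 0 i * partial i (psi t) x).
  apply: continuous_mul => //.
  have -> : partial i (psi t) = fun x => dx i (fun z : R * space3 R => psi z.1 z.2) (t, x).
    by apply/funext => x; rewrite -partialE.
  apply: continuous_section4; have [_ d _] := tpsi; exact: (d _).2.
rewrite cintE; last exact: continuous_sum.
congr EFin; rewrite (_ : (fun x => _) = (fun x => v t x 0 ord0 * partial ord0 (psi t) x +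
   (v t x 0 1 * partial 1 (psi t) x + v t x 0 ord_max * partial ord_max (psi t) x))); last first.
  by apply/funext => x; rewrite sum3E.
have Z i : cint (fun x => v t x 0 i * partial i (psi t) x) = 0.
  have pvi : torus_periodic (fun x => v t x 0 i) by move=> x j; rewrite pv.
  have h := cint_mul_partial t tpsi (cv t i) pvi (iv t i).
  by rewrite -[RHS]h; congr cint; apply/funext => x; rewrite -partialE.
apply: (etrans (cintD (cs ord0) (continuous_add (cs 1) (cs ord_max)))).
rewrite -[RHS]addr0; congr (_ + _); first exact: Z.
apply: (etrans (cintD (cs 1) (cs ord_max))).
by rewrite -[RHS]addr0; congr (_ + _); exact: Z.
Qed.

Lemma vel_invariant b n g t i r x : profile_ok g ->
  vel b n g t (moved i r x) 0 i = vel b n g t x 0 i.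
Proof.
move=> og; have [_ _ Z3] := profile_Z n og; rewrite !mxE.
case: eqP => [->|_]; first by rewrite shear_moved.
case: eqP => // ->; rewrite /carried.
rewrite [Phi _ _ (moved _ _ _)]/Phi shear_moved3 moved_comm.
exact: Z3.
Qed.

Lemma frc_invariant b n t i r x :
  frc b n t (moved i r x) 0 i = frc b n t x 0 i.
Proof. by rewrite !mxE; case: eqP => [->|_]; rewrite ?shear_moved. Qed.

Lemma body_force_force : body_force 2 force.
Proof.
split; [by move=> t; exact: frc_periodic|exact: (measurable_force delta0 delta_gt0 delta_lt delta_cvg)|].
apply: distr_div_free_invariant.
- by move=> t i; exact: continuous_section4 (@continuous_frc_joint _ _ _ _ _).
- by move=> t; exact: frc_periodic.
- by move=> *; exact: frc_invariant.
Qed.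

Lemma weak_solution_sol g1 g2 (eps : nat -> R) :
  profile_ok g1 -> profile_ok g2 ->
  (forall y, `|g1 y| <= 1) -> (forall y, `|g2 y| <= 1) ->
  matched g1 g2 eps -> eps n @[n --> \oo] --> (0 : R) ->
  weak_solution 2 force (initial g1) (sol g1 g2).
Proof.
move=> o1 o2 h1 h2 mat e0.
have og (t : R) : profile_ok (if side t then g2 else g1) by exact: profile_if.
have pv (t : R) : torus_periodic (sol g1 g2 t) by exact: vel_periodic.
split=> //.
- exact: (measurable_sol delta0 delta_gt0 delta_lt delta_cvg).
- apply: distr_div_free_invariant => //.
  + move=> t i; have c := @continuous_vel_joint _ delta (side t) (stage t) _ i (og t).
    exact: (@continuous_section4 _ _ _ t c).
  + by move=> *; exact: vel_invariant.
- by move=> phi; exact: (weak_formulation o1 o2 h1 h2 mat e0).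
Qed.

(** * Matching at time 1, energy and non-uniqueness *)

Lemma scale_le_half n : scale n <= 2^-1 ^+ n :> R.
Proof.
elim: n => [|n IH]; first by rewrite expr0 scale_le1.
have h : scale n.+1 * 2 <= scale n :> R.
  rewrite [leRHS]scaleS ler_wpM2l ?(ltW (scale_gt0 _)) //.
  have e1 : 1 <= 256 ^+ n :> R by rewrite exprn_ege1 //; lra.
  by rewrite exprS; lra.
by rewrite exprSr ler_pdivlMr // (le_trans h).
Qed.

Lemma profile_theta0 : profile_ok (@theta0 R).
Proof.
split; [exact: continuous_theta0|exact: theta0_periodic|].
by move=> r x; exact: lip12_moved3 (@theta0_lip R).
Qed.

Lemma profile_beta : profile_ok (@beta R).
Proof.
split; [exact: continuous_beta|exact: beta_periodic|].
by move=> r x; exact: beta_moved3.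
Qed.

Lemma matched_refl g : matched g g (fun=> 0).
Proof. by move=> n psi M _ _ _ _; rewrite subrr normr0 mulr0. Qed.

Lemma matched_beta : matched theta0 beta (fun n => 2^-1 ^+ n + scale n).
Proof.
move=> n psi M cpsi ppsi bpsi lpsi.
have h1 := beta_A_weak n cpsi bpsi; have h2 := A_weak n cpsi ppsi lpsi.
rewrite mulrDr; apply: le_trans (lerD h1 h2).
rewrite [X in _ <= _ + X]distrC; apply: le_trans _ (ler_normD _ _).
by rewrite addrA subrK.
Qed.

Lemma matched_beta_cvg : (2^-1 ^+ n + scale n : R) @[n --> \oo] --> (0 : R).
Proof.
apply: (@squeeze_cvgr _ _ _ _ (fun=> 0) (fun n => 2 * 2^-1 ^+ n)).
- near=> n; apply/andP; split.
    by rewrite addr_ge0 ?exprn_ge0 // ltW ?scale_gt0.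
  by rewrite mulr2n mulrDl mul1r lerD2l scale_le_half.
- exact: cvg_cst.
- exact: cvg_half.
Unshelve. all: by end_near.
Qed.

(** The horizontal kinetic energy of stage n is half of this, times the square of
[prof1]. *)
Definition shear_mass n := cint (fun x => shear n x ^+ 2) : R.

Let continuous_shear_sqr n : continuous (fun x : space3 R => shear n x ^+ 2).
Proof. by apply: continuous_exprn; exact: continuous_shear. Qed.

(** The carried profile contributes its constant energy, as the shears preserve the
integral. *)
Lemma cint_sqr_vel b n g t : profile_ok g ->
  cint (fun x => dot (vel b n g t x) (vel b n g t x)) =
    prof1 delta b n t ^+ 2 * shear_mass n + cint (fun x => g x ^+ 2).
Proof.
move=> og; have [cg pg g3] := og; have [cZ pZ _] := profile_Z n og.
have c2 : continuous (fun x => g (Z n x) ^+ 2) by exact: continuous_exprn.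
have c1 : continuous (fun x => carried delta b n g t x ^+ 2).
  apply: (continuous_comp2 _ c2); apply: continuous_Phi => //; cont.
have -> : (fun x => dot (vel b n g t x) (vel b n g t x)) =
    (fun x => prof1 delta b n t ^+ 2 * shear n x ^+ 2 + carried delta b n g t x ^+ 2).
  apply/funext => x; rewrite /dot (sum3_dir (n := n)) => [|i i1 i2]; last first.
    by rewrite (vel_0 _ _ _ _ _ i1 i2) mul0r.
  by rewrite vel_dir vel_3 -!expr2 exprMn.
rewrite cintD //; last by apply: continuous_mul => //; cont.
rewrite cintZ // /carried; congr (_ + _).
have p2 : torus_periodic (fun x => g (Z n x) ^+ 2) by move=> x i; rewrite pZ.
rewrite (@cint_Phi _ n (- prof delta b n t) _ c2 p2) //.
have c3 : continuous (fun x => g x ^+ 2) by exact: continuous_exprn.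
have p3 : torus_periodic (fun x => g x ^+ 2) by move=> x i; rewrite pg.
exact: (@cint_Z _ n _ c3 p3).
Qed.

Lemma cint_work b n g t : profile_ok g ->
  cint (fun x => dot (frc b n t x) (vel b n g t x)) =
    prof2 delta b n t * prof1 delta b n t * shear_mass n.
Proof.
move=> og; rewrite -cintZ //; congr cint; apply/funext => x.
rewrite /dot (sum3_dir (n := n)) => [|i i1 i2]; last by rewrite (frc_0 _ _ _ _ i1) mul0r.
by rewrite vel_dir frc_dir frc_0 ?mul0r ?addr0; [ring|rewrite eq_sym dir_neq3].
Qed.

Lemma continuous_dot_vel b n g t (F : vfield R) : profile_ok g ->
  (forall i, continuous (fun x => F x 0 i)) -> continuous (fun x => dot (F x) (vel b n g t x)).
Proof.
move=> og cF; rewrite /dot; apply: continuous_sum => i; apply: continuous_mul => //.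
exact: (@continuous_section4 _ _ _ t (@continuous_vel_joint _ delta b n _ i og)).
Qed.

Lemma continuous_vel b n g t i : profile_ok g -> continuous (fun x => vel b n g t x 0 i).
Proof. by move=> og; exact: (@continuous_section4 _ _ _ t (@continuous_vel_joint _ delta b n _ i og)). Qed.

Lemma continuous_frc b n t i : continuous (fun x => frc b n t x 0 i).
Proof. exact: (@continuous_section4 _ _ _ t (@continuous_frc_joint _ delta b n i)). Qed.

Let kin b n (t : R) := prof1 delta b n t ^+ 2 * shear_mass n / 2.

Lemma is_derive_kin b n (t : R) :
  is_derive t 1 (kin b n) (prof2 delta b n t * prof1 delta b n t * shear_mass n).
Proof.
have d := is_derive_prof1 delta b n t.
have -> : kin b n = (shear_mass n / 2) \*: (prof1 delta b n * prof1 delta b n).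
  by apply/funext => s; rewrite /kin /= expr2 -mulrA mulrC; congr (_ * _).
by apply: is_derive_eq; rewrite /GRing.scale /=; field.
Qed.

Lemma energyE b n g t : profile_ok g ->
  (energy (vel b n g t) = (2 * kin b n t + cint (fun x => g x ^+ 2))%:E)%E.
Proof.
move=> og; rewrite /energy cintE.
  by rewrite (cint_sqr_vel _ _ _ og) /kin; congr (_ + _)%:E; field.
by apply: continuous_dot_vel => // i; exact: continuous_vel.
Qed.

Let En (t : R) := kin (side t) (stage t) t.

Let En_closed b n t : T n <= clock b t <= T n.+1 -> En t = kin b n t.
Proof.
have inP b' n' s : piece b' n' s -> En s = kin b' n' s.
  by move=> p; rewrite /En (piece_side delta_gt0 p) (piece_stage delta_gt0 delta_lt p).
move=> /andP[h1]; rewrite le_eqVlt => /predU1P[h2|h2]; last first.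
  by apply: inP; rewrite /piece /= h1.
have p : piece b n.+1 t by rewrite /piece /= h2 lexx /=; exact: TS_lt.
rewrite (inP _ _ _ p) /kin; have [_ ->] := prof_hi delta_lt h2.
by have [_ ->] := prof_lo h2; rewrite expr0n /= !mul0r.
Qed.

(** The work of the force up to time t is the horizontal kinetic energy at time t.  This
energy vanishes at the ends of all stages, so nothing is lost at time 1. *)
Lemma work_integral g1 g2 t : profile_ok g1 -> profile_ok g2 ->
  (forall y, `|g1 y| <= 1) -> (forall y, `|g2 y| <= 1) -> 0 <= t -> t <= 2 -> t != 1 ->
  (\int[mu]_(s in `]0%R, t[) \int[mu3]_(x in cube) (dot (force s x) (sol g1 g2 s x))%:E = (En t)%:E)%E.
Proof.
move=> o1 o2 b1 b2 t0 t2 t1.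
have og b : profile_ok (if b then g2 else g1) by exact: profile_if.
pose K (s : R) := cint (fun x => dot (force s x) (sol g1 g2 s x)).
pose Kn b n (s : R) := prof2 delta b n s * prof1 delta b n s * shear_mass n.
pose MM n := 3 * (6 * (scale n / tau n ^+ 2) * vmax).
have vm0 : 0 <= vmax by rewrite /vmax addr_ge0 // mulr_ge0.
have s0 n : 0 <= scale n / tau n ^+ 2 :> R.
  by rewrite divr_ge0 ?exprn_ge0 // ltW ?scale_gt0.
have MM0 n : 0 <= MM n by rewrite /MM mulr_ge0 // mulr_ge0 // mulr_ge0.
have KE b n s : piece b n s -> K s = Kn b n s.
  move=> p; rewrite /K (force_piece delta_gt0 delta_lt p) (sol_piece delta_gt0 delta_lt g1 g2 p).
  exact: cint_work.
have cKn b n : continuous (Kn b n).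
  have h1 := @continuous_prof1 _ delta b n; have h2 := @continuous_prof2 _ delta b n.
  by apply: continuous_mul; [exact: continuous_mul|exact: continuous_cst_fun].
have IE b n (a c : R) : a <= c -> \int[mu]_(s in `[a, c]) Kn b n s = kin b n c - kin b n a /\
     mu.-integrable `[a, c] (EFin \o Kn b n).
  move=> ac; split.
    apply: (congr1 fine (FTC2_closed ac (@cKn b n) (F := kin b n) _)) => s _.
    exact: is_derive_kin.
  by apply: continuous_compact_integrable; [exact: segment_compact|exact: continuous_subspaceT].
have KM b n s : piece b n s -> `|K s| <= MM n.
  move=> p; have cl := piece_closed p.
  rewrite /K (force_piece delta_gt0 delta_lt p) (sol_piece delta_gt0 delta_lt g1 g2 p).
  apply: cint_bound.
    by apply: continuous_dot_vel => // i; exact: continuous_frc.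
  move=> x _; apply: norm_sum3 => i; rewrite normrM; apply: ler_pM => //.
    exact: frc_bound.
  by apply: vel_bound => // y; case: (b).
have MC n : MM n * tau n <= (3 * 6 * vmax * CF) * 2^-1 ^+ n.
  have -> : MM n * tau n = 3 * 6 * vmax * (scale n / tau n ^+ 2 * tau n) by rewrite /MM; ring.
  by rewrite -[X in _ <= X]mulrA ler_wpM2l // !mulr_ge0.
have En_T b n : En (clock b (T n)) = 0.
  have cT : clock b (clock b (T n)) = T n by rewrite clockK.
  rewrite (En_closed (b := b) (n := n)); last by rewrite cT lexx /= ltW // TS_lt.
  by rewrite /kin; have [_ ->] := prof_lo cT; rewrite expr0n /= !mul0r.
have gap : En (2 - T n) - En (T n) @[n --> \oo] --> (0 : R).
  rewrite (_ : (fun n => _) = fun=> 0); first exact: cvg_cst.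
  by apply/funext => n; have := En_T true n; have := En_T false n; rewrite /clock => -> ->; rewrite subrr.
have [iK FTC] := ftc_pieces KE En_closed IE MM0 KM MC gap.
have E0 : En 0 = 0 by have := En_T false 0; rewrite /clock (T0 delta0).
have iKt : mu.-integrable `[0, t] (EFin \o K).
  apply: integrableS iK => //.
  by apply: subset_itvl; rewrite bnd_simp.
have -> : (\int[mu]_(s in `]0%R, t[) \int[mu3]_(x in cube) (dot (force s x) (sol g1 g2 s x))%:E
   = \int[mu]_(s in `]0%R, t[) (K s)%:E)%E.
  apply: eq_integral => s _; rewrite cintE //.
  by apply: continuous_dot_vel => // i; exact: continuous_frc.
have -> : (\int[mu]_(s in `]0%R, t[) (K s)%:E = \int[mu]_(s in `[0%R, t]) (K s)%:E)%E.
  rewrite -(@integral_itv_bndoo _ _ _ _ true false) //.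
  apply: measurable_funS (measurable_int _ iKt) => //.
  by apply: subset_itv; rewrite bnd_simp.
rewrite -(fineK (integrable_fin_num _ iKt)) //=.
by rewrite -/(Rintegral mu `[0, t] K) FTC // E0 subr0.
Qed.

(** The horizontal energy balances exactly, and the carried profile may only lose energy
at time 1. *)
Lemma admissible_sol g1 g2 : profile_ok g1 -> profile_ok g2 ->
  (forall y, `|g1 y| <= 1) -> (forall y, `|g2 y| <= 1) ->
  cint (fun x => g2 x ^+ 2) <= cint (fun x => g1 x ^+ 2) ->
  admissible 2 force (initial g1) (sol g1 g2).
Proof.
move=> o1 o2 b1 b2 h12.
have og b : profile_ok (if b then g2 else g1) by exact: profile_if.
have vm0 : 0 <= vmax by rewrite /vmax addr_ge0 // mulr_ge0.
have ae1 (P : R -> Prop) : (forall t, 0 <= t <= 2 -> t != 1 -> P t) ->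
    {ae mu, forall t, t \in `]0, 2[ -> P t}.
  move=> h; exists [set 1]; split; [exact: measurable_set1|exact: lebesgue_measure_set1|].
  move=> t /= nP; apply/eqP; apply: contra_notT nP => t1.
  by rewrite in_itv /= => /andP[t0 t2]; apply: h => //; rewrite !ltW.
split.
  exists (3 * (vmax * vmax)); apply: ae1 => t t02 t1.
  have [b [n p]] := piece_cover delta0 delta_cvg t02 t1.
  rewrite (sol_piece delta_gt0 delta_lt g1 g2 p) /energy.
  have cd : continuous (fun x => dot (vel b n (if b then g2 else g1) t x) (vel b n (if b then g2 else g1) t x)).
    by apply: continuous_dot_vel => // i; exact: continuous_vel.
  rewrite cintE // lee_fin (le_trans (ler_norm _)) //; apply: cint_bound => // x _.
  by apply: norm_sum3 => i; rewrite normrM; apply: ler_pM => //;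
    apply: vel_bound; rewrite ?piece_closed //; case: (b).
apply: ae1 => t t02 t1; have [t0 t2] := andP t02.
rewrite (work_integral o1 o2 b1 b2 t0 t2 t1) energyE // -/(En t).
have -> : (energy (initial g1) = (cint (fun x => g1 x ^+ 2))%:E)%E.
  rewrite /energy; under eq_integral do rewrite dot_initial mxE eqxx -expr2.
  by rewrite cintE //; case: o1 => cg _ _; exact: continuous_exprn.
rewrite -EFinM -EFinD lee_fin addrC lerD2r.
by case: (side t).
Qed.

Lemma enorm_le (u : 'rV[R]_3) c : 0 <= c -> (forall i, `|u 0 i| <= c) -> enorm u <= 2 * c.
Proof.
move=> c0 uc; rewrite -(ger0_norm (mulr_ge0 _ c0)) // -sqrtr_sqr /enorm; apply: ler_wsqrtr.
apply: (@le_trans _ _ (3 * (c * c))).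
  apply: (le_trans (ler_norm _)); apply: norm_sum3 => i.
  by rewrite normrM; apply: ler_pM.
by rewrite exprMn -expr2; have := sqr_ge0 c; lra.
Qed.

Lemma bounded_sol g1 g2 : (forall y, `|g1 y| <= 1) -> (forall y, `|g2 y| <= 1) ->
  bounded_field 2 (sol g1 g2).
Proof.
move=> b1 b2; pose c1 := `|prof1 delta (side (1 : R)) (stage 1) 1| * scale (stage 1) + 1.
have vm0 : 0 <= vmax by rewrite /vmax addr_ge0 // mulr_ge0.
have c10 : 0 <= c1 by rewrite addr_ge0 // mulr_ge0 // ltW ?scale_gt0.
(* c1 covers the unspecified values at time 1 *)
exists (2 * (vmax + c1)).
suff h z : spacetime 2 z -> enorm (sol g1 g2 z.1 z.2) <= 2 * (vmax + c1).
  by exists set0; split; [exact: measurable0|exact: (measure0 (mu \x mu3s)%E)|move=> z /= nh; exfalso; apply: nh; exact: h].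
move=> [/=]; rewrite in_itv /= => /andP[t0 t2] _; apply: enorm_le; first exact: addr_ge0.
move=> i; have [t1|t1] := eqVneq z.1 1; last first.
  by apply: (@le_trans _ _ vmax); [apply: sol_bound; rewrite // !ltW|rewrite lerDl].
apply: (@le_trans _ _ c1); last by rewrite lerDr.
rewrite t1 mxE /c1; case: ifP => _.
  rewrite normrM (ger0_norm (shear_ge0 _ _)); apply: (@le_trans _ _ (`|prof1 delta (side (1 : R)) (stage 1) 1| * scale (stage 1))); last by rewrite lerDl.
  by apply: ler_wpM2l => //; exact: shear_le.
case: ifP => _; last by rewrite normr0.
apply: (@le_trans _ _ 1); last by rewrite lerDr mulr_ge0 // ltW ?scale_gt0.
by rewrite /carried; case: (side _).
Qed.

Lemma box_measure (a1 a2 a3 a4 d : R) : 0 < d ->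
  ((mu \x mu3) (`](a1 - d)%R, a1[ `*` ((`]a2, (a2 + d)%R[ `*` `]a3, (a3 + d)%R[) `*` `]a4, (a4 + d)%R[)) = (d ^+ 4)%:E)%E.
Proof.
move=> d0; pose I (a : R) : set R := `]a, a + d[%classic.
have mI a : measurable (I a) by exact: measurable_itv.
have eI a : mu (I a) = d%:E.
  by rewrite lebesgue_measure_itv /= lte_fin ltrDl d0 -EFinB addrAC subrr add0r.
have -> : (`]a1 - d, a1[ = I (a1 - d) :> set R)%classic by rewrite /I subrK.
have e1 : mu2s (I a2 `*` I a3) = (mu (I a2) * mu (I a3))%E := product_measure1E mu mu (mI _) (mI _).
have e2 : mu3s ((I a2 `*` I a3) `*` I a4) = (mu2s (I a2 `*` I a3) * mu (I a4))%E :=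
  product_measure1E mu2s mu (measurableX (mI _) (mI _)) (mI _).
have := product_measure1E mu mu3s (mI (a1 - d)) (measurableX (measurableX (mI a2) (mI a3)) (mI a4)).
move=> h; apply: (etrans h).
rewrite (_ : mu3s _ = (d * d * d)%:E); last by rewrite e2 e1 !eI -!EFinM.
apply: (etrans (congr1 (fun u => u * (d * d * d)%:E)%E (eI (a1 - d)))).
by rewrite -EFinM; congr EFin; ring.
Qed.

(** At time 2 the carried profiles are g1 and g2 themselves.  If they differ at a point, the
solutions differ on a box adjacent to it, by continuity. *)
Lemma not_same_sol g1 g2 (x0 : space3 R) : profile_ok g1 -> profile_ok g2 ->
  0 < x0.1.1 < 1 -> 0 < x0.1.2 < 1 -> 0 < x0.2 < 1 -> g1 x0 != g2 x0 ->
  ~ same_field 2 (sol g1 g1) (sol g1 g2).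
Proof.
move=> o1 o2 /andP[h1 h1'] /andP[h2 h2'] /andP[h3 h3'] g12 [N [mN N0 sub]].
pose h (z : R * space3 R) := vel true 0 g1 z.1 z.2 0 ord_max - vel true 0 g2 z.1 z.2 0 ord_max.
have ch : continuous h.
  by move=> z; apply: cvgB; [exact: (@continuous_vel_joint _ delta true 0 g1 _ o1)|exact: (@continuous_vel_joint _ delta true 0 g2 _ o2)].
have h0 : h (2, x0) != 0.
  have c2 : clock true 2 = T 0%N by rewrite /clock (T0 delta0) subrr.
  by rewrite /h /= !(vel_lo _ c2) !mxE /= subr_eq0.
have : nbhs (2 : R, x0) (h @^-1` [set r | r != 0]).
  by apply: ch; apply: open_nbhs_nbhs; split => //; exact: open_neq.
move=> /nbhs_ballP[e /= e0 he].
pose d := Num.min e (Num.min (T 1) (Num.min (1 - x0.1.1) (Num.min (1 - x0.1.2) (1 - x0.2)))).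
have T1 : 0 < T 1 by have := TS_lt delta_lt 0; rewrite T0.
have d0 : 0 < d by rewrite !lt_min e0 T1 !subr_gt0 h1' h2' h3'.
have [d1 d2 d3 d4 d5] : [/\ d <= e, d <= T 1, d <= 1 - x0.1.1, d <= 1 - x0.1.2 & d <= 1 - x0.2].
  by split; rewrite /d !ge_min lexx ?orbT.
have T2 := T_lt1 delta_gt0 1.
pose B : set (R * space3 R) := `]2 - d, 2[ `*` ((`]x0.1.1, x0.1.1 + d[ `*` `]x0.1.2, x0.1.2 + d[) `*` `]x0.2, x0.2 + d[).
have mB : measurable B by apply: measurableX => //; apply: measurableX => //; apply: measurableX.
have BN : B `<=` N.
  move=> [t [[x1 x2] x3]] [/= ht [[hx1 hx2] hx3]].
  move: ht hx1 hx2 hx3; rewrite !in_itv /= => /andP[t1 t2] /andP[a1 a2] /andP[b1 b2] /andP[c1 c2].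
  apply: sub => /= eq.
  have : spacetime 2 (t, (x1, x2, x3)).
    by split; [|split; [split|]]; rewrite /= in_itv /=; apply/andP; split; lra.
  move=> /eq.
  have p : piece true 0 t by rewrite /piece /= (T0 delta0); apply/andP; split; lra.
  rewrite (sol_piece delta_gt0 delta_lt g1 g1 p) (sol_piece delta_gt0 delta_lt g1 g2 p) => E.
  have /eqP[] : h (t, (x1, x2, x3)) != 0.
    apply: he; rewrite /ball /= /prod_ball /=; split => /=; first by rewrite /ball /= ltr_norml; apply/andP; split; lra.
    split => /=; last by rewrite /ball /= ltr_norml; apply/andP; split; lra.
    by split => /=; rewrite /ball /= ltr_norml; apply/andP; split; lra.
  by rewrite /h /= E subrr.
have : ((mu \x mu3s) B <= (mu \x mu3s) N)%E by apply: le_measure; rewrite ?inE.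
have -> : ((mu \x mu3s) B = (d ^+ 4)%:E)%E by exact: box_measure.
have -> : ((mu \x mu3s) N = 0)%E by exact: N0.
by rewrite lee_fin leNgt exprn_gt0.
Qed.

Lemma cint_beta_theta0 : cint (fun x : space3 R => beta x ^+ 2) <= cint (fun x : space3 R => theta0 x ^+ 2).
Proof.
rewrite cint_theta0_sqr (le_trans (ler_norm _)) //; apply: cint_bound.
  by apply: continuous_exprn; exact: continuous_beta.
move=> x _; rewrite normrX; apply: (@le_trans _ _ ((7 / 16) ^+ 2)); last by lra.
by rewrite lerXn2r ?nnegrE // ?beta_bound //; lra.
Qed.

End solution_weak.

(** * Hoelder norms *)

Section holder_norm.
Context {R : realType}.
Local Notation mu := (@lebesgue_measure R).
Implicit Types (f g : vfield R) (x y : space3 R) (a c L : R).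

Definition controlled c L f :=
  (forall x i, `|f x 0 i| <= c) /\ (forall i, lip12 L (fun x => f x 0 i)).

Lemma dist12_eucl x y : dist12 x y <= 2 * eucl_dist x y.
Proof.
rewrite /dist12 mulr2n mulrDl mul1r /eucl_dist.
have h1 := sqr_ge0 (x.1.1 - y.1.1); have h2 := sqr_ge0 (x.1.2 - y.1.2); have h3 := sqr_ge0 (x.2 - y.2).
by apply: lerD; rewrite -sqrtr_sqr; apply: ler_wsqrtr; lra.
Qed.

Lemma eucl_dist_gt0 x y : x != y -> 0 < eucl_dist x y.
Proof.
move=> xy; rewrite sqrtr_gt0 lt0r !addr_ge0 ?sqr_ge0 // andbT.
apply: contra_neq xy => /eqP; rewrite !paddr_eq0 ?addr_ge0 ?sqr_ge0 // !sqrf_eq0 !subr_eq0.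
by case: x y => [[x1 x2] x3] [[y1 y2] y3] /= /andP[/andP[/eqP-> /eqP->] /eqP->].
Qed.

Lemma controlled_ge0 c L f : controlled c L f -> 0 <= c.
Proof. by move=> [h _]; exact: le_trans (h 0 ord0). Qed.

Lemma controlled_sub c L c' L' f g : controlled c L f -> controlled c' L' g ->
  controlled (c + c') (L + L') (fun x => f x - g x).
Proof.
move=> [h1 h2] [k1 k2]; split => [x i|i x y]; rewrite !mxE.
  by apply: (le_trans (ler_normB _ _)); exact: lerD.
have -> : f x 0 i - g x 0 i - (f y 0 i - g y 0 i) =
  (f x 0 i - f y 0 i) - (g x 0 i - g y 0 i) by ring.
by apply: (le_trans (ler_normB _ _)); rewrite mulrDl; apply: lerD; [exact: h2|exact: k2].
Qed.

(** Interpolation between the sup norm and the Lipschitz constant; the factors 4 pass from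
components and [dist12] to the Euclidean norms. *)
Definition holder_bound a c L := 2 * c + (4 * c) `^ (1 - a) * (4 * L) `^ a.

(** For a difference D of values at distance d, D <= 4 c and D <= 4 L d, hence
D = D^(1-a) D^a <= (4 c)^(1-a) (4 L)^a d^a. *)
Lemma C_norm_le a c L f : 0 <= a < 1 -> 0 <= L -> controlled c L f ->
  (C_norm a f <= (holder_bound a c L)%:E)%E.
Proof.
move=> /andP[a0 a1] L0 ctrl; have c0 := controlled_ge0 ctrl; have [h1 h2] := ctrl.
have hs : (sup_norm f <= (2 * c)%:E)%E.
  by apply: ge_ereal_sup => _ [x _ <-]; rewrite lee_fin enorm_le.
rewrite /C_norm /holder_bound; case: eqP => [->|/eqP an0].
  by apply: (le_trans hs); rewrite lee_fin lerDl mulr_ge0 ?powR_ge0.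
have {}a0 : 0 < a by rewrite lt0r an0.
rewrite EFinD; apply: leeD => //; apply: ge_ereal_sup => _ [[x y] /= xy <-].
have d0 := eucl_dist_gt0 xy; set d := eucl_dist x y in d0 *.
rewrite lee_fin ler_pdivrMr ?powR_gt0 //.
set D := enorm _; have D0 : 0 <= D by exact: sqrtr_ge0.
have D1 : D <= 4 * c.
  rewrite (_ : 4 * c = 2 * (2 * c)); last lra.
  apply: enorm_le => [|i]; first by rewrite mulr_ge0.
  rewrite !mxE (le_trans (ler_normB _ _)) // mulr2n mulrDl mul1r.
  by apply: lerD; exact: h1.
have D2 : D <= 4 * L * d.
  have dd := dist12_eucl x y; rewrite -/d in dd.
  apply: (@le_trans _ _ (2 * (L * dist12 x y))).
    apply: enorm_le => [|i]; first by rewrite mulr_ge0 // addr_ge0.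
    by rewrite !mxE; exact: h2.
  rewrite (_ : 4 * L * d = 2 * (L * (2 * d))); last lra.
  by rewrite ler_pM2l // ler_wpM2l.
have [->|Dn0] := eqVneq D 0; first by rewrite !mulr_ge0 ?powR_ge0.
have -> : D = D `^ (1 - a) * D `^ a.
  rewrite -powRD ?subrK ?powRr1 //; by rewrite Dn0 implybT.
have d0' := ltW d0; have a0' := ltW a0; have a1' := ltW a1.
rewrite -mulrA -powRM ?mulr_ge0 //.
by apply: ler_pM; rewrite ?powR_ge0 //; apply: ge0_ler_powR; rewrite ?nnegrE ?subr_ge0 ?mulr_ge0.
Qed.

Lemma continuous_row f : (forall i, continuous (fun x => f x 0 i)) -> continuous f.
Proof.
move=> cf; pose F (i : 'I_3) x : 'rV[R]_3 := f x 0 i *: delta_mx 0 i.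
have cF i : continuous (F i) by move=> x; apply: cvgZr_tmp; exact: cf.
have -> : f = (fun x => F ord0 x + (F (lift ord0 ord0) x + F (lift ord0 (lift ord0 ord0)) x)).
  apply/funext => x; rewrite {1}[f x]row_sum_delta.
  by rewrite !big_ord_recl big_ord0 addr0.
by move=> x; apply: cvgD; [|apply: cvgD]; exact: cF.
Qed.

Lemma controlled_inC a c L f : 0 <= a < 1 -> 0 <= L -> controlled c L f -> torus_periodic f -> inC a f.
Proof.
move=> a01 L0 ctrl pf; split => //.
  by apply: continuous_row => i; apply: lip12_continuous (proj2 ctrl i).
by apply: le_lt_trans (C_norm_le a01 L0 ctrl) _; rewrite ltry.
Qed.

Lemma C_norm_ge0 a f : (0 <= C_norm a f)%E.
Proof.
have h1 : (0 <= sup_norm f)%E.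
  apply: (@le_trans _ _ (enorm (f 0))%:E); first by rewrite lee_fin sqrtr_ge0.
  by apply: ereal_sup_ubound; exists 0.
rewrite /C_norm; case: ifP => // _; apply: adde_ge0 => //.
pose e : space3 R := ((1, 0), 0).
apply: (@le_trans _ _ (enorm (f e - f 0) / eucl_dist e 0 `^ a)%:E).
  by rewrite lee_fin divr_ge0 ?powR_ge0 // sqrtr_ge0.
apply: ereal_sup_ubound; exists (e, 0) => //=.
by apply/eqP => -[] /eqP; rewrite oner_eq0.
Qed.

(** The integral of a nonnegative function, measurable or not, is a supremum over the
simple functions below it, hence monotone.  This is applied to the Hoelder norm of a
time-dependent field. *)
Lemma ge0_integral_mono (D : set R) (f g : R -> \bar R) :
  (forall t, D t -> (0 <= f t)%E) -> (forall t, D t -> (f t <= g t)%E) ->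
  (\int[mu]_(t in D) f t <= \int[mu]_(t in D) g t)%E.
Proof.
move=> f0 fg; have g0 t : D t -> (0 <= g t)%E by move=> Dt; exact: le_trans (f0 t Dt) (fg t Dt).
rewrite !ge0_integralE //; apply: ereal_sup_le => _ [h hf <-]; exists h => // t.
by apply: (le_trans (hf t)); rewrite /patch; case: ifPn => // /set_mem; exact: fg.
Qed.

Lemma holder_bound_small a L (e : R) : 0 <= a < 1 -> 0 <= L -> 0 < e ->
  exists2 d, 0 < d & forall c, 0 <= c <= d -> holder_bound a c L <= e.
Proof.
move=> /andP[a0 a1] L0 e0; pose K := (4 * L) `^ a; have K0 : 0 <= K by exact: powR_ge0.
have a1' : 0 < 1 - a by rewrite subr_gt0.
pose r := e / (2 * (K + 1)); have K1 : 0 < K + 1 by rewrite ltr_wpDl.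
have r0 : 0 < r by rewrite divr_gt0 // mulr_gt0.
pose w := r `^ (1 - a)^-1; have w0 : 0 < w by exact: powR_gt0.
exists (Num.min (e / 4) (w / 4)); first by rewrite lt_min !divr_gt0.
move=> c /andP[c0]; rewrite le_min => /andP[c1 c2]; rewrite /holder_bound -/K.
have h : (4 * c) `^ (1 - a) <= r.
  have -> : r = w `^ (1 - a) by rewrite -powRrM mulVf ?powRr1 ?ltW // gt_eqF.
  by apply: ge0_ler_powR; rewrite ?nnegrE ?mulr_ge0 ?(ltW a1') ?(ltW w0) //; lra.
have : (4 * c) `^ (1 - a) * K <= e / 2.
  apply: (@le_trans _ _ (r * (K + 1))).
    by apply: ler_pM => //; rewrite ?powR_ge0 // lerDl.
  by rewrite /r invfM mulrA -[_ * _ * _]mulrA mulVf ?mulr1 // gt_eqF.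
lra.
Qed.

(** By interpolation, uniform convergence with bounded Lipschitz constants implies
convergence in Hoelder spaces. *)
Lemma C_norm_cvg0 a L (w : R -> R) (g : R -> vfield R) (t : R) :
  0 <= a < 1 -> 0 <= L -> w s @[s --> t] --> (0 : R) ->
  (\forall s \near t, controlled (w s) L (g s)) ->
  (C_norm a (g s) @[s --> t] --> 0)%E.
Proof.
move=> a01 L0 w0 gw.
have hw : holder_bound a (w s) L @[s --> t] --> (0 : R).
  apply/cvgrPdist_le => e e0; have [d d0 hd] := holder_bound_small a01 L0 e0.
  move/cvgrPdist_le : w0 => /(_ d d0); apply: filterS2 gw => s /controlled_ge0 c0.
  rewrite !sub0r !normrN (ger0_norm c0) => wd; rewrite ger0_norm.
    by apply: hd; rewrite c0.
  by rewrite addr_ge0 ?mulr_ge0 ?powR_ge0.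
apply: (@squeeze_cvge _ _ _ _ (fun=> 0%E) _ (fun s => (holder_bound a (w s) L)%:E)).
- apply: filterS gw => s cs; rewrite C_norm_ge0 /=; exact: C_norm_le.
- exact: cvg_cst.
- by apply: cvg_EFin => //; near=> s.
Unshelve. all: by end_near. Qed.

Lemma inC0 a : 0 <= a < 1 -> inC a (fun=> 0 : 'rV[R]_3).
Proof.
move=> a01; apply: (@controlled_inC a 0 0) => //.
by split=> [x i|i x y]; rewrite !mxE ?subrr normr0 // mul0r.
Qed.

(** The simple functions take on each dyadic interval of length 2^-n the value of f at its
left end.  Time 1 is itself a dyadic number, where f may fail to be Hoelder
continuous; the value there is replaced by 0. *)
Lemma strongly_measurable_of_continuous a (f : R -> vfield R) (N : set R) : 0 <= a < 1 ->
  measurable N -> mu N = 0%E -> N 1 ->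
  (forall t : R, 0 <= t <= 2 -> t != 1 -> inC a (f t)) ->
  (forall t : R, 0 < t < 2 -> ~ N t -> C_norm a (fun x => f s x - f t x) @[s --> t] --> 0%E) ->
  strongly_measurable_in_C 2 a f.
Proof.
move=> a01 mN N0 N1 fC fcvg.
pose q (n i : nat) : R := i%:R / 2 ^+ n.
pose g n i : vfield R := if q n i == 1 then fun=> 0 else f (q n i).
have p2 n : 0 < 2 ^+ n :> R by exact: exprn_gt0.
pose h n (t : R) x : 'rV[R]_3 :=
  \sum_(i < 2 * 2 ^ n) \1_(`[q n i, q n i.+1[%classic : set R) t *: g n i x.
exists h; split.
  move=> n; exists (2 * 2 ^ n)%N, (fun i : 'I__ => `[q n i, q n i.+1[%classic : set R), (fun i : 'I__ => g n i).
  split => // i; rewrite /g; case: eqP => [_|/eqP i1]; first exact: inC0.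
  apply: fC => //; rewrite divr_ge0 ?exprn_ge0 //= ler_pdivrMr //.
  by rewrite -natrX -natrM ler_nat ltnW.
exists N; split=> // t /= nt; apply: contrapT => Nt; apply: nt.
rewrite in_itv /= => t02; have [t0 t2] := andP t02.
have t1 : t != 1 by apply: contra_notN Nt => /eqP ->.
pose k n := Num.truncn (t * 2 ^+ n).
have kP n : q n (k n) <= t < q n (k n).+1.
  have tp : 0 <= t * 2 ^+ n by rewrite mulr_ge0 ?exprn_ge0 ?(ltW t0).
  have := truncn_itv tp; rewrite -/(k n).
  by rewrite ler_pdivrMr // ltr_pdivlMr.
have hE n : h n t = g n (k n).
  have [k1 k2] := andP (kP n).
  have kn : (k n < 2 * 2 ^ n)%N.
    rewrite -(ltr_nat R) natrM natrX -ltr_pdivrMr //.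
    exact: le_lt_trans k1 t2.
  apply/funext => x; rewrite /h (bigD1 (Ordinal kn)) //= indicE mem_set /=; last by rewrite in_itv /= k1.
  rewrite scale1r big1 ?addr0 // => i ik.
  rewrite indicE memNset ?scale0r //= in_itv /= => /andP[i1 i2].
  move/eqP: ik; apply; apply/val_inj => /=; apply/eqP.
  rewrite eqn_leq -ltnS -[X in _ && X]ltnS -!(ltr_nat R).
  have c := p2 n; move: k1 k2 i1 i2; rewrite /q !ler_pdivrMr // !ltr_pdivlMr // => k1 k2 i1 i2.
  by rewrite (le_lt_trans i1 k2) (le_lt_trans k1 i2).
have qt : q n (k n) @[n --> \oo] --> t.
  apply: (@squeeze_cvgr _ _ _ _ (fun n => t - 2^-1 ^+ n) (fun=> t)).
  - near=> n; have [k1 k2] := andP (kP n); rewrite k1 andbT.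
    rewrite lerBlDr (le_trans (ltW k2)) // /q -natr1 mulrDl mul1r exprVn; exact: lexx.
  - rewrite -[X in _ --> X]subr0; apply: cvgB; first exact: cvg_cst.
    by have := @cvg_half R 1; under eq_fun do rewrite mul1r.
  - exact: cvg_cst.
have H := @cvg_comp _ _ _ (fun n => q n (k n)) (fun s => C_norm a (fun x => f s x - f t x)) _ _ _ qt (fcvg t t02 Nt).
apply: cvg_trans H; apply: near_eq_cvg.
have : \forall n \near \oo, q n (k n) != 1.
  by apply: (qt [set s | s != 1]); apply: open_nbhs_nbhs; split => //; exact: open_neq.
by apply: filterS => n qn; rewrite hE /g (negbTE qn).
Unshelve. all: by end_near. Qed.

End holder_norm.

(** * Hoelder regularity of stagewise fields *)

Section stagewise_fields.
Context {R : realType}.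
Local Notation mu := (@lebesgue_measure R).
Variable delta : nat -> R.
Hypotheses (delta0 : delta 0%N = 1) (delta_gt0 : forall n, 0 < delta n).
Hypothesis (delta_lt : forall n, delta n.+1 < delta n).
Hypothesis (delta_cvg : delta n @[n --> \oo] --> (0 : R)).
Local Notation T := (T delta).
Local Notation tau := (tau delta).
Local Notation stage := (stage delta).
Local Notation piece := (piece delta).
Implicit Types (b : bool) (n : nat) (a p : R).

Definition moduli (F : R -> vfield R) := forall t : R, exists w : R -> R,
  w s @[s --> t] --> (0 : R) /\ forall s x i, `|F s x 0 i - F t x 0 i| <= w s.

Lemma open_clock b (a c : R) : open [set s | a < clock b s < c].
Proof.
have cc : continuous (fun s : R => clock b s) by case: b; rewrite /clock; cont.
rewrite (_ : [set s | _] = clock b @^-1` `]a, c[%classic).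
  by apply: open_comp => [s _|]; [exact: cc|exact: interval_open].
by apply/seteqP; split => s /=; rewrite in_itv.
Qed.

(* the ends of the stages, where continuity in time is not claimed *)
Let ends : set R := \bigcup_n [set 1; T n; 2 - T n].

Let ends_null : mu ends = 0%E.
Proof.
apply: countable_lebesgue_measure0; apply: bigcup_countable => // n _.
by apply: finite_set_countable; rewrite !finite_setU; do ?split; exact: finite_set1.
Qed.

Let measurable_ends : measurable ends.
Proof. by apply: bigcup_measurable => n _; do ?apply: measurableU; exact: measurable_set1. Qed.

Let ends1 : ends 1. Proof. by exists 0%N => //; left; left. Qed.

Let inside (t : R) : 0 < t < 2 -> ~ ends t -> exists b n, T n < clock b t < T n.+1.
Proof.
move=> /andP[t0 t2] nt; have t1 : t != 1 by apply/eqP => t1; apply: nt; rewrite t1.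
have t02 : 0 <= t <= 2 by rewrite !ltW.
have [b [n /andP[p1 p2]]] := piece_cover delta0 delta_cvg t02 t1.
exists b, n; rewrite p2 andbT lt_neqAle p1 andbT; apply/eqP => E; apply: nt.
by exists n => //; case: b E {p1 p2} => /= E; [right; lra|left; right; lra].
Qed.

(** Strong measurability follows from continuity in time inside the stages, and
integrability from the bounds [holder_bound] of the Hoelder norms, a step
function of time. *)
Lemma LpC_stagewise (f : R -> vfield R) (F : bool -> nat -> R -> vfield R)
    (c L : nat -> R) a p (C : R) : 0 <= a < 1 -> 0 <= p ->
  (forall b n t, piece b n t -> f t = F b n t) ->
  (forall b n t, piece b n t -> controlled (c n) (L n) (F b n t)) ->
  (forall n, 0 <= L n) -> (forall b n t, torus_periodic (F b n t)) ->
  (forall b n, moduli (F b n)) ->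
  (forall n, holder_bound a (c n) (L n) `^ p * tau n <= C * 2^-1 ^+ n) ->
  LpC p 2 a f.
Proof.
move=> a01 p0 fF ctrl L0 pF mF sumC.
have fC (t : R) : 0 <= t <= 2 -> t != 1 -> inC a (f t).
  move=> t02 t1; have [b [n pt]] := piece_cover delta0 delta_cvg t02 t1.
  by rewrite (fF _ _ _ pt); exact: controlled_inC (ctrl _ _ _ pt) _.
split.
- apply: (@strongly_measurable_of_continuous _ a f ends) => //.
  move=> t t02 /(inside t02)[b [n tn]].
  have inp s : T n < clock b s < T n.+1 -> piece b n s.
    by move=> /andP[/ltW h1 h2]; rewrite /piece /= h1 h2.
  have [w [w0 hw]] := mF b n t.
  apply: (@C_norm_cvg0 _ a (L n + L n) w) => //; first by rewrite addr_ge0.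
  have : \forall s \near t, T n < clock b s < T n.+1.
    by apply: open_nbhs_nbhs; split => //; exact: open_clock.
  apply: filterS => s sn; rewrite (fF _ _ _ (inp _ sn)) (fF _ _ _ (inp _ tn)).
  have [_ h] := controlled_sub (ctrl _ _ _ (inp _ sn)) (ctrl _ _ _ (inp _ tn)).
  by split=> // x i; rewrite !mxE.
- exists [set 1]; split; [exact: measurable_set1|exact: lebesgue_measure_set1|].
  move=> t /= nP; apply/eqP; apply: contra_notT nP => t1.
  by rewrite in_itv /= => /andP[t0 t2]; apply: fC => //; rewrite !ltW.
pose M n := holder_bound a (c n) (L n) `^ p.
have M0 n : 0 <= M n by exact: powR_ge0.
have lty := step_integral_lty delta0 delta_gt0 delta_lt delta_cvg M0 sumC.
(* infinite at time 1, where nothing is known of f *)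
pose G (t : R) : \bar R := if t == 1 then +oo%E else (M (stage t))%:E.
have G0 t : (0 <= G t)%E by rewrite /G; case: ifP => // _; rewrite lee_fin.
apply: (@le_lt_trans _ _ (\int[mu]_(t in `]0%R, 2%R[) G t)%E).
  apply: ge0_integral_mono => t /=; rewrite in_itv /=; first by move=> _; exact: poweR_ge0.
  move=> /andP[t0 t2]; rewrite /G; case: eqP => [_|/eqP t1]; first by rewrite leey.
  have t02 : 0 <= t <= 2 by rewrite !ltW.
  have [b [n pt]] := piece_cover delta0 delta_cvg t02 t1.
  rewrite (fF _ _ _ pt) (piece_stage delta_gt0 delta_lt pt) /M -poweR_EFin.
  have h := C_norm_le a01 (L0 n) (ctrl _ _ _ pt).
  have cn := controlled_ge0 (ctrl _ _ _ pt).
  apply: gt0_ler_poweR => //; rewrite in_itv /= leey andbT; first exact: C_norm_ge0.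
  by rewrite lee_fin addr_ge0 ?mulr_ge0 ?powR_ge0.
have mG : measurable_fun (`[0, 2]%classic : set R) G.
  apply: (measurable_fun_stage delta0 delta_gt0 delta_lt delta_cvg) => b n.
  apply: (@eq_measurable_fun _ _ _ _ _ (fun=> (M n)%:E)); last exact: measurable_cst.
  move=> t /set_mem pt; rewrite /G (negbTE (piece_neq1 delta_gt0 pt)).
  by rewrite (piece_stage delta_gt0 delta_lt pt).
have mS := measurable_step delta0 delta_gt0 delta_lt delta_cvg M.
apply: le_lt_trans lty.
apply: (@le_trans _ _ (\int[mu]_(t in `[0%R, 2%R]) G t)%E).
  by apply: ge0_subset_integral => //; apply: subset_itv; rewrite bnd_simp.
have h1 : mu [set (1 : R)] = 0%E by exact: lebesgue_measure_set1.
have -> : (\int[mu]_(t in `[0%R, 2%R]) G t = \int[mu]_(t in `[0%R, 2%R] `\` [set 1%R]) G t)%E.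
  by apply: ge0_negligible_integral.
have -> : (\int[mu]_(t in `[0%R, 2%R]) (M (stage t))%:E =
    \int[mu]_(t in `[0%R, 2%R] `\` [set 1%R]) (M (stage t))%:E)%E.
  by apply: ge0_negligible_integral => // t _; rewrite lee_fin.
apply: ge0_integral_mono => // t [_ /eqP t1].
by rewrite /G (negbTE t1).
Qed.

End stagewise_fields.

Section stage_regularity.
Context {R : realType}.
Variable delta : nat -> R.
Hypothesis (delta_lt : forall n, delta n.+1 < delta n).
Local Notation T := (T delta).
Local Notation tau := (tau delta).
Local Notation prof := (prof delta).
Local Notation prof1 := (prof1 delta).
Local Notation prof2 := (prof2 delta).
Local Notation vel := (vel delta).
Local Notation frc := (frc delta).
Variable C0 : R.
Hypotheses (C0_ge0 : 0 <= C0) (tau_scale : forall n, scale n <= C0 * tau n).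
Implicit Types (b : bool) (n : nat).

Let tau_pos n : 0 < tau n. Proof. exact: tau_gt0. Qed.

Lemma shear_lip12 n : lip12 (2 * 256 ^+ n.+1) (@shear R n).
Proof.
move=> x y; apply: (le_trans (shear_lip n x y)); rewrite ler_wpM2l ?mulr_ge0 ?exprn_ge0 //.
by rewrite /across /dist12; case: odd; rewrite ?lerDl ?lerDr.
Qed.

Definition vel_lip n : R :=
  (4 * (C0 * 256) + (8 + 16 * 256)) * (3 * 256) ^+ n / scale n.

(** The gradient of the shear is at most 4 * 256 ^ n.+1 / tau n, where 1 / tau n is at most
C0 / scale n; that of the carried profile is the constant of theta n times the
gradient of the shear of stage n. *)
Lemma vel_controlled b n t : T n <= clock b t <= T n.+1 ->
  controlled (2 * C0 + 1) (vel_lip n) (vel b n theta0 t).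
Proof.
move=> ht; have s0 := scale_gt0 n : 0 < scale n :> R.
have l1 := fun x y => shear_lip12 n x y.
have p01 : `|- prof b n t| <= 1.
  by have /andP[h1 h2] := prof_itv delta_lt ht; rewrite normrN ger0_norm.
have := lip12_Phi n (lipconst_ge0 n) p01 (@theta_lip R n).
rewrite /vel_lip /lipconst (_ : (freq n)%:R = (scale n)^-1 :> R); last by rewrite /scale invrK.
have q1 : 1 <= 256 :> R by rewrite ler1n.
rewrite exprS in l1; rewrite exprS exprMn.
move: (256 : R) q1 l1 => q q1 l1 l2.
have q0 : 0 <= q by exact: le_trans q1.
have e1 : 1 <= q ^+ n by rewrite exprn_ege1.
have e2 : 1 <= 3 ^+ n :> R by rewrite exprn_ege1 //; lra.
have e3 : q ^+ n <= 3 ^+ n * q ^+ n by rewrite ler_peMl // (le_trans ler01).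
have e4 : 3 ^+ n <= 3 ^+ n * q ^+ n by rewrite ler_peMr // (le_trans ler01).
move: (q ^+ n) (3 ^+ n) e1 e2 e3 e4 l1 l2 => Q P e1 e2 e3 e4 l1 l2.
have Q0 := le_trans ler01 e1; have P0 := le_trans ler01 e2.
have PQ0 := mulr_ge0 P0 Q0.
split=> [x i|i].
  by apply: vel_bound => // y; exact: theta0_bound.
move=> x y; rewrite !mxE.
have D0 : 0 <= dist12 x y by rewrite addr_ge0.
case: ifP => _.
  rewrite -mulrBr normrM; apply: (@le_trans _ _ (2 / tau n * (2 * (q * Q) * dist12 x y))).
    by apply: ler_pM => //; exact: prof1_bound.
  rewrite [X in X <= _]mulrA ler_wpM2r //.
  apply: (@le_trans _ _ (C0 / scale n * (4 * (q * Q)))).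
    rewrite [X in X <= _](_ : _ = (tau n)^-1 * (4 * (q * Q))); last by ring.
    rewrite ler_wpM2r ?mulr_ge0 //.
    by rewrite ler_pdivlMr // mulrC ler_pdivrMr.
  rewrite [X in X <= _](_ : _ = 4 * (C0 * q) * Q / scale n); last by ring.
  rewrite ler_wpM2r ?invr_ge0 ?(ltW s0) //; apply: ler_pM => //; rewrite ?mulr_ge0 //.
  by rewrite lerDl addr_ge0 // mulr_ge0.
case: ifP => _; last first.
  rewrite subrr normr0 mulr_ge0 // divr_ge0 ?(ltW s0) // mulr_ge0 //.
  by rewrite !addr_ge0 ?mulr_ge0.
apply: (le_trans (l2 x y)); rewrite ler_wpM2r // mulrAC ler_wpM2r ?invr_ge0 ?(ltW s0) //.
have := mulr_ge0 (mulr_ge0 C0_ge0 q0) PQ0.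
have -> : 8 * P * (1 + 2 * (q * Q)) = 8 * P + 16 * q * (P * Q) by ring.
have -> : (4 * (C0 * q) + (8 + 16 * q)) * (P * Q) =
    4 * (C0 * q * (P * Q)) + (8 * (P * Q) + 16 * q * (P * Q)) by ring.
by move: (C0 * q * (P * Q)) (16 * q * (P * Q)) => k l k0; lra.
Qed.

(** Moving time from s to t shears the carried profile by at most
|prof s - prof t| scale n. *)
Lemma vel_moduli b n : moduli (vel b n theta0).
Proof.
move=> t; have cp := @continuous_prof _ delta b n; have cp1 := @continuous_prof1 _ delta b n.
exists (fun s => `|prof1 b n s - prof1 b n t| * scale n + lipconst n * (`|prof b n s - prof b n t| * scale n)).
have s0 := ltW (scale_gt0 n) : 0 <= scale n :> R; have l0 := lipconst_ge0 n : 0 <= lipconst n :> R.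
split.
  have c1 : `|prof1 b n s - prof1 b n t| @[s --> t] --> (0 : R).
    rewrite -[X in _ --> X](normr0 R) -(subrr (prof1 b n t)); apply: cvg_norm.
    by apply: cvgB; [exact: cp1|exact: cvg_cst].
  have c2 : `|prof b n s - prof b n t| @[s --> t] --> (0 : R).
    rewrite -[X in _ --> X](normr0 R) -(subrr (prof b n t)); apply: cvg_norm.
    by apply: cvgB; [exact: cp|exact: cvg_cst].
  rewrite (_ : (0 : R) = 0 * scale n + lipconst n * (0 * scale n)); last by rewrite !mul0r mulr0 addr0.
  apply: cvgD; first by apply: cvgM => //; exact: cvg_cst.
  by apply: cvgM; [exact: cvg_cst|apply: cvgM => //; exact: cvg_cst].
move=> s x i; rewrite !mxE; case: ifP => _.
  rewrite -mulrBl normrM -[X in X <= _]addr0; apply: lerD; last by rewrite !mulr_ge0.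
  by apply: ler_wpM2l => //; rewrite ger0_norm ?shear_ge0 // shear_le.
case: ifP => _; last by rewrite subrr normr0 addr_ge0 // !mulr_ge0.
rewrite -[X in X <= _]add0r; apply: lerD; first by rewrite mulr_ge0.
apply: (le_trans (theta_lip n _ _)); rewrite ler_wpM2l //.
have -> : dist12 (Phi n (- prof b n s) x) (Phi n (- prof b n t) x) =
    `|(prof b n s - prof b n t) * shear n x|.
  rewrite /dist12 /Phi /moved /= /dir; case: odd => /=; rewrite ?mulr1 ?mulr0 ?addr0 subrr normr0 ?addr0 ?add0r.
  - by rewrite -normrN; congr `|_|; ring.
  - by rewrite -normrN; congr `|_|; ring.
by rewrite normrM ler_wpM2l // ger0_norm ?shear_ge0 // shear_le.
Qed.

Definition frc_lip n : R :=
  6 * (scale n / tau n ^+ 2) * (2 * 256 * 256 ^+ n / scale n).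

Lemma frc_controlled b n t : T n <= clock b t <= T n.+1 ->
  controlled (6 * (scale n / tau n ^+ 2)) (frc_lip n) (frc b n t).
Proof.
move=> ht; have s0 := scale_gt0 n : 0 < scale n :> R.
have t0 : 0 <= (tau n ^+ 2)^-1 by rewrite invr_ge0 exprn_ge0 // ltW.
have E : frc_lip n = 6 / tau n ^+ 2 * (2 * 256 ^+ n.+1).
  rewrite /frc_lip; move: (256 : R) (tau n ^+ 2)^-1 => q B; rewrite exprS; move: (q ^+ n) => A.
  by field; rewrite gt_eqF.
split=> [x i|i x y]; first exact: frc_bound.
have D0 : 0 <= dist12 x y by rewrite addr_ge0.
rewrite !mxE; case: ifP => _; last first.
  by rewrite subrr normr0 E; do ![apply: mulr_ge0 => //]; exact: exprn_ge0.
rewrite -mulrBr normrM E -[X in _ <= X]mulrA; apply: ler_pM; [by []|by []|exact: prof2_bound|].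
exact: shear_lip12.
Qed.

Lemma frc_moduli b n : moduli (frc b n).
Proof.
move=> t; have cp := @continuous_prof2 _ delta b n.
exists (fun s => `|prof2 b n s - prof2 b n t| * scale n).
have s0 := ltW (scale_gt0 n) : 0 <= scale n :> R.
split.
  rewrite (_ : (0 : R) = `|prof2 b n t - prof2 b n t| * scale n); last by rewrite subrr normr0 mul0r.
  apply: cvgM; last exact: cvg_cst.
  by apply: cvg_norm; apply: cvgB; [exact: cp|exact: cvg_cst].
move=> s x i; rewrite !mxE; case: ifP => _; last by rewrite subrr normr0 mulr_ge0.
by rewrite -mulrBl normrM ler_wpM2l // ger0_norm ?shear_ge0 // shear_le.
Qed.

Lemma frc_lip_ge0 n : 0 <= frc_lip n.
Proof.
have s0 := ltW (scale_gt0 n) : 0 <= scale n :> R; have t0 := ltW (tau_pos n).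
have q0 : 0 <= 256 :> R by rewrite ler0n.
by rewrite /frc_lip; move: (256 : R) q0 => q q0; rewrite !mulr_ge0 ?divr_ge0 ?invr_ge0 ?exprn_ge0.
Qed.

Lemma vel_lip_ge0 n : 0 <= vel_lip n.
Proof.
have s0 := ltW (scale_gt0 n) : 0 <= scale n :> R.
have q0 : 0 <= 256 :> R by rewrite ler0n.
rewrite /vel_lip; move: (256 : R) q0 => q q0.
by rewrite divr_ge0 // mulr_ge0 ?exprn_ge0 ?mulr_ge0 // !addr_ge0 ?mulr_ge0.
Qed.

End stage_regularity.

(** * Choice of the parameters *)

Section parameters.
Context {R : realType}.
Local Notation scale := (@scale R).
Implicit Types (n : nat) (a r : R).

Let scale_pos n : 0 < scale n. Proof. exact: scale_gt0. Qed.

Let scale01 n : 0 < scale n <= 1. Proof. by rewrite scale_gt0 scale_le1. Qed.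

Lemma scale_powRN_ge1 n a : 0 <= a -> 1 <= scale n `^ (- a).
Proof.
move=> a0; rewrite -[X in X <= _](powRr0 (scale n)).
by apply: ger_powR => //; rewrite oppr_le0.
Qed.

Lemma scale_powRD n a r : scale n `^ a * scale n `^ r = scale n `^ (a + r).
Proof. by rewrite powRD //; apply/implyP => _; rewrite gt_eqF. Qed.

Lemma invr_powR n a : (scale n)^-1 `^ a = scale n `^ (- a).
Proof. by rewrite -(powR_inv1 (ltW (scale_pos n))) -powRrM mulN1r. Qed.

(** The ratio of consecutive terms of scale n `^ a (2 D) ^ n is 2 D / q ^ n.+1 with
q = 256 `^ a > 1, hence at most 1 from some rank on, and the sequence is
bounded. *)
Lemma scale_decay a (D : R) : 0 < a -> 1 <= D ->
  exists C : R, forall n, scale n `^ a * D ^+ n <= C * 2^-1 ^+ n.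
Proof.
move=> a0 D1; pose u n := scale n `^ a * (2 * D) ^+ n.
have D0 : 0 <= D by exact: le_trans ler01 D1.
have D2 : 0 < 2 * D by rewrite mulr_gt0 // (lt_le_trans ltr01).
have u0 n : 0 <= u n by rewrite mulr_ge0 ?powR_ge0 // exprn_ge0 // ltW.
suff [C uC] : exists C, forall n, u n <= C.
  exists C => n; have := uC n; rewrite /u exprMn mulrCA => h.
  by rewrite exprVn ler_pdivlMr ?exprn_gt0 // mulrC.
pose q : R := 256 `^ a.
have q1 : 1 < q.
  have e1 : 1 `^ a = 1 :> R by rewrite powR1.
  by rewrite -e1; apply: gt0_ltr_powR; rewrite ?nnegrE ?ler0n ?ltr1n.
have q0 : 0 < q by rewrite (lt_trans ltr01).
have uS n : u n.+1 = u n * ((q ^+ n.+1)^-1 * (2 * D)).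
  rewrite /u [scale n]scaleS powRM ?exprn_ge0 ?ler0n ?(ltW (scale_pos _)) //.
  have -> : (256 ^+ n.+1) `^ a = q ^+ n.+1.
    by rewrite -powR_mulrn ?ler0n // powRAC powR_mulrn // powR_ge0.
  have : q ^+ n.+1 != 0 by rewrite expf_neq0 // gt_eqF.
  rewrite [(2 * D) ^+ n.+1]exprSr; move: (q ^+ n.+1) (_ `^ a) ((2 * D) ^+ n) (2 * D) => w x y z w0.
  by field.
have [N hN] : exists N, forall n, (N <= n)%N -> (q ^+ n.+1)^-1 * (2 * D) <= 1.
  have := @cvg_geometric R (2 * D) q^-1; rewrite /geometric => H.
  have : (2 * D * q^-1 ^+ n) @[n --> \oo] --> (0 : R).
    by apply: H; rewrite gtr0_norm ?invr_gt0 // invf_lt1.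
  move=> /cvgrPdist_le /(_ 1 ltr01)[N _ hN]; exists N => n Nn.
  have := hN n.+1 (leqW Nn); rewrite sub0r normrN ger0_norm ?mulr_ge0 ?exprn_ge0 ?invr_ge0 ?(ltW q0) ?(ltW D2) //.
  by rewrite exprVn mulrC.
exists (\sum_(i < N.+1) u i) => n.
have base m : (m <= N)%N -> u m <= \sum_(i < N.+1) u i.
  move=> mN; have mN' : (m < N.+1)%N by [].
  by rewrite (bigD1 (Ordinal mN')) //= lerDl sumr_ge0.
elim: n => [|n IH]; first exact: base.
have [nN|Nn] := ltnP n N; first exact: base.
by rewrite uS; apply: le_trans IH; rewrite ler_piMr ?u0 ?hN.
Qed.

Variable alpha : R.
Hypothesis alpha01 : 0 <= alpha < 1.
(** Stage n has to be long compared with scale n, for the velocity to be bounded and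
for the force to be integrable, which requires gamma < 1, but short compared with
scale n `^ alpha, which requires alpha < gamma. *)
Definition gamma := (1 + alpha) / 2.
Definition sigma := (1 - gamma) / 4.
Definition widths n := scale n `^ gamma.
Local Notation tau := (tau widths).

Let gamma_itv : 2^-1 <= gamma < 1.
Proof. by have /andP[h1 h2] := alpha01; rewrite /gamma; apply/andP; split; lra. Qed.

Lemma sigma_itv : 0 < sigma < 1.
Proof. by have /andP[h1 h2] := gamma_itv; rewrite /sigma; apply/andP; split; lra. Qed.

Lemma widths0 : widths 0 = 1.
Proof. by rewrite /widths /scale /= invr1 powR1. Qed.

Lemma widths_gt0 n : 0 < widths n.
Proof. exact: powR_gt0. Qed.

Lemma widthsS n : widths n.+1 <= widths n / 2.
Proof.
have h : scale n.+1 <= scale n * 4^-1.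
  rewrite ler_pdivlMr // [leRHS]scaleS ler_wpM2l ?(ltW (scale_pos _)) //.
  rewrite exprS; apply: (@le_trans _ _ (256 * 1)); first by rewrite mulr1 ler_nat.
  by rewrite ler_wpM2l ?ler0n // exprn_ege1 // ler1n.
have g0 : 0 <= gamma by have /andP[h1 h2] := gamma_itv; lra.
apply: (@le_trans _ _ ((scale n * 4^-1) `^ gamma)).
  have s0 := ltW (scale_pos n); have s1 := ltW (scale_pos n.+1).
  by apply: ge0_ler_powR => //; rewrite nnegrE ?mulr_ge0 ?invr_ge0 ?ler0n.
rewrite powRM ?(ltW (scale_pos _)) // ler_wpM2l ?powR_ge0 //.
apply: (@le_trans _ _ (4^-1 `^ 2^-1)).
  by apply: ger_powR; [lra|have /andP[] := gamma_itv].
rewrite powR12_sqrt // (_ : 4^-1 = 2^-1 ^+ 2) ?sqrtr_sqr ?ger0_norm //.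
by rewrite expr2; lra.
Qed.

Lemma widths_lt n : widths n.+1 < widths n.
Proof. by have := widthsS n; have := widths_gt0 n; lra. Qed.

Lemma widths_half n : widths n <= 2^-1 ^+ n.
Proof.
elim: n => [|n IH]; first by rewrite widths0 expr0.
by apply: (le_trans (widthsS n)); rewrite exprSr; lra.
Qed.

Lemma widths_cvg : widths n @[n --> \oo] --> (0 : R).
Proof.
apply: (@squeeze_cvgr _ _ _ _ (fun=> 0) (fun n => 2^-1 ^+ n)).
- by near=> n; rewrite ltW ?widths_gt0 //= widths_half.
- exact: cvg_cst.
- by have := @cvg_half R 1; under eq_fun do rewrite mul1r.
Unshelve. all: by end_near. Qed.

Lemma tau_le n : tau n <= widths n.
Proof. by have := widths_gt0 n.+1; rewrite /tau; lra. Qed.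

Lemma tau_ge n : widths n / 2 <= tau n.
Proof. by have := widthsS n; rewrite /tau; lra. Qed.

Let tau_pos n : 0 < tau n.
Proof. by have := tau_ge n; have := widths_gt0 n; lra. Qed.

Lemma widths_scale n : scale n <= 2 * tau n.
Proof.
have : scale n <= widths n by apply: ger1_powR => //; have /andP[h1 h2] := gamma_itv; lra.
by have := tau_ge n; lra.
Qed.

Lemma widths_sum n : tau n <= 1 * 2^-1 ^+ n.
Proof. by rewrite mul1r (le_trans (tau_le n)) // widths_half. Qed.

Lemma force_sum : exists CF, forall n, scale n / tau n ^+ 2 * tau n <= CF * 2^-1 ^+ n.
Proof.
have g1 : 0 < 1 - gamma by have /andP[h1 h2] := gamma_itv; lra.
have [C hC] := scale_decay g1 (lexx 1); exists (2 * C) => n.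
have -> : scale n / tau n ^+ 2 * tau n = scale n / tau n.
  by rewrite expr2 invfM mulrA mulfVK // gt_eqF.
have := hC n; rewrite expr1n mulr1 => h.
apply: (@le_trans _ _ (2 * scale n `^ (1 - gamma))); last by rewrite -mulrA ler_pM2l.
rewrite ler_pdivrMr // -scale_powRD powRr1 ?(ltW (scale_pos _)) // powRN -/(widths n).
rewrite -[X in X <= _]mulr1 -!mulrA [2 * _]mulrCA ler_pM2l //.
rewrite mulrCA mulrC -ler_pdivrMr; last by rewrite invr_gt0 widths_gt0.
by rewrite invrK mul1r; have := tau_ge n; lra.
Qed.

Lemma divr_scale_powR (W a : R) n : 1 <= W -> a <= 1 ->
  (W / scale n) `^ a <= W * scale n `^ (- a).
Proof.
move=> W1 a1; have W0 := le_trans ler01 W1; have s0 := ltW (scale_pos n).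
by rewrite powRM ?invr_ge0 // invr_powR ler_wpM2r ?powR_ge0 // ler1_powR.
Qed.

(** The product is at most a geometric factor times
scale n `^ (- alpha) scale n `^ gamma, with alpha < gamma. *)
Lemma vel_sum (C0 : R) : 0 <= C0 -> exists C, forall n,
  holder_bound alpha (2 * C0 + 1) (vel_lip C0 n) `^ 1 * tau n <= C * 2^-1 ^+ n.
Proof.
move=> C00; have /andP[a0 a1] := alpha01.
pose V := 4 * (4 * (C0 * 256) + (8 + 16 * 256)); pose q : R := 3 * 256; pose c := 2 * C0 + 1.
have c1 : 1 <= c by rewrite lerDr mulr_ge0.
have V1 : 1 <= V.
  have p1 : 0 <= 256 :> R by rewrite ler0n.
  have := mulr_ge0 C00 p1; rewrite /V; move: (C0 * 256) => k k0.
  have : 0 <= 16 * 256 :> R by rewrite mulr_ge0 ?ler0n.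
  by move: (16 * 256) => l l0; lra.
have q1 : 1 <= q.
  have p1 : 1 <= 256 :> R by rewrite ler1n.
  by rewrite /q; move: (256 : R) p1 => r r1; lra.
have ga : 0 < gamma - alpha by rewrite /gamma; lra.
have [C hC] := scale_decay ga q1.
exists ((2 * c + 4 * c * V) * C) => n; have s0 := scale_pos n.
have qn : 1 <= q ^+ n by rewrite exprn_ege1.
have sn := scale_powRN_ge1 n a0.
have c0 : 0 <= c by exact: le_trans c1.
have V0 : 0 <= V by exact: le_trans V1.
pose G := q ^+ n * scale n `^ (- alpha).
have G1 : 1 <= G by rewrite /G mulr_ege1.
have HB : holder_bound alpha c (vel_lip C0 n) <= (2 * c + 4 * c * V) * G.
  rewrite /holder_bound [leRHS]mulrDl; apply: lerD.
    by rewrite ler_peMr // mulr_ge0.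
  rewrite -mulrA; apply: ler_pM; rewrite ?powR_ge0 //.
    by apply: ler1_powR; lra.
  have -> : 4 * vel_lip C0 n = V * q ^+ n / scale n by rewrite /vel_lip /V /q; ring.
  have W1 : 1 <= V * q ^+ n by rewrite mulr_ege1.
  by apply: (le_trans (divr_scale_powR _ W1 (ltW a1))); rewrite /G mulrA.
have HB0 : 0 <= holder_bound alpha c (vel_lip C0 n).
  by rewrite /holder_bound addr_ge0 ?mulr_ge0 ?powR_ge0.
rewrite powRr1 //; apply: (@le_trans _ _ ((2 * c + 4 * c * V) * G * widths n)).
  by apply: ler_pM; rewrite ?(ltW (tau_pos n)) ?tau_le.
have P0 : 0 <= 2 * c + 4 * c * V.
  exact: addr_ge0 (mulr_ge0 (ler0n _ 2) c0) (mulr_ge0 (mulr_ge0 (ler0n _ 4) c0) V0).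
rewrite -[leLHS]mulrA -[leRHS]mulrA ler_wpM2l //.
apply: le_trans (hC n); rewrite /G /widths.
by rewrite -mulrA scale_powRD mulrC [- _ + _]addrC.
Qed.

(** The force is at most c = 24 scale n `^ (1 - 2 gamma), and its Hoelder norm at most c
scale n `^ (- sigma) up to a geometric factor.  With gamma = 1 - 4 sigma, the exponent
(1 - 2 gamma - sigma) (1 + sigma) + gamma of scale n is 2 sigma + 7 sigma^2. *)
Lemma frc_sum : exists C, forall n,
  holder_bound sigma (6 * (scale n / tau n ^+ 2)) (frc_lip widths n) `^ (1 + sigma) * tau n
    <= C * 2^-1 ^+ n.
Proof.
have /andP[g0 g1] := gamma_itv; have /andP[s0 s1] := sigma_itv.
have s4 : gamma = 1 - 4 * sigma by rewrite /sigma; lra.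
pose E := (1 - 2 * gamma - sigma) * (1 + sigma) + gamma.
have E0 : 0 < E.
  rewrite /E s4 (_ : _ + _ = 2 * sigma + 7 * (sigma * sigma)); last by ring.
  by have := mulr_gt0 s0 s0; lra.
have q1 : 1 <= 256 :> R by rewrite ler1n.
pose q : R := 256; have {}q1 : 1 <= q by [].
have qq1 : 1 <= q * q by rewrite mulr_ege1.
have [C hC] := scale_decay E0 qq1.
pose K := 24 * (2 + 8 * q).
have K1 : 1 <= K.
  have h (r : R) : 1 <= r -> 1 <= 24 * (2 + 8 * r) by move=> *; lra.
  exact: h.
exists (K * K * C) => n; have sn := scale_pos n; have tn := tau_pos n.
have qn : 1 <= q ^+ n by rewrite exprn_ege1.
have ssn := scale_powRN_ge1 n (ltW s0).
pose c := 6 * (scale n / tau n ^+ 2).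
have c0 : 0 < c by rewrite /c mulr_gt0 // divr_gt0 // exprn_gt0.
pose G := q ^+ n * scale n `^ (- sigma).
have G1 : 1 <= G by rewrite /G mulr_ege1.
have HB1 : holder_bound sigma c (frc_lip widths n) <= c * ((2 + 8 * q) * G).
  rewrite /holder_bound.
  have -> : 4 * frc_lip widths n = 4 * c * (2 * q * q ^+ n / scale n).
    by rewrite /frc_lip -/c -/q mulrA.
  have W1 : 1 <= 2 * q * q ^+ n.
    by rewrite mulr_ege1 // mulr_ege1 //; lra.
  have W0 := le_trans ler01 W1.
  have c40 : 0 < 4 * c by rewrite mulr_gt0.
  rewrite [(4 * c * _) `^ _]powRM; [|exact: ltW|by rewrite divr_ge0 // ltW].
  rewrite [_ `^ _ * (_ * _)]mulrA -powRD; last by apply/implyP => _; rewrite gt_eqF.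
  rewrite subrK powRr1 ?(ltW c40) //.
  apply: (@le_trans _ _ (2 * c * G + 4 * c * (2 * q * G))).
    apply: lerD; first by rewrite ler_peMr // mulr_ge0 // ltW.
    rewrite ler_pM2l //; apply: (le_trans (divr_scale_powR _ W1 (ltW s1))).
    by rewrite /G !mulrA.
  have h (x y g : R) : 2 * x * g + 4 * x * (2 * y * g) = x * ((2 + 8 * y) * g) by ring.
  by rewrite h.
have cb : c <= 24 * scale n `^ (1 - 2 * gamma).
  rewrite /c (_ : 24 = 6 * 4); last by lra.
  rewrite -mulrA ler_pM2l // ler_pdivrMr ?exprn_gt0 //.
  have -> : scale n `^ (1 - 2 * gamma) = scale n / (widths n * widths n).
    rewrite /widths scale_powRD -[X in X / _](powRr1 (ltW sn)) -powRN scale_powRD.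
    by congr (_ `^ _); lra.
  have w0 := widths_gt0 n; have tg := tau_ge n.
  have -> : 4 * (scale n / (widths n * widths n)) * tau n ^+ 2 =
    scale n * ((2 * tau n) * (2 * tau n) / (widths n * widths n)) by ring.
  rewrite ler_peMr ?(ltW sn) // ler_pdivlMr ?mulr_gt0 // mul1r.
  by apply: ler_pM; rewrite ?(ltW w0) //; lra.
have HB0 : 0 <= holder_bound sigma c (frc_lip widths n).
  exact: addr_ge0 (mulr_ge0 (ler0n _ 2) (ltW c0)) (mulr_ge0 (powR_ge0 _ _) (powR_ge0 _ _)).
have HB : holder_bound sigma c (frc_lip widths n) <= K * q ^+ n * scale n `^ (1 - 2 * gamma - sigma).
  apply: (le_trans HB1); apply: (@le_trans _ _ (24 * scale n `^ (1 - 2 * gamma) * ((2 + 8 * q) * G))).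
    rewrite ler_wpM2r // mulr_ge0 ?(le_trans ler01 G1) //.
    by rewrite addr_ge0 // mulr_ge0 // (le_trans ler01).
  have h (u v a b : R) : 24 * u * ((2 + 8 * b) * (a * v)) = 24 * (2 + 8 * b) * a * (u * v) by ring.
  by rewrite -(scale_powRD n (1 - 2 * gamma) (- sigma)) /G /K h.
rewrite -/c; have p0 : 0 <= 1 + sigma by rewrite addr_ge0 // ltW.
have W1 : 1 <= K * q ^+ n by rewrite mulr_ege1.
have W0 := le_trans ler01 W1.
apply: (@le_trans _ _ ((K * q ^+ n * scale n `^ (1 - 2 * gamma - sigma)) `^ (1 + sigma) * widths n)).
  apply: ler_pM; rewrite ?powR_ge0 ?(ltW tn) ?tau_le //.
  by apply: ge0_ler_powR; rewrite ?nnegrE // mulr_ge0 ?powR_ge0.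
rewrite powRM ?powR_ge0 // -powRrM -mulrA scale_powRD -/E.
apply: (@le_trans _ _ ((K * q ^+ n) * (K * q ^+ n) * scale n `^ E)).
  rewrite ler_wpM2r ?powR_ge0 //; apply: (@le_trans _ _ ((K * q ^+ n) `^ 2)).
    by apply: ler_powR => //; lra.
  by rewrite powR_mulrn // expr2.
have K0 : 0 <= K * K by rewrite mulr_ge0 // (le_trans ler01).
rewrite -[X in _ <= X]mulrA; have := ler_wpM2l K0 (hC n).
rewrite exprMn; apply: le_trans.
have h (u a b : R) : b * a * (b * a) * u = b * b * (u * (a * a)) by ring.
by rewrite h.
Qed.

End parameters.

(** * The initial datum and the theorem *)

Section initial_datum.
Context {R : realType}.
Implicit Types (x y v : space3 R).

(* A family containing the initial datum and stable under directional derivatives: the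
derivative of a sine is a sine with shifted phase. *)
Let wave (c d : R) x : 'rV[R]_3 := (c * sin (2 * pi * x.1.1 + d)) *: delta_mx 0 ord_max.

Let continuous_wave c d : continuous (wave c d).
Proof.
move=> x; apply: cvgZr_tmp; apply: cvgM; first exact: cvg_cst.
apply: (@continuous_comp2 _ _ _ (fun x : space3 R => 2 * pi * x.1.1 + d) sin); first by cont.
exact: continuous_sin.
Qed.

Let is_derive_wave c d x v :
  is_derive x v (wave c d) (wave (c * (2 * pi * v.1.1)) (d + pi / 2) x).
Proof.
apply: is_derive_cvg.
pose s (h : R) := c * sin (2 * pi * v.1.1 * h + (2 * pi * x.1.1 + d)).
have ds : is_derive (0 : R) 1 s (c * (2 * pi * v.1.1) * sin (2 * pi * x.1.1 + (d + pi / 2))).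
  pose l (h : R) := 2 * pi * v.1.1 * h + (2 * pi * x.1.1 + d).
  have d1 : is_derive (0 : R) 1 l (2 * pi * v.1.1) by exact: is_derive_affine.
  have d2 := @is_derive1_comp R sin l 0 _ _ (is_derive_sin (l 0)) d1.
  have d3 := is_deriveZ c d2.
  apply: is_derive_eq d3 _.
  rewrite /l mulr0 add0r addrA sinDpihalf /GRing.scale /=; ring.
have := is_deriveE ds => h.
rewrite (_ : (fun h => _) = (fun h : R => (h^-1 *: (s (h *: 1 + 0) - s 0)) *: delta_mx 0 ord_max)).
  by apply: cvgZr_tmp.
apply/funext => r; rewrite /wave -scalerBl scalerA; congr (_ *: _).
rewrite /s mulr0 add0r addr0; congr (_ * (_ - _)); congr (_ * sin _).
by rewrite /= /GRing.scale /=; ring.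
Qed.

Let wave_Ck n c d : Ck n (wave c d).
Proof.
elim: n c d => [|n IH] c d /=; first exact: continuous_wave.
split; first exact: continuous_wave.
move=> v; split; first by move=> x; case: (is_derive_wave c d x v).
have -> : 'D_v (wave c d) = wave (c * (2 * pi * v.1.1)) (d + pi / 2).
  by apply/funext => x; case: (is_derive_wave c d x v).
exact: IH.
Qed.

Lemma smooth_initial : smooth (initial (@theta0 R)).
Proof.
move=> n; have -> : initial (@theta0 R) = wave 1 0; last exact: wave_Ck.
apply/funext => x; apply/rowP => i; rewrite !mxE /theta0 addr0 mul1r eqxx /=.
by case: eqP => _; rewrite ?mulr1 ?mulr0.
Qed.

Lemma partial_invariant (f : space3 R -> R) i x :
  (forall r y, f (moved i r y) = f y) -> partial i f x = 0.
Proof.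
move=> fi; rewrite /partial /derive.
have -> : (fun h : R => h^-1 *: ((f \o shift x) (h *: unit_vec i) - f x)) = (fun=> 0).
  by apply/funext => h /=; rewrite [_ *: _ + x]addrC -movedE fi subrr scaler0.
by apply: lim_cst.
Qed.

Lemma div_initial (g : space3 R -> R) x : profile_ok g -> div (initial g) x = 0.
Proof.
move=> [_ _ g3]; rewrite /div big1 // => i _; apply: partial_invariant => r y.
by rewrite !mxE; case: eqP => // ->.
Qed.

Lemma initial_periodic (g : space3 R -> R) : torus_periodic g -> torus_periodic (initial g).
Proof. by move=> pg x i; apply/rowP => j; rewrite !mxE pg. Qed.

End initial_datum.

Theorem corollary1p4 (R : realType) (alpha' : R) (halpha' : 0 <= alpha' < 1) :
  exists (sigma : R) (F0 : R -> vfield R) (vin : vfield R),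
    [/\ 0 < sigma < 1,
        body_force 2 F0,
        LpC (1 + sigma) 2 sigma F0 &
        [/\ smooth vin, torus_periodic vin & forall x, div vin x = 0]] /\
    exists v1 v2 : R -> vfield R,
      [/\ [/\ weak_solution 2 F0 vin v1, admissible 2 F0 vin v1 &
              bounded_field 2 v1],
          [/\ weak_solution 2 F0 vin v2, admissible 2 F0 vin v2 &
              bounded_field 2 v2],
          ~ same_field 2 v1 v2 &
          LpC 1 2 alpha' v1].
Proof.
pose delta := widths alpha'.
have d0 : delta 0 = 1 := widths0 alpha'.
have dp n : 0 < delta n := widths_gt0 alpha' n.
have dl n : delta n.+1 < delta n := widths_lt halpha' n.
have dc : delta n @[n --> \oo] --> (0 : R) := widths_cvg halpha'.
have ts n : scale n <= 2 * tau delta n := widths_scale halpha' n.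
have tsum n : tau delta n <= 1 * 2^-1 ^+ n := widths_sum halpha' n.
have [CF fs] := force_sum halpha'.
have [CV vs] := vel_sum halpha' (ler0n R 2).
have [CG gs] := frc_sum halpha'.
have ot := @profile_theta0 R; have ob := @profile_beta R.
have bt y : `|theta0 y| <= 1 :> R by exact: theta0_bound.
have bb y : `|beta y| <= 1 :> R by apply: (le_trans (beta_bound y)); lra.
have sg := sigma_itv halpha'; have /andP[sg0 sg1] := sg.
exists (sigma alpha'), (force delta), (initial theta0); split; first split => //.
- exact: body_force_force.
- apply: (LpC_stagewise d0 dp dl dc (F := frc delta) (L := frc_lip delta)
    (c := fun n => 6 * (scale n / tau delta n ^+ 2)) _ _ _ _ _ _ _ gs).
  + by rewrite ltW.
  + by rewrite addr_ge0 // ltW.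
  + by move=> b n t p; exact: force_piece.
  + by move=> b n t p; apply: frc_controlled => //; exact: piece_closed p.
  + exact: frc_lip_ge0.
  + by move=> *; exact: frc_periodic.
  + by move=> *; exact: frc_moduli.
- split; [exact: smooth_initial|exact: initial_periodic (@theta0_periodic R)|].
  by move=> x; exact: div_initial.
exists (sol delta theta0 theta0), (sol delta theta0 beta); split.
- split.
  + by apply: (weak_solution_sol d0 dp dl dc ts fs tsum) (@matched_refl _ _) (cvg_cst _).
  + by apply: (admissible_sol d0 dp dl dc ts fs).
  + exact: (bounded_sol d0 dp dl dc ts).
- split.
  + by apply: (weak_solution_sol d0 dp dl dc ts fs tsum) (@matched_beta _) (@matched_beta_cvg _).
  + by apply: (admissible_sol d0 dp dl dc ts fs) (@cint_beta_theta0 _).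
  + exact: (bounded_sol d0 dp dl dc ts).
(* theta0 reaches its maximum 1 at x_1 = 1/4, while |beta| <= 7/16 *)
- have e : theta0 ((4^-1, 2^-1), 2^-1) = 1 :> R.
    by rewrite /theta0 /= (_ : 2 * pi * 4^-1 = pi / 2) ?sin_pihalf //; lra.
  apply: (not_same_sol d0 dp dl (x0 := ((4^-1, 2^-1), 2^-1))) => //=; try by apply/andP; split; lra.
  apply/eqP => E; have := @beta_bound R ((4^-1, 2^-1), 2^-1).
  by rewrite -E e normr1; lra.
- apply: (LpC_stagewise d0 dp dl dc (F := fun b n => vel delta b n theta0) (L := vel_lip 2)
    (c := fun n => 2 * 2 + 1) _ _ _ _ _ _ _ vs) => //.
  + by move=> b n t p; rewrite (sol_piece dp dl theta0 theta0 p); case: b p.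
  + by move=> b n t p; apply: vel_controlled => //; exact: piece_closed p.
  + by move=> n; exact: vel_lip_ge0.
  + by move=> *; exact: vel_periodic.
  + by move=> *; exact: vel_moduli.
Qed.
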